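(* Let $f\colon \mathbb{D} \to \mathbb{D}$ be an inner function and let $p \in \partial\mathbb{D}$ be a boundary Fatou point of $f$. (a) Assume $|f'(p)| < \infty$. Then $$\mu_p(f^{-1}(E)) = |f'(p)|\,\mu_{f(p)}(E)$$ for any measurable set $E \subseteq \partial\mathbb{D}$. (b) If $|f'(p)| = \infty$ and $E \subseteq \partial\mathbb{D}$ is a measurable set, then $\mu_p(f^{-1}(E)) = \infty$ if $\mu_{f(p)}(E) > 0$, and $\mu_p(f^{-1}(E)) = 0$ if $\mu_{f(p)}(E) = 0$.
   Context: $\mathbb{D}$ is the open unit disc of the complex plane, $\partial\mathbb{D}$ the unit circle, and $\lambda$ the normalized Lebesgue measure on $\partial\mathbb{D}$; ''measurable'' means Lebesgue measurable. An analytic map $f\colon\mathbb{D}\to\mathbb{D}$ is called inner if $\left|\lim_{r\to1}f(r\xi)\right|=1$ for almost every $\xi\in\partial\mathbb{D}$. It induces a map defined at almost every $\xi\in\partial\mathbb{D}$ by $f(\xi)=\lim_{r\to1}f(r\xi)$; for $E\subseteq\partial\mathbb{D}$, $f^{-1}(E)$ denotes the set of $\xi\in\partial\mathbb{D}$ at which this radial limit exists and belongs to $E$. A point $p\in\partial\mathbb{D}$ is a boundary Fatou point of $f$ if $f(p)=\lim_{r\to1}f(rp)$ exists and $f(p)\in\partial\mathbb{D}$. For $\beta>1$ and $p\in\partial\mathbb{D}$ let $\Gamma_\beta(p)=\{z\in\mathbb{D}: |z-p|<\beta(1-|z|)\}$ be the Stolz angle with vertex $p$. An analytic $f\colon\mathbb{D}\to\mathbb{D}$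 has finite angular derivative at $p\in\partial\mathbb{D}$ if there are $\eta\in\partial\mathbb{D}$ and $\beta>1$ such that the limit $$f'(p)=\lim_{\Gamma_\beta(p)\ni z\to p}\frac{\eta-f(z)}{p-z}$$ exists and is finite (in this case $\eta=f(p)$). One sets $|f'(p)|=+\infty$ if $f$ does not have a finite angular derivative at $p$. For $p\in\overline{\mathbb{D}}$, $\mu_p$ is the positive measure on $\partial\mathbb{D}$ (with values in $[0,\infty]$) given by $\mu_p(E)=\int_E\frac{1}{|\xi-p|^2}\,d\lambda(\xi)$ for measurable $E\subseteq\partial\mathbb{D}$. *)

(* Defs.v *)
From HB Require Import structures.
From mathcomp Require Import all_boot all_order all_algebra.
From mathcomp Require Import complex.
From mathcomp Require Import all_classical all_reals all_analysis.

Set Implicit Arguments.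
Unset Strict Implicit.
Unset Printing Implicit Defensive.

Import Order.TTheory GRing.Theory Num.Theory.
Import numFieldNormedType.Exports.

Local Open Scope classical_set_scope.
Local Open Scope complex_scope.
Local Open Scope ring_scope.

(* R[i] seen as an abstract numFieldType: this is what gives it its topology and
   its normed space structure over itself (so that derivable below means complex
   differentiable), without unification having to unfold the operations of
   R[i]. *)
Definition Cplx (R : realType) : numFieldType := R[i].

Definition unit_disc {R : realType} : set (Cplx R) := [set z | `|z| < 1].

Definition unit_circle {R : realType} : set (Cplx R) := [set z | `|z| = 1].

Section circle_measure.
Context {R : realType}.

Definition circle_param (t : R) : Cplx R :=
  Complex (cos (2 * pi * t)) (sin (2 * pi * t)).

(* R with the sigma-algebra of Lebesgue measurable sets, not just Borel ones. *)
Definition lebesgueTypeR : Type :=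
  caratheodory_type (wlength (R:=R) idfun)^*%mu.
HB.instance Definition _ := Measurable.on lebesgueTypeR.

(* The Lebesgue sigma-algebra of the circle, transported from `[0, 1[ along
   circle_param. Its elements are subsets of the whole plane of which only the
   trace on the circle matters. *)
Definition circle_sigma_algebra : set (set (Cplx R)) :=
  image_set_system `[0, 1[%classic circle_param
    (@measurable _ lebesgueTypeR).

Definition circleType : Type := g_sigma_algebraType circle_sigma_algebra.
HB.instance Definition _ := Measurable.on circleType.

(* Normalized arc length: the image of the completed Lebesgue measure of
   `[0, 1[ under circle_param. *)
Definition circle_measure (E : set circleType) : \bar R :=
  completed_lebesgue_measure (`[0, 1[%classic `&` circle_param @^-1` E).

Let measurable_I01 : @measurable _ lebesgueTypeR `[0, 1[%classic.
Proof.
apply: sub_caratheodory.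
exact: (@measurable_itv R `[0, 1[).
Qed.

Lemma circle_measurableE (E : set circleType) :
  measurable E =
  @measurable _ lebesgueTypeR (`[0, 1[%classic `&` circle_param @^-1` E).
Proof.
have /sigma_algebra_id H : sigma_algebra setT circle_sigma_algebra.
  apply: sigma_algebra_image; split; first exact: measurable0.
    by move=> A mA; exact: measurableD.
  by move=> F mF; exact: bigcupT_measurable.
by rewrite {1}/measurable /= H.
Qed.

Let circle_measure0 : circle_measure set0 = 0%E.
Proof. by rewrite /circle_measure preimage_set0 setI0 measure0. Qed.

Let circle_measure_ge0 E : (0 <= circle_measure E)%E.
Proof. exact: measure_ge0. Qed.

Let circle_measure_sigma_additive : semi_sigma_additive circle_measure.
Proof.
move=> F mF tF mUF; rewrite /circle_measure preimage_bigcup setI_bigcupr.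
apply: measure_semi_sigma_additive.
- by move=> n; have := mF n; rewrite circle_measurableE.
- apply/trivIsetP => /= i j _ _ ij; apply/seteqP; split => // t [[_ Fit] [_ Fjt]].
  move/trivIsetP : tF => /(_ i j Logic.I Logic.I ij) FiFj.
  have : (F i `&` F j) (circle_param t) by split.
  by rewrite FiFj.
- by move: mUF; rewrite circle_measurableE preimage_bigcup setI_bigcupr.
Qed.

HB.instance Definition _ := isMeasure.Build _ _ _ circle_measure
  circle_measure0 circle_measure_ge0 circle_measure_sigma_additive.

End circle_measure.
Arguments lebesgueTypeR : clear implicits.
Arguments circleType : clear implicits.

Section inner_functions.
Context {R : realType}.
Implicit Types (f : Cplx R -> Cplx R) (p xi : Cplx R) (E : set (Cplx R)).

Definition has_radial_limit f xi : Prop :=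
  cvg (f (r%:C * xi) @[r --> (1 : R)^'-]).

(* The boundary value f(xi); meaningful only when has_radial_limit f xi. *)
Definition radial_limit f xi : Cplx R :=
  lim (f (r%:C * xi) @[r --> (1 : R)^'-]).

(* f is a total function, but only its values on the unit disc matter:
   derivable f z 1 depends only on f near z. *)
Definition analytic_self_map f : Prop :=
  forall z, unit_disc z -> derivable f z 1 /\ unit_disc (f z).

Definition inner f : Prop :=
  analytic_self_map f /\
  {ae @circle_measure R, forall xi, unit_circle xi ->
     has_radial_limit f xi /\ `|radial_limit f xi| = 1}.

Definition boundary_preimage f E : set (Cplx R) :=
  [set xi | [/\ unit_circle xi, has_radial_limit f xi & E (radial_limit f xi)]].

Definition boundary_Fatou_point f p : Prop :=
  [/\ unit_circle p, has_radial_limit f p & unit_circle (radial_limit f p)].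

Definition stolz_angle (beta : R) p : set (Cplx R) :=
  [set z | unit_disc z /\ `|z - p| < beta%:C * (1 - `|z|)].

Definition is_angular_derivative f p (l : Cplx R) : Prop :=
  exists eta : Cplx R, exists beta : R, [/\ unit_circle eta, 1 < beta &
    (eta - f z) / (p - z) @[z --> within (stolz_angle beta p) (nbhs p)] --> l].

(* |f'(p)| in [0, +oo]. For p on the circle the angular derivative, if any, is
   unique and independent of eta and beta: every Stolz angle contains the end
   of the radius at p. *)
Definition abs_angular_derivative f p : \bar R :=
  if `[< exists l, is_angular_derivative f p l >]
  then (Normc.normc (get (is_angular_derivative f p)))%:E else +oo%E.

Definition lebesgue_measurable E : Prop :=
  E `<=` unit_circle /\ measurable (E : set (circleType R)).

(* mu_p. When p is on the circle, the value 0^-1 = 0 of the density at xi = p is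
   irrelevant since points are circle_measure-null. *)
Definition mu p E : \bar R :=
  (\int[circle_measure]_(xi in (E : set (circleType R)))
     ((Normc.normc ((xi : Cplx R) - p) ^+ 2)^-1)%:E)%E.

End inner_functions.

(* Main.v *)
(** For z in the disc let w_z(E) be the harmonic measure of E seen from z, i.e.
the integral over E of the Poisson kernel (1 - |z|^2) / |xi - z|^2. An inner f
satisfies w_z(f^{-1}(E)) = w_{f(z)}(E). Indeed x |-> w_{f(r x)}(C) has the
Poisson representation w_{f(r z)}(C) = int w_{f(r x)}(C) P_z(x) dx; as r -> 1,
Fatou's lemma applied to the complement of a closed set C, near which the
boundary values determine w_{f(r x)}, gives an inequality for closed sets, inner
regularity extends it to all measurable sets, and the inequalities for E and
its complement add up to an equality.

Since w_z = (1 - |z|^2) mu_z, the invariance at z = r p reads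
mu_{rp}(f^{-1}(E)) = q(r) mu_{f(rp)}(E) with q(r) = (1 - |f(rp)|^2) / (1 - r^2),
and r -> 1 gives the theorem: by the Julia-Caratheodory theorem q(r) tends to
|f'(p)| in [0, +oo], and when |f'(p)| is finite f(rp) tends to f(p) inside a
Stolz angle, in which the densities of mu are dominated by the one at the
vertex.

The Julia-Caratheodory theorem comes from the two-point Pick inequality for
functions of positive real part. That inequality, the Poisson formula and the
Cauchy formula on the circle only need Goursat's argument on a rectangle, used
in polar coordinates. *)

From HB Require Import structures.
From mathcomp Require Import all_boot all_order all_algebra.
From mathcomp Require Import complex.
From mathcomp Require Import ring lra.
From mathcomp Require Import all_classical all_reals all_analysis.
From mathcomp Require Import measurable_realfun.
Require Import Defs.

Set Implicit Arguments.
Unset Strict Implicit.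
Unset Printing Implicit Defensive.

Import Order.TTheory GRing.Theory Num.Theory.
Import numFieldNormedType.Exports.

Local Open Scope classical_set_scope.
Local Open Scope ring_scope.

(** * Goursat's lemma on a rectangle *)

(** Two difficulties shape the proof. Measurability of the preimage of [E] is not known in advance,
    so each one-sided inequality produces a measurable set inside the preimage of [E] or of its
    complement; these two sets exhaust the circle up to a null set, and completeness of the Lebesgue
    sigma-algebra settles measurability together with equality. Moreover, an infinite angular
    derivative has to force the whole quotient q(r) to diverge. The Julia-Caratheodory theorem is
    therefore stated under a bound of the quotient at infinitely many radii only: the failure of all
    such bounds is exactly divergence. The identity is exact at each interior radius, but either
    measure at the boundary may be infinite. For a finite derivative, Fatou's lemma carries
    finiteness from one side to the other, and dominated convergence computes the limit once both
    are finite; for an infinite one, a lower bound of the density by 1/4 is enough. *)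

Section goursat.
Context {R : realType}.
Notation leb := (@lebesgue_measure R).
Implicit Types (P Q : R -> R -> R) (a b c d e : R).

Lemma nested_interval_point (u v : R^nat) :
  {homo u : n m / (n <= m)%N >-> n <= m} ->
  {homo v : n m / (n <= m)%N >-> n >= m} ->
  (forall n, u n <= v n) -> exists x, forall n, u n <= x <= v n.
Proof.
move=> ui vd uv; exists (sup (range u)) => n.
have le_uv m k : u m <= v k.
  apply: (@le_trans _ _ (u (maxn m k))); first by apply: ui; exact: leq_maxl.
  by apply: (le_trans (uv _)); apply: vd; exact: leq_maxr.
have hs : has_sup (range u).
  by split; [exists (u 0%N), 0%N | exists (v 0%N) => _ [m _ <-]].
apply/andP; split; first by apply: sup_ubound; [case: hs | exists n].
by apply: ge_sup => [|_ [m _ <-]]; [exists (u 0%N), 0%N | ].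
Qed.

(** The counterclockwise integral of [P dx + Q dy] along the boundary. Opposite sides share one
    integral, so that the affine parts of [P] and [Q] cancel visibly in [rect_circulation_small]. *)
Definition rect_circulation P Q a b c d : R :=
  \int[leb]_(x in `[a, b]) (P x c - P x d) +
  \int[leb]_(y in `[c, d]) (Q b y - Q a y).

Definition rect_integrable P Q a b c d :=
  (forall y, y \in `[c, d] -> leb.-integrable `[a, b] (EFin \o P^~ y)) /\
  (forall x, x \in `[a, b] -> leb.-integrable `[c, d] (EFin \o Q x)).

Let integrable_sub (g : R -> R) a b c d : a <= c -> d <= b ->
  leb.-integrable `[a, b] (EFin \o g) -> leb.-integrable `[c, d] (EFin \o g).
Proof.
move=> ac db; apply: integrableS; [exact: measurable_itv|exact: measurable_itv|].
by apply: subset_itv; rewrite bnd_simp.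
Qed.

Lemma rect_integrableS P Q a b c d a' b' c' d' :
  a <= a' -> b' <= b -> c <= c' -> d' <= d ->
  rect_integrable P Q a b c d -> rect_integrable P Q a' b' c' d'.
Proof.
move=> aa bb cc dd [iP iQ]; split=> z /[!in_itv]/= /andP[? ?].
- by apply: integrable_sub (iP z _); rewrite // in_itv /=; apply/andP; split; lra.
- by apply: integrable_sub (iQ z _); rewrite // in_itv /=; apply/andP; split; lra.
Qed.

Let Rintegral_split (g : R -> R) a m b : a <= m -> m <= b ->
  leb.-integrable `[a, b] (EFin \o g) ->
  \int[leb]_(x in `[a, b]) g x =
  \int[leb]_(x in `[a, m]) g x + \int[leb]_(x in `[m, b]) g x.
Proof.
move=> am mb ig.
have := @Rintegral_itvB R g (BLeft a) (BRight b) m ig.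
rewrite !bnd_simp => /(_ am mb).
rewrite Rintegral_itv_obnd_cbnd; first by move=> <-; rewrite addrC subrK.
apply: integrableS ig; [exact: measurable_itv|exact: measurable_itv|].
by apply: subset_itv; rewrite bnd_simp.
Qed.

Let integrable_pm (g h : R -> R) a b :
  leb.-integrable `[a, b] (EFin \o g) -> leb.-integrable `[a, b] (EFin \o h) ->
  leb.-integrable `[a, b] (EFin \o (fun x => g x - h x)).
Proof.
move=> ig ih.
by have := @integrableB _ _ R leb `[a, b] (measurable_itv _) _ _ ig ih.
Qed.

Lemma rect_circulation_quarter P Q a m b c n d :
  a <= m -> m <= b -> c <= n -> n <= d -> rect_integrable P Q a b c d ->
  rect_circulation P Q a b c d =
    rect_circulation P Q a m c n + rect_circulation P Q a m n d +
    (rect_circulation P Q m b c n + rect_circulation P Q m b n d).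
Proof.
move=> am mb cn nd [iP iQ]; rewrite /rect_circulation.
have [aa bb mm] : [/\ a \in `[a, b], b \in `[a, b] & m \in `[a, b]].
  by rewrite !in_itv /=; split; apply/andP; split; lra.
have [cc dd nn] : [/\ c \in `[c, d], d \in `[c, d] & n \in `[c, d]].
  by rewrite !in_itv /=; split; apply/andP; split; lra.
rewrite (Rintegral_split am mb); last by apply: integrable_pm; exact: iP.
rewrite (Rintegral_split cn nd); last by apply: integrable_pm; exact: iQ.
have iP1 y : y \in `[c, d] -> leb.-integrable `[a, m] (EFin \o P^~ y).
  by move=> /iP; exact: integrable_sub.
have iP2 y : y \in `[c, d] -> leb.-integrable `[m, b] (EFin \o P^~ y).
  by move=> /iP; exact: integrable_sub.
have iQ1 y : y \in `[a, b] -> leb.-integrable `[c, n] (EFin \o Q y).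
  by move=> /iQ; exact: integrable_sub.
have iQ2 y : y \in `[a, b] -> leb.-integrable `[n, d] (EFin \o Q y).
  by move=> /iQ; exact: integrable_sub.
rewrite !RintegralB //; do ?[exact: iP1 | exact: iP2 | exact: iQ1 | exact: iQ2].
ring.
Qed.

(* The common coefficient p2 = dP/dy = dQ/dx says that P dx + Q dy is closed at
   (x0, y0); no continuity of the partial derivatives is assumed. *)
Definition closed_form_at P Q a b c d x0 y0 :=
  exists p1 p2 q2 : R, forall e, 0 < e -> exists2 dl, 0 < dl &
    forall x y, a <= x <= b -> c <= y <= d -> `|x - x0| < dl -> `|y - y0| < dl ->
      `|P x y - P x0 y0 - p1 * (x - x0) - p2 * (y - y0)| <=
          e * (`|x - x0| + `|y - y0|) /\
      `|Q x y - Q x0 y0 - p2 * (x - x0) - q2 * (y - y0)| <=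
          e * (`|x - x0| + `|y - y0|).

Let Rintegral_near_const (g : R -> R) a b k e : a <= b ->
  leb.-integrable `[a, b] (EFin \o g) ->
  (forall x, a <= x <= b -> `|g x - k| <= e) ->
  `|\int[leb]_(x in `[a, b]) g x - k * (b - a)| <= e * (b - a).
Proof.
move=> ab ig gk.
have cst_itv r : \int[leb]_(x in `[a, b]) r = r * (b - a).
  rewrite Rintegral_cst; last exact: measurable_itv.
  rewrite /= lebesgue_measure_itv /= lte_fin.
  by move: ab; rewrite le_eqVlt => /orP[/eqP->|->]; rewrite ?ltxx ?subrr.
have icst r : leb.-integrable `[a, b] (EFin \o (fun _ : R => r)).
  apply: continuous_compact_integrable; first exact: segment_compact.
  by apply: continuous_subspaceT => x; exact: cvg_cst.
rewrite -(cst_itv k).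
have /= <- := @RintegralB _ _ _ leb `[a, b] g (fun=> k) (measurable_itv _) ig (icst k).
apply: le_trans (le_normr_Rintegral _ _) _; first exact: measurable_itv.
  exact: integrable_pm.
rewrite -(cst_itv e); apply: le_Rintegral; first exact: measurable_itv.
- by apply: integrable_norm; exact: integrable_pm.
- exact: icst.
- by move=> x; rewrite /= in_itv /= => /gk.
Qed.

(** The affine approximations contribute [p2 * (c' - d') * (b' - a')] and
    [p2 * (b' - a') * (d' - c')], which add up to 0 because [p2] is common to [P] and [Q]. Only the
    errors remain, and each integrand is a difference of two values: hence the factor 2. *)
Lemma rect_circulation_small P Q a b c d a' b' c' d' x0 y0 p1 p2 q2 e :
  a <= a' -> b' <= b -> c <= c' -> d' <= d -> a' <= b' -> c' <= d' ->
  a' <= x0 <= b' -> c' <= y0 <= d' -> 0 <= e ->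
  rect_integrable P Q a b c d ->
  (forall x y, a' <= x <= b' -> c' <= y <= d' ->
      `|P x y - P x0 y0 - p1 * (x - x0) - p2 * (y - y0)| <=
          e * (`|x - x0| + `|y - y0|) /\
      `|Q x y - Q x0 y0 - p2 * (x - x0) - q2 * (y - y0)| <=
          e * (`|x - x0| + `|y - y0|)) ->
  `|rect_circulation P Q a' b' c' d'| <= 2 * e * ((b' - a') + (d' - c')) ^+ 2.
Proof.
move=> aa bb cc dd ab cd hx0 hy0 e0 iPQ H.
have [iP iQ] := rect_integrableS aa bb cc dd iPQ.
have H' x y : a' <= x <= b' -> c' <= y <= d' ->
    `|P x y - P x0 y0 - p1 * (x - x0) - p2 * (y - y0)| <=
      e * ((b' - a') + (d' - c')) /\
    `|Q x y - Q x0 y0 - p2 * (x - x0) - q2 * (y - y0)| <=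
      e * ((b' - a') + (d' - c')).
  move=> hx hy; have [h1 h2] := H x y hx hy.
  have le : e * (`|x - x0| + `|y - y0|) <= e * ((b' - a') + (d' - c')).
    by rewrite ler_wpM2l // lerD // ler_norml; apply/andP; split; lra.
  by split; [exact: le_trans h1 le|exact: le_trans h2 le].
set L := (b' - a') + (d' - c') in H' *.
have E1 : `|\int[leb]_(x in `[a', b']) (P x c' - P x d') - p2 * (c' - d') * (b' - a')|
    <= 2 * e * L * (b' - a').
  apply: Rintegral_near_const => //.
    by apply: integrable_pm; apply: iP; rewrite in_itv /= lexx ?cd.
  move=> x hx; have [h1 _] := H' x c' hx ltac:(by rewrite lexx cd).
  have [h2 _] := H' x d' hx ltac:(by rewrite lexx cd).
  by move: h1 h2; rewrite !ler_norml => /andP[? ?] /andP[? ?]; apply/andP; split; lra.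
have E2 : `|\int[leb]_(y in `[c', d']) (Q b' y - Q a' y) - p2 * (b' - a') * (d' - c')|
    <= 2 * e * L * (d' - c').
  apply: Rintegral_near_const => //.
    by apply: integrable_pm; apply: iQ; rewrite in_itv /= lexx ?ab.
  move=> y hy; have [_ h1] := H' b' y ltac:(by rewrite lexx ab) hy.
  have [_ h2] := H' a' y ltac:(by rewrite lexx ab) hy.
  by move: h1 h2; rewrite !ler_norml => /andP[? ?] /andP[? ?]; apply/andP; split; lra.
rewrite /rect_circulation; move: E1 E2.
set I1 := Rintegral _ _ _; set I2 := Rintegral _ _ _.
have -> : 2 * e * L ^+ 2 = 2 * e * L * (b' - a') + 2 * e * L * (d' - c').
  by rewrite -mulrDr expr2 mulrA.
move: (2 * e * L * (b' - a')) (2 * e * L * (d' - c')) => X Y.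
by rewrite !ler_norml => /andP[? ?] /andP[? ?]; apply/andP; split; lra.
Qed.

Lemma goursat_rectangle P Q a b c d : a <= b -> c <= d ->
  rect_integrable P Q a b c d ->
  (forall x y, a <= x <= b -> c <= y <= d -> closed_form_at P Q a b c d x y) ->
  rect_circulation P Q a b c d = 0.
Proof.
move=> ab cd iPQ H.
pose h1 n : R := (b - a) / 2 ^+ n; pose h2 n : R := (d - c) / 2 ^+ n.
have h1S n : h1 n = h1 n.+1 + h1 n.+1.
  by rewrite /h1 exprS; field; rewrite expf_neq0 //; lra.
have h2S n : h2 n = h2 n.+1 + h2 n.+1.
  by rewrite /h2 exprS; field; rewrite expf_neq0 //; lra.
have h1ge n : 0 <= h1 n by rewrite /h1 divr_ge0 ?exprn_ge0 //; lra.
have h2ge n : 0 <= h2 n by rewrite /h2 divr_ge0 ?exprn_ge0 //; lra.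
pose C n (p : R * R) := rect_circulation P Q p.1 (p.1 + h1 n) p.2 (p.2 + h2 n).
pose inR n (p : R * R) := [/\ a <= p.1, p.1 + h1 n <= b, c <= p.2 & p.2 + h2 n <= d].
(* A quarter that carries at least a quarter of the circulation. The implication stands under the
   existential so that [nxt] is a total function. *)
have step n p : exists q : R * R, inR n p ->
    [/\ p.1 <= q.1 <= p.1 + h1 n.+1, p.2 <= q.2 <= p.2 + h2 n.+1 &
        `|C n p| <= 4 * `|C n.+1 q|].
  have [[ap pb cp pd]|nR] := pselect (inR n p); last by exists p => /nR.
  have := @rect_circulation_quarter P Q p.1 (p.1 + h1 n.+1) (p.1 + h1 n)
    p.2 (p.2 + h2 n.+1) (p.2 + h2 n).
  have := h1ge n.+1; have := h2ge n.+1; have := h1S n; have := h2S n => e2 e1 g2 g1.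
  move=> /(_ ltac:(lra) ltac:(lra) ltac:(lra) ltac:(lra)
    (rect_integrableS ap pb cp pd iPQ)) E.
  pose q1 := p; pose q2 : R * R := (p.1, p.2 + h2 n.+1).
  pose q3 : R * R := (p.1 + h1 n.+1, p.2).
  pose q4 : R * R := (p.1 + h1 n.+1, p.2 + h2 n.+1).
  have {}E : C n p = C n.+1 q1 + C n.+1 q2 + (C n.+1 q3 + C n.+1 q4).
    by rewrite /C E /= -!addrA -e1 -e2.
  have : `|C n p| <= 4 * `|C n.+1 q1| \/ `|C n p| <= 4 * `|C n.+1 q2| \/
         `|C n p| <= 4 * `|C n.+1 q3| \/ `|C n p| <= 4 * `|C n.+1 q4|.
    have T : `|C n p| <= `|C n.+1 q1| + `|C n.+1 q2| + (`|C n.+1 q3| + `|C n.+1 q4|).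
      rewrite E; apply: (le_trans (ler_normD _ _)).
      by apply: lerD; exact: ler_normD.
    case: (lerP `|C n p| (4 * `|C n.+1 q1|)) => k1; first by left.
    case: (lerP `|C n p| (4 * `|C n.+1 q2|)) => k2; first by right; left.
    case: (lerP `|C n p| (4 * `|C n.+1 q3|)) => k3; first by right; right; left.
    right; right; right; lra.
  by move=> [|[|[|]]] k; [exists q1|exists q2|exists q3|exists q4] => _; split => //=;
    apply/andP; split; lra.
pose nxt n p := projT1 (cid (step n p)).
have nxtP n p : inR n p -> [/\ p.1 <= (nxt n p).1 <= p.1 + h1 n.+1,
    p.2 <= (nxt n p).2 <= p.2 + h2 n.+1 & `|C n p| <= 4 * `|C n.+1 (nxt n p)|].
  by rewrite /nxt; case: cid.
pose u := fix u n : R * R := if n is m.+1 then nxt m (u m) else (a, c).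
have uS n : u n.+1 = nxt n (u n) by [].
have uR n : inR n (u n).
  elim: n => [|n IH]; first by rewrite /inR /h1 /h2 /= expr0 !divr1; split; lra.
  have [/andP[? ?] /andP[? ?] _] := nxtP n _ IH; case: IH => ? ? ? ?.
  by rewrite /inR uS; have := h1S n; have := h2S n; split; lra.
have uC n : `|C 0%N (a, c)| <= 4 ^+ n * `|C n (u n)|.
  elim: n => [|n IH]; first by rewrite expr0 mul1r.
  have [_ _ k] := nxtP n _ (uR n); apply: (le_trans IH).
  by rewrite exprSr -mulrA ler_wpM2l ?exprn_ge0.
have [x0 hx0] : exists x, forall n, (u n).1 <= x <= (u n).1 + h1 n.
  apply: nested_interval_point => [||n]; last by rewrite lerDl.
  - apply: homo_leq => [x|x y z|n]; [exact: lexx|exact: le_trans|].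
    by have [/andP[]] := nxtP n _ (uR n).
  - apply: (@homo_leq _ _ (fun x y => y <= x)) => [x|x y z|n]; [exact: lexx|exact: ge_trans|].
    by have [/andP[? ?]] := nxtP n _ (uR n); rewrite uS; have := h1S n; lra.
have [y0 hy0] : exists x, forall n, (u n).2 <= x <= (u n).2 + h2 n.
  apply: nested_interval_point => [||n]; last by rewrite lerDl.
  - apply: homo_leq => [x|x y z|n]; [exact: lexx|exact: le_trans|].
    by have [_ /andP[]] := nxtP n _ (uR n).
  - apply: (@homo_leq _ _ (fun x y => y <= x)) => [x|x y z|n]; [exact: lexx|exact: ge_trans|].
    by have [_ /andP[? ?]] := nxtP n _ (uR n); rewrite uS; have := h2S n; lra.
have ->: rect_circulation P Q a b c d = C 0%N (a, c).
  by rewrite /C /h1 /h2 /= expr0 !divr1 ![_ + (_ - _)]addrC !subrK.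
have x0ab : a <= x0 <= b by have := hx0 0%N; rewrite /h1 /= expr0 divr1; lra.
have y0cd : c <= y0 <= d by have := hy0 0%N; rewrite /h2 /= expr0 divr1; lra.
have [p1 [p2 [q2 D]]] := H x0 y0 x0ab y0cd.
apply/eqP; rewrite -normr_le0; apply/ler_addgt0Pr => e e0; rewrite add0r.
pose L := (b - a) + (d - c).
have L0 : 0 <= L by rewrite /L; lra.
have LL : 0 < 2 * (L ^+ 2 + 1) by have := sqr_ge0 L; lra.
(* The factor [4 ^+ n] cancels against the square of [L / 2 ^+ n], so the final bound is
   [e * (L ^+ 2 / (L ^+ 2 + 1))]; adding 1 covers the degenerate case [L = 0]. *)
have e'0 : 0 < e / (2 * (L ^+ 2 + 1)) by rewrite divr_gt0.
have [dl dl0 {}D] := D _ e'0.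
have [n hn] : exists n, L / 2 ^+ n < dl.
  have := @cvg_geometric R L (1 / 2).
  rewrite ger0_norm; last lra.
  move=> /(_ ltac:(lra)) /cvgrPdist_lt /(_ _ dl0) [n _ /(_ n (leqnn n))].
  rewrite /geometric /= sub0r normrN ger0_norm; last by rewrite mulr_ge0 ?exprn_ge0; lra.
  by rewrite div1r exprVn => ?; exists n.
have hL : h1 n + h2 n = L / 2 ^+ n by rewrite /h1 /h2 /L; ring.
have [ua ub uc ud] := uR n.
have hx := hx0 n; have hy := hy0 n.
have := h1ge n; have := h2ge n => g2 g1.
have := @rect_circulation_small P Q a b c d (u n).1 ((u n).1 + h1 n) (u n).2
  ((u n).2 + h2 n) x0 y0 p1 p2 q2 _ ua ub uc ud ltac:(lra) ltac:(lra) hx hy (ltW e'0) iPQ.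
move=> /(_ ltac:(move=> x y hx1 hy1; apply: D; rewrite ?ltr_norml; lra)).
rewrite -/(C n (u n)).
have -> : (u n).1 + h1 n - (u n).1 + ((u n).2 + h2 n - (u n).2) = L / 2 ^+ n.
  by rewrite -hL; ring.
move=> K; apply: (le_trans (uC n)).
apply: (@le_trans _ _ (4 ^+ n * (2 * (e / (2 * (L ^+ 2 + 1))) * (L / 2 ^+ n) ^+ 2))).
  by rewrite ler_wpM2l // exprn_ge0.
have -> : 4 ^+ n * (2 * (e / (2 * (L ^+ 2 + 1))) * (L / 2 ^+ n) ^+ 2)
    = e * (L ^+ 2 / (L ^+ 2 + 1)).
  have -> : (4 : R) = 2 ^+ 2 by ring.
  rewrite -exprM mulnC exprM.
  by field; rewrite expf_neq0 //=; have := sqr_ge0 L; lra.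
apply: ler_piMr; first exact: ltW.
by rewrite ler_pdivrMr ?mul1r; have := sqr_ge0 L; lra.
Qed.

End goursat.

(** * Complex numbers *)

Section complex_numbers.
Context {R : realType}.
Implicit Types (z w u : Cplx R) (r s : R).

Definition re z : R := complex.Re z.
Definition im z : R := complex.Im z.
Definition conj z : Cplx R := conjc z.
(** The norm of [Cplx R] is itself complex-valued. [cabs] is its real value, which lets all
    estimates take place in [R]. *)
Definition cabs z : R := Normc.normc z.
Definition ofR r : Cplx R := real_complex R r.

Lemma cplx_eqP z w : re z = re w -> im z = im w -> z = w.
Proof. by case: z w => [a b] [c d] /= -> ->. Qed.

Lemma reD z w : re (z + w) = re z + re w. Proof. by case: z w => [? ?] [? ?]. Qed.
Lemma imD z w : im (z + w) = im z + im w. Proof. by case: z w => [? ?] [? ?]. Qed.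
Lemma reN z : re (- z) = - re z. Proof. by case: z. Qed.
Lemma imN z : im (- z) = - im z. Proof. by case: z. Qed.
Lemma reM z w : re (z * w) = re z * re w - im z * im w.
Proof. by case: z w => [? ?] [? ?]. Qed.
Lemma imM z w : im (z * w) = re z * im w + im z * re w.
Proof. by case: z w => [? ?] [? ?]. Qed.
Lemma re0 : re 0 = 0. Proof. by []. Qed.
Lemma im0 : im 0 = 0. Proof. by []. Qed.
Lemma re1 : re 1 = 1. Proof. by []. Qed.
Lemma im1 : im 1 = 0. Proof. by []. Qed.
Lemma re_ofR r : re (ofR r) = r. Proof. by []. Qed.
Lemma im_ofR r : im (ofR r) = 0. Proof. by []. Qed.
Lemma re_conj z : re (conj z) = re z. Proof. by case: z. Qed.
Lemma im_conj z : im (conj z) = - im z. Proof. by case: z. Qed.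
Definition cplxE := (reD, imD, reN, imN, reM, imM, re0, im0, re1, im1, re_ofR,
  im_ofR, re_conj, im_conj).

Lemma ofRD r s : ofR (r + s) = ofR r + ofR s.
Proof. by apply: cplx_eqP; rewrite !cplxE; ring. Qed.
Lemma ofRN r : ofR (- r) = - ofR r.
Proof. by apply: cplx_eqP; rewrite !cplxE; ring. Qed.
Lemma ofRM r s : ofR (r * s) = ofR r * ofR s.
Proof. by apply: cplx_eqP; rewrite !cplxE; ring. Qed.
Lemma ofR1 : ofR 1 = 1. Proof. by []. Qed.
Lemma ofR0 : ofR 0 = 0. Proof. by []. Qed.
Lemma ofRV r : ofR r^-1 = (ofR r)^-1.
Proof.
have [->|r0] := eqVneq r 0; first by rewrite invr0 ofR0 invr0.
apply: (mulIf (x := ofR r)); first by apply: contra_neq r0 => /(congr1 re).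
rewrite mulVf; last by apply: contra_neq r0 => /(congr1 re).
by rewrite -ofRM mulVf.
Qed.

Lemma conjD z w : conj (z + w) = conj z + conj w.
Proof. by apply: cplx_eqP; rewrite !cplxE; ring. Qed.
Lemma conjN z : conj (- z) = - conj z.
Proof. by apply: cplx_eqP; rewrite !cplxE; ring. Qed.
Lemma conjM z w : conj (z * w) = conj z * conj w.
Proof. by apply: cplx_eqP; rewrite !cplxE; ring. Qed.
Lemma conjK z : conj (conj z) = z.
Proof. by apply: cplx_eqP; rewrite !cplxE; ring. Qed.
Lemma conj1 : conj 1 = 1. Proof. by apply: cplx_eqP; rewrite !cplxE ?oppr0. Qed.
Lemma conj0 : conj 0 = 0. Proof. by apply: cplx_eqP; rewrite !cplxE ?oppr0. Qed.
Lemma conj_ofR r : conj (ofR r) = ofR r.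
Proof. by apply: cplx_eqP; rewrite !cplxE ?oppr0. Qed.
Lemma conj_eq0 z : (conj z == 0) = (z == 0).
Proof.
by apply/eqP/eqP => [/(congr1 conj)|->]; rewrite ?conjK conj0.
Qed.
Lemma conjV z : conj z^-1 = (conj z)^-1.
Proof.
have [->|z0] := eqVneq z 0; first by rewrite invr0 conj0 invr0.
have z0' : conj z != 0 by rewrite conj_eq0.
by apply: (mulIf z0'); rewrite -conjM !mulVf // conj1.
Qed.

Lemma norm_cabs z : `|z| = ofR (cabs z) :> Cplx R. Proof. by []. Qed.
Lemma cabs_sqr z : cabs z ^+ 2 = re z ^+ 2 + im z ^+ 2.
Proof.
rewrite /cabs /Normc.normc /re /im; case: z => a b /=.
by rewrite sqr_sqrtr // addr_ge0 ?sqr_ge0.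
Qed.
Lemma mul_conj z : z * conj z = ofR (cabs z ^+ 2).
Proof. by rewrite cabs_sqr; apply: cplx_eqP; rewrite !cplxE; ring. Qed.
Lemma cabs_ge0 z : 0 <= cabs z.
Proof. by case: z => a b; rewrite /cabs /= sqrtr_ge0. Qed.
Lemma cabs0 : cabs 0 = 0. Proof. exact: Normc.normc0. Qed.
Lemma cabs1 : cabs 1 = 1. Proof. exact: Normc.normc1. Qed.
Lemma cabs_eq0 z : (cabs z == 0) = (z == 0).
Proof. by apply/eqP/eqP => [/Normc.eq0_normc//|->]; exact: cabs0. Qed.
Lemma cabs_gt0 z : (0 < cabs z) = (z != 0).
Proof. by rewrite lt_def cabs_ge0 andbT cabs_eq0. Qed.
Lemma cabsM z w : cabs (z * w) = cabs z * cabs w. Proof. exact: Normc.normcM. Qed.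
Lemma cabsV z : cabs z^-1 = (cabs z)^-1. Proof. exact: Normc.normcV. Qed.
Lemma cabsN z : cabs (- z) = cabs z. Proof. exact: normcN. Qed.
Lemma cabsD z w : cabs (z + w) <= cabs z + cabs w. Proof. exact: le_normcD. Qed.
Lemma cabsB z w : cabs (z - w) = cabs (w - z). Proof. by rewrite -cabsN opprB. Qed.
Lemma cabs_tri u z w : cabs (z - w) <= cabs (z - u) + cabs (u - w).
Proof. by apply: le_trans (cabsD _ _); rewrite addrA subrK. Qed.
Lemma cabs_lip z w : `|cabs z - cabs w| <= cabs (z - w).
Proof.
have h1 := cabs_tri w z 0; have h2 := cabs_tri z w 0; have h3 := cabsB w z.
by move: h1 h2; rewrite !subr0 h3 ler_norml => ? ?; apply/andP; split; lra.
Qed.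
Lemma cabs_sub_ge z w : cabs z - cabs w <= cabs (z - w).
Proof. exact: le_trans (ler_norm _) (cabs_lip z w). Qed.
Lemma cabs_conj z : cabs (conj z) = cabs z.
Proof.
by apply/eqP; rewrite -(@eqrXn2 _ 2) ?cabs_ge0 // !cabs_sqr !cplxE sqrrN.
Qed.
Lemma cabs_ofR r : cabs (ofR r) = `|r|.
Proof.
by apply/eqP; rewrite -(@eqrXn2 _ 2) ?cabs_ge0 // !cabs_sqr !cplxE
  expr0n /= addr0 real_normK // num_real.
Qed.
Lemma re_le_cabs z : `|re z| <= cabs z.
Proof.
rewrite -(@ler_pXn2r _ 2) ?nnegrE ?cabs_ge0 // real_normK ?num_real //.
by rewrite cabs_sqr lerDl sqr_ge0.
Qed.
Lemma im_le_cabs z : `|im z| <= cabs z.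
Proof.
rewrite -(@ler_pXn2r _ 2) ?nnegrE ?cabs_ge0 // real_normK ?num_real //.
by rewrite cabs_sqr lerDr sqr_ge0.
Qed.
Lemma cabs_le_re_im z : cabs z <= `|re z| + `|im z|.
Proof.
rewrite -(@ler_pXn2r _ 2) ?nnegrE ?cabs_ge0 ?addr_ge0 // cabs_sqr.
rewrite sqrrD !real_normK ?num_real //.
rewrite -addrA [X in _ <= _ + X]addrC addrA lerDl mulrn_wge0 // mulr_ge0 //.
Qed.
Lemma addz_conj z : z + conj z = ofR (2 * re z).
Proof. by apply: cplx_eqP; rewrite !cplxE; ring. Qed.

Lemma unit_discE z : unit_disc z <-> cabs z < 1.
Proof. by rewrite /unit_disc /= norm_cabs /ofR (_ : (1 : Cplx R) = ofR 1) // ltcR. Qed.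
Lemma unit_circleE z : unit_circle z <-> cabs z = 1.
Proof.
rewrite /unit_circle /= norm_cabs; split => [/(congr1 re)//|->].
by rewrite ofR1.
Qed.

End complex_numbers.

(** * Topology of the plane through real epsilons *)

Lemma cvg_continuous_comp {T : Type} {U V : topologicalType} {F : set_system T}
    (u : T -> U) (g : U -> V) (l : U) :
  {for l, continuous g} -> u x @[x --> F] --> l -> g (u x) @[x --> F] --> g l.
Proof. by move=> cg ul A /cg /ul. Qed.

Lemma cvg_near_eq {T : Type} {U : topologicalType} {F : set_system T} {FF : Filter F}
    (u v : T -> U) (l : U) :
  (\forall x \near F, u x = v x) -> u x @[x --> F] --> l -> v x @[x --> F] --> l.
Proof.
move=> uv ul A /ul uA; rewrite /fmap /nbhs /=.
by apply: filterS2 uv uA => x /= <-.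
Qed.

Section complex_topology.
Context {R : realType}.
Implicit Types (z w u l : Cplx R) (f g : Cplx R -> Cplx R).

Lemma Cplx_cvgP {T : Type} {F : set_system T} {FF : Filter F} (h : T -> Cplx R) l :
  h @ F --> l <-> forall e : R, 0 < e -> \forall x \near F, cabs (h x - l) < e.
Proof.
split=> [/cvgrPdist_lt H e e0|H].
  have e0C : 0 < ofR e :> Cplx R by rewrite /ofR ltcR.
  near=> x; rewrite cabsB -ltcR.
  by near: x; exact: H _ e0C.
apply/cvgrPdist_lt => e e0.
have eE : e = ofR (re e) :> Cplx R.
  by apply: cplx_eqP; rewrite // im_ofR; move: e0; rewrite ltcE => /andP[/eqP].
have e0R : 0 < re e by move: e0; rewrite ltcE => /andP[].
near=> x; rewrite eE norm_cabs /ofR ltcR cabsB.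
by near: x; exact: H.
Unshelve. all: by end_near. Qed.

Lemma Cplx_nbhsP z (A : set (Cplx R)) :
  nbhs z A <-> exists2 d : R, 0 < d & forall w, cabs (w - z) < d -> A w.
Proof.
split=> [/nbhs_ballP[e /= e0 eA]|[d d0 dA]].
  exists (re e); first by move: e0; rewrite ltcE => /andP[].
  move=> w wz; apply: eA; rewrite /ball /= distrC norm_cabs.
  have -> : e = ofR (re e) :> Cplx R.
    by apply: cplx_eqP; rewrite // im_ofR; move: e0; rewrite ltcE => /andP[/eqP].
  by rewrite /ofR ltcR.
apply/nbhs_ballP; exists (ofR d); first by rewrite /= /ofR ltcR.
by move=> w; rewrite /ball /= norm_cabs /ofR ltcR cabsB => /dA.
Qed.

Lemma re_continuous : continuous (@re R : Cplx R -> R).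
Proof.
move=> z; apply/(@cvgrPdist_lt _ _ _ (nbhs z)) => e e0; apply/Cplx_nbhsP; exists e => // w wz.
by rewrite -reN -reD; apply: le_lt_trans (re_le_cabs _) _; rewrite cabsB.
Qed.
Lemma im_continuous : continuous (@im R : Cplx R -> R).
Proof.
move=> z; apply/(@cvgrPdist_lt _ _ _ (nbhs z)) => e e0; apply/Cplx_nbhsP; exists e => // w wz.
by rewrite -imN -imD; apply: le_lt_trans (im_le_cabs _) _; rewrite cabsB.
Qed.
Lemma cabs_continuous : continuous (@cabs R : Cplx R -> R).
Proof.
move=> z; apply/(@cvgrPdist_lt _ _ _ (nbhs z)) => e e0; apply/Cplx_nbhsP; exists e => // w wz.
by apply: le_lt_trans (cabs_lip _ _) _; rewrite cabsB.
Qed.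
Lemma conj_continuous : continuous (@conj R : Cplx R -> Cplx R).
Proof.
move=> z; apply: (Cplx_cvgP (F := nbhs z) _ _).2 => e e0; apply/Cplx_nbhsP; exists e => // w wz.
by rewrite -conjN -conjD cabs_conj.
Qed.
Lemma ofR_continuous : continuous (@ofR R : R -> Cplx R).
Proof.
move=> r; apply: (Cplx_cvgP (F := nbhs r) _ _).2 => e e0; near=> s.
rewrite -ofRN -ofRD cabs_ofR distrC; near: s.
by apply: cvgr_dist_lt => //; exact: cvg_id.
Unshelve. all: by end_near. Qed.

Lemma cvg_re_im {T : Type} {F : set_system T} {FF : Filter F} (h : T -> Cplx R) l :
  re \o h @ F --> re l -> im \o h @ F --> im l -> h @ F --> l.
Proof.
move=> /cvgrPdist_lt hr /cvgrPdist_lt hi; apply/Cplx_cvgP => e e0.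
have e2 : 0 < e / 2 by rewrite divr_gt0.
near=> x; rewrite cabsB; apply: le_lt_trans (cabs_le_re_im _) _.
rewrite (splitr e) !cplxE ltrD //; near: x; [exact: hr|exact: hi].
Unshelve. all: by end_near. Qed.

Lemma continuousP_eps (f : Cplx R -> Cplx R) z :
  {for z, continuous f} <-> forall e : R, 0 < e -> exists2 d : R, 0 < d &
    forall w, cabs (w - z) < d -> cabs (f w - f z) < e.
Proof.
split=> [H e e0|H].
  have := (Cplx_cvgP (F := nbhs z) f (f z)).1 H e e0.
  by move=> /(_ (nbhs_filter z)) /Cplx_nbhsP.
apply: (Cplx_cvgP (F := nbhs z) f (f z)).2 => e /H ?.
exact/Cplx_nbhsP.
Qed.

Lemma derivable_approx f z : derivable f z 1 -> exists l, forall e : R, 0 < e ->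
  exists2 d : R, 0 < d & forall w, cabs (w - z) < d ->
    cabs (f w - f z - l * (w - z)) <= e * cabs (w - z).
Proof.
move=> /cvg_ex[l /Cplx_cvgP H]; exists l => e e0.
have : nbhs (0 : Cplx R) (fun x => x != 0 ->
  cabs (x^-1 *: (f (x%:A + z) - f z) - l) < e) := H e e0.
move=> /Cplx_nbhsP[d d0 dH].
exists d => // w wz; have [->|wz0] := eqVneq w z.
  by rewrite !subrr mulr0 subrr cabs0 mulr0.
have := dH (w - z); rewrite subr0 => /(_ wz).
have wz1 : w - z != 0 by rewrite subr_eq0.
move=> /(_ wz1) /ltW; rewrite /= scaler1 subrK.
rewrite -(ler_pM2r (_ : 0 < cabs (w - z))); last by rewrite cabs_gt0.
rewrite -cabsM mulrBl /GRing.scale /= mulrAC mulVf // mul1r.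
by move=> h; exact: h.
Qed.

Lemma derivable_continuous f z : derivable f z 1 -> {for z, continuous f}.
Proof. by move=> /derivable1_diffP/differentiable_continuous. Qed.

End complex_topology.

(** * Joint differentiability in polar coordinates *)

Section circle_parametrization.
Context {R : realType}.
Notation circ := (@circle_param R).
Implicit Types (t s : R).

Definition imag_unit : Cplx R := Complex 0 1.

Lemma re_imag_unit : re imag_unit = 0. Proof. by []. Qed.
Lemma im_imag_unit : im imag_unit = 1. Proof. by []. Qed.
Lemma re_circ t : re (circ t) = cos (2 * pi * t). Proof. by []. Qed.
Lemma im_circ t : im (circ t) = sin (2 * pi * t). Proof. by []. Qed.

Lemma cabs_circ t : cabs (circ t) = 1.
Proof.
apply/eqP; rewrite -(@eqrXn2 _ 2) ?cabs_ge0 // cabs_sqr re_circ im_circ cos2Dsin2.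
by rewrite expr1n.
Qed.

Lemma circ_neq0 t : circ t != 0.
Proof. by rewrite -cabs_gt0 cabs_circ. Qed.

Lemma circ1 : circ 1 = circ 0.
Proof.
apply: cplx_eqP; rewrite ?re_circ ?im_circ mulr0 mulr1 mulr_natl.
  by rewrite cos2pi cos0.
by rewrite sin2pi sin0.
Qed.

Lemma is_derive_approx (g : R -> R) t l : is_derive t (1 : R) g l ->
  forall e, 0 < e -> exists2 d, 0 < d & forall s, `|s - t| < d ->
    `|g s - g t - l * (s - t)| <= e * `|s - t|.
Proof.
move=> [dg <-] e e0.
move: dg => /cvg_ex[l' H]; rewrite (_ : 'D_1 g t = l'); last first.
  by rewrite /derive; exact: cvg_lim.
move: H => /cvgrPdist_lt /(_ e e0) H.
have : nbhs (0 : R) (fun x => x != 0 -> `|l' - x^-1 *: (g (x *: 1 + t) - g t)| < e) := H.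
move=> /nbhs_ballP[d /= d0 dH]; exists d => // s st.
have [->|st0] := eqVneq s t; first by rewrite !subrr mulr0 subrr normr0 mulr0.
have := dH (s - t); rewrite /ball /= sub0r normrN => /(_ st).
rewrite subr_eq0 => /(_ st0) /ltW; rewrite [(s - t) *: _]mulr1 subrK distrC.
rewrite -(ler_pM2r (_ : 0 < `|s - t|)); last by rewrite normr_gt0 subr_eq0.
rewrite -normrM mulrBl /GRing.scale /= mulrAC mulVf ?subr_eq0 // mul1r.
by move=> h; exact: h.
Qed.

Lemma circ_approx t e : 0 < e -> exists2 d, 0 < d & forall s, `|s - t| < d ->
  cabs (circ s - circ t - ofR (2 * pi) * imag_unit * circ t * ofR (s - t)) <=
    e * `|s - t|.
Proof.
move=> e0.
have dlin : is_derive t (1 : R) (fun x => 2 * pi * x) (2 * pi).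
  by apply: is_derive_eq; rewrite /GRing.scale /= mulr1.
have dc : is_derive t (1 : R) (fun x => cos (2 * pi * x)) (- sin (2 * pi * t) * (2 * pi)).
  by apply: is_derive_eq; rewrite /GRing.scale /= mulrC.
have ds : is_derive t (1 : R) (fun x => sin (2 * pi * x)) (cos (2 * pi * t) * (2 * pi)).
  by apply: is_derive_eq; rewrite /GRing.scale /= mulrC.
have e2 : 0 < e / 2 by rewrite divr_gt0.
have [d1 d10 H1] := is_derive_approx dc e2.
have [d2 d20 H2] := is_derive_approx ds e2.
exists (Num.min d1 d2) => [|s]; first by rewrite lt_min d10.
rewrite lt_min => /andP[/H1 k1 /H2 k2].
apply: le_trans (cabs_le_re_im _) _.
rewrite !cplxE re_imag_unit im_imag_unit !re_circ !im_circ.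
have -> : e * `|s - t| = e / 2 * `|s - t| + e / 2 * `|s - t| by field.
apply: lerD; [move: k1|move: k2];
  by congr (`| _ | <= _); ring.
Qed.

Lemma circ_continuous : continuous circ.
Proof.
have lin_cont : continuous (fun t : R => 2 * pi * t).
  by move=> t; apply: cvgM; [exact: cvg_cst|exact: cvg_id].
move=> t; apply: cvg_re_im.
- by apply: (@continuous_comp _ _ _ (fun t => 2 * pi * t) cos);
    [exact: lin_cont|exact: continuous_cos].
- by apply: (@continuous_comp _ _ _ (fun t => 2 * pi * t) sin);
    [exact: lin_cont|exact: continuous_sin].
Qed.

End circle_parametrization.

Section plane_differentiability.
Context {R : realType}.
Notation circ := (@circle_param R).
Implicit Types (g h : R -> R -> Cplx R) (A B : Cplx R).

(** Total differentiability at [(s0, t0)] with complex partial derivatives [A] and [B]. Its real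
    part is an estimate of the kind [closed_form_at] asks for. *)
Definition dif2 g (s0 t0 : R) A B := forall e : R, 0 < e ->
  exists2 d : R, 0 < d & forall s t, `|s - s0| < d -> `|t - t0| < d ->
    cabs (g s t - g s0 t0 - A * ofR (s - s0) - B * ofR (t - t0)) <=
      e * (`|s - s0| + `|t - t0|).

Lemma dif2_cst A s0 t0 : dif2 (fun _ _ => A) s0 t0 0 0.
Proof.
move=> e e0; exists 1 => // s t _ _.
by rewrite !mul0r !subr0 subrr cabs0 mulr_ge0 ?addr_ge0 // ltW.
Qed.

Lemma dif2_eq g s0 t0 A B A' B' : dif2 g s0 t0 A B -> A = A' -> B = B' ->
  dif2 g s0 t0 A' B'.
Proof. by move=> ? <- <-. Qed.

Lemma dif2_fst s0 t0 : dif2 (fun s _ => ofR s) s0 t0 1 0.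
Proof.
move=> e e0; exists 1 => // s t _ _.
rewrite mul0r subr0 mul1r -ofRN -ofRD subrr cabs0 mulr_ge0 ?addr_ge0 //; exact: ltW.
Qed.

Lemma dif2_circ s0 t0 :
  dif2 (fun _ t => circ t) s0 t0 0 (ofR (2 * pi) * imag_unit * circ t0).
Proof.
move=> e e0; have [d d0 H] := circ_approx t0 e0.
exists d => // s t _ /H h; rewrite mul0r subr0; apply: (le_trans h).
by rewrite ler_wpM2l ?lerDr // ltW.
Qed.

Lemma dif2_lip g s0 t0 A B : dif2 g s0 t0 A B -> exists2 d : R, 0 < d &
  forall s t, `|s - s0| < d -> `|t - t0| < d ->
    cabs (g s t - g s0 t0) <= (cabs A + cabs B + 1) * (`|s - s0| + `|t - t0|).
Proof.
move=> /(_ 1 ltr01)[d d0 H]; exists d => // s t hs ht.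
have := H s t hs ht; set x := `|s - s0|; set y := `|t - t0| => k.
have -> : g s t - g s0 t0 = (g s t - g s0 t0 - A * ofR (s - s0) - B * ofR (t - t0))
   + (A * ofR (s - s0) + B * ofR (t - t0)) by ring.
apply: le_trans (cabsD _ _) _; apply: le_trans (lerD k (cabsD _ _)) _.
rewrite !cabsM !cabs_ofR -/x -/y.
have x0 : 0 <= x := normr_ge0 _; have y0 : 0 <= y := normr_ge0 _.
have a0 := cabs_ge0 A; have b0 := cabs_ge0 B.
by have := mulr_ge0 a0 y0; have := mulr_ge0 b0 x0; lra.
Qed.

Lemma dif2_mul g h s0 t0 A B A' B' : dif2 g s0 t0 A B -> dif2 h s0 t0 A' B' ->
  dif2 (fun s t => g s t * h s t) s0 t0
    (A * h s0 t0 + g s0 t0 * A') (B * h s0 t0 + g s0 t0 * B').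
Proof.
move=> dg dh e e0.
have [d1 d10 lg] := dif2_lip dg; have [d2 d20 lh] := dif2_lip dh.
set M := cabs A + cabs B + 1 in lg; set M' := cabs A' + cabs B' + 1 in lh.
have M0 : 0 < M by rewrite /M; have := cabs_ge0 A; have := cabs_ge0 B; lra.
have M'0 : 0 < M' by rewrite /M'; have := cabs_ge0 A'; have := cabs_ge0 B'; lra.
have g0 := cabs_ge0 (g s0 t0); have h0 := cabs_ge0 (h s0 t0).
set K := cabs (g s0 t0) + cabs (h s0 t0) + 1.
have K0 : 0 < K by rewrite /K; lra.
have eK : 0 < e / (2 * K) by rewrite divr_gt0 // mulr_gt0.
have [d3 d30 {}dg] := dg _ eK; have [d4 d40 {}dh] := dh _ eK.
have MM0 : 0 < M * M' by rewrite mulr_gt0.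
have d50 : 0 < e / (4 * (M * M')) by rewrite divr_gt0 // mulr_gt0.
(* The last radius gives [N <= e / (2 * (M * M'))], so the product of the two increments, at most
   [M * N * (M' * N)], is at most [e / 2 * N]. The first-order errors take the other half. *)
exists (Num.min (Num.min (Num.min d1 d2) (Num.min d3 d4)) (e / (4 * (M * M')))).
  by rewrite !lt_min d10 d20 d30 d40 d50.
move=> s t; rewrite !lt_min.
move=> /andP[/andP[/andP[s1 s2] /andP[s3 s4]] s5].
move=> /andP[/andP[/andP[t1 t2] /andP[t3 t4]] t5].
have {lg} := lg s t s1 t1; have {lh} := lh s t s2 t2.
have {dg} := dg s t s3 t3; have {dh} := dh s t s4 t4.
set N := `|s - s0| + `|t - t0| => kh kg lh lg.
have N0 : 0 <= N by rewrite addr_ge0.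
have NN : N <= e / (2 * (M * M')).
  have -> : e / (2 * (M * M')) = e / (4 * (M * M')) + e / (4 * (M * M')).
    by field; rewrite ?gt_eqF.
  by rewrite lerD // ltW.
set u := g s t - g s0 t0 - A * ofR (s - s0) - B * ofR (t - t0) in kg.
set v := h s t - h s0 t0 - A' * ofR (s - s0) - B' * ofR (t - t0) in kh.
have -> : g s t * h s t - g s0 t0 * h s0 t0 -
    (A * h s0 t0 + g s0 t0 * A') * ofR (s - s0) -
    (B * h s0 t0 + g s0 t0 * B') * ofR (t - t0) =
  u * h s0 t0 + g s0 t0 * v + (g s t - g s0 t0) * (h s t - h s0 t0).
  by rewrite /u /v; ring.
apply: le_trans (cabsD _ _) _; apply: le_trans (lerD (cabsD _ _) (lexx _)) _.
rewrite !cabsM.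
have E1 : cabs u * cabs (h s0 t0) <= e / (2 * K) * N * cabs (h s0 t0).
  by rewrite ler_wpM2r.
have E2 : cabs (g s0 t0) * cabs v <= cabs (g s0 t0) * (e / (2 * K) * N).
  by rewrite ler_wpM2l.
have E3 : cabs (g s t - g s0 t0) * cabs (h s t - h s0 t0) <= (M * N) * (M' * N).
  by rewrite ler_pM // cabs_ge0.
have E4 : (M * N) * (M' * N) <= e / 2 * N.
  rewrite mulrACA mulrA ler_wpM2r // mulrC.
  apply: le_trans (ler_wpM2r (ltW MM0) NN) _.
  by rewrite le_eqVlt; apply/orP; left; apply/eqP; field; rewrite ?gt_eqF.
have E5 : e / (2 * K) * N * cabs (h s0 t0) + cabs (g s0 t0) * (e / (2 * K) * N) <= e / 2 * N.
  have -> : e / (2 * K) * N * cabs (h s0 t0) + cabs (g s0 t0) * (e / (2 * K) * N) =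
     e / (2 * K) * (cabs (g s0 t0) + cabs (h s0 t0)) * N by ring.
  rewrite ler_wpM2r //.
  have -> : e / 2 = e / (2 * K) * K by field; rewrite ?gt_eqF.
  by rewrite ler_wpM2l ?ltW // /K ltrDl.
have := lerD (lerD E1 E2) (le_trans E3 E4); move/le_trans; apply.
by move: E5; move: (_ + _) => X; lra.
Qed.

(** One factor [l] multiplies both partial derivatives: this is the content of the Cauchy-Riemann
    equations, and the source of the closedness of [k(z) dz]. *)
Lemma dif2_comp (k : Cplx R -> Cplx R) g s0 t0 A B : dif2 g s0 t0 A B ->
  derivable k (g s0 t0) 1 ->
  exists l, dif2 (fun s t => k (g s t)) s0 t0 (l * A) (l * B).
Proof.
move=> dg /derivable_approx[l kl]; exists l => e e0.
have [d1 d10 lg] := dif2_lip dg.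
set M := cabs A + cabs B + 1 in lg.
have M0 : 0 < M by rewrite /M; have := cabs_ge0 A; have := cabs_ge0 B; lra.
have l0 := cabs_ge0 l.
have L0 : 0 < cabs l + 1 by lra.
have [d2 d20 {}kl] := kl (e / (2 * M)) ltac:(by rewrite divr_gt0 // mulr_gt0).
have [d3 d30 {}dg] := dg (e / (2 * (cabs l + 1))) ltac:(by rewrite divr_gt0 // mulr_gt0).
have d40 : 0 < d2 / (2 * M) by rewrite divr_gt0 // mulr_gt0.
exists (Num.min (Num.min d1 d3) (d2 / (2 * M))).
  by rewrite !lt_min d10 d30 d40.
move=> s t; rewrite !lt_min => /andP[/andP[s1 s3] s4] /andP[/andP[t1 t3] t4].
have {lg} := lg s t s1 t1; have {dg} := dg s t s3 t3.
have NN : `|s - s0| + `|t - t0| < d2 / M.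
  have -> : d2 / M = d2 / (2 * M) + d2 / (2 * M) by field; rewrite gt_eqF.
  by rewrite ltrD.
move: NN; set N := `|s - s0| + `|t - t0| => NN kg lg.
have N0 : 0 <= N by rewrite addr_ge0.
have {}kl := kl (g s t) ltac:(by apply: (le_lt_trans lg); rewrite mulrC -ltr_pdivlMr).
set u := g s t - g s0 t0 - A * ofR (s - s0) - B * ofR (t - t0) in kg.
have -> : k (g s t) - k (g s0 t0) - l * A * ofR (s - s0) - l * B * ofR (t - t0) =
  (k (g s t) - k (g s0 t0) - l * (g s t - g s0 t0)) + l * u by rewrite /u; ring.
apply: le_trans (cabsD _ _) _; rewrite cabsM.
have E1 : e / (2 * M) * cabs (g s t - g s0 t0) <= e / 2 * N.
  have -> : e / 2 * N = e / (2 * M) * (M * N) by field; rewrite gt_eqF.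
  by rewrite ler_wpM2l // divr_ge0 ?mulr_ge0 // ltW.
have E2 : cabs l * cabs u <= e / 2 * N.
  have -> : e / 2 * N = (cabs l + 1) * (e / (2 * (cabs l + 1)) * N).
    by field; rewrite gt_eqF.
  by rewrite ler_pM ?cabs_ge0 // lerDl.
by have := lerD (le_trans kl E1) E2; move/le_trans; apply; lra.
Qed.

Lemma dif2_re_im g s0 t0 A B : dif2 g s0 t0 A B -> forall e : R, 0 < e ->
  exists2 d : R, 0 < d & forall s t, `|s - s0| < d -> `|t - t0| < d ->
    `|re (g s t) - re (g s0 t0) - re A * (s - s0) - re B * (t - t0)| <=
      e * (`|s - s0| + `|t - t0|) /\
    `|im (g s t) - im (g s0 t0) - im A * (s - s0) - im B * (t - t0)| <=
      e * (`|s - s0| + `|t - t0|).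
Proof.
move=> dg e /dg[d d0 H]; exists d => // s t hs ht.
have := H s t hs ht => k; split.
- apply: le_trans k; apply: le_trans (re_le_cabs _).
  by rewrite !cplxE !mulr0 !subr0.
- apply: le_trans k; apply: le_trans (im_le_cabs _).
  by rewrite !cplxE !mulr0 !add0r.
Qed.

End plane_differentiability.

(** * Cauchy, Poisson and Herglotz formulas on the circle *)

Section cauchy_theorem.
Context {R : realType}.
Notation leb := (@lebesgue_measure R).
Notation circ := (@circle_param R).
Variables (k : Cplx R -> Cplx R) (rho : R) (z0 : Cplx R).
Hypothesis rho1 : 1 < rho.
Hypothesis k_cont : forall z, cabs z < rho -> {for z, continuous k}.
Hypothesis k_der : forall z, cabs z < rho -> z != z0 -> derivable k z 1.

Let kc s t : Cplx R := k (ofR s * circ t).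

Let cabs_polar (s t : R) : cabs (ofR s * circ t) = `|s|.
Proof. by rewrite cabsM cabs_ofR cabs_circ mulr1. Qed.

Let polar_continuous : continuous (fun st : R * R => ofR st.1 * circ st.2).
Proof.
move=> st; apply: cvgM.
  apply: (@continuous_comp _ _ _ fst (@ofR R)); first exact: cvg_fst.
  exact: ofR_continuous.
apply: (@continuous_comp _ _ _ snd circ); first exact: cvg_snd.
exact: circ_continuous.
Qed.

Let kc_continuous st : `|st.1| < rho -> {for st, continuous (fun st : R * R => kc st.1 st.2)}.
Proof.
move=> h; apply: (@continuous_comp _ _ _ (fun st : R * R => ofR st.1 * circ st.2) k).
  exact: polar_continuous.
by apply: k_cont; rewrite cabs_polar.
Qed.

Let kc_continuous_t s : `|s| < rho -> continuous (kc s).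
Proof.
move=> h t; apply: (@continuous_comp _ _ _ (fun t : R => (s, t)) (fun st : R * R => kc st.1 st.2)).
  by apply: (@cvg_pair _ _ _ (nbhs t) (nbhs s) (nbhs t)); [exact: cvg_cst|exact: cvg_id].
exact: kc_continuous.
Qed.

Let kc_continuous_s t s : `|s| < rho -> {for s, continuous (kc ^~ t)}.
Proof.
move=> h; apply: (@continuous_comp _ _ _ (fun s : R => (s, t)) (fun st : R * R => kc st.1 st.2)).
  by apply: (@cvg_pair _ _ _ (nbhs s) (nbhs s) (nbhs t)); [exact: cvg_id|exact: cvg_cst].
exact: kc_continuous.
Qed.

Let kc_bounded (r : R) : r < rho -> exists2 M, 0 <= M & forall s t, -r <= s <= r -> 0 <= t <= 1 ->
  cabs (kc s t) <= M.
Proof.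
move=> rr.
pose D := `[-r, r]%classic `*` `[0, 1]%classic : set (R * R).
have cD : compact D by apply: compact_setX; exact: segment_compact.
have : {within D, continuous (fun st : R * R => cabs (kc st.1 st.2))}.
  apply: continuous_in_subspaceT => -[s t]; rewrite inE => -[/=].
  rewrite in_itv /= => hs _.
  apply: (@continuous_comp _ _ _ (fun st : R * R => kc st.1 st.2) (@cabs R)).
    by apply: kc_continuous => /=; rewrite ltr_norml; apply/andP; split; lra.
  exact: cabs_continuous.
move=> /continuous_compact/(_ cD)/compact_bounded[M [Mr MH]].
exists (`|M| + 1) => // s t hs ht.
have := MH (`|M| + 1) ltac:(by apply: le_lt_trans (ler_norm M) _; lra).
move=> /(_ (cabs (kc s t))) /=; rewrite ger0_norm ?cabs_ge0 //; apply.
by exists (s, t) => //; split; rewrite /= in_itv.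
Qed.

(* With z = s * circ t, the form k(z) dz is g1 ds + g2 dt. As g1 takes the same
   values at t = 0 and t = 1, Goursat on [a, b] x [0, 1] shows that the integral of
   g2 over |z| = s does not depend on s as long as s avoids |z0|; continuity in s
   crosses |z0|, and the integral vanishes at s = 0. *)
Let g1 s t := circ t * kc s t.
Let g2 s t := ofR (2 * pi) * imag_unit * (ofR s * (circ t * kc s t)).
Let circulation s := \int[leb]_(t in `[0, 1]) re (g2 s t).

Let g1_continuous_s t s : `|s| < rho -> {for s, continuous (fun s => re (g1 s t))}.
Proof.
move=> h; apply: (@continuous_comp _ _ _ (g1 ^~ t) (@re R)); last exact: re_continuous.
by apply: cvgM; [exact: cvg_cst|exact: kc_continuous_s].
Qed.

Let g2_continuous_s t s : `|s| < rho -> {for s, continuous (fun s => re (g2 s t))}.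
Proof.
move=> h; apply: (@continuous_comp _ _ _ (g2 ^~ t) (@re R)); last exact: re_continuous.
apply: cvgM; first exact: cvg_cst.
apply: cvgM; first exact: ofR_continuous.
by apply: cvgM; [exact: cvg_cst|exact: kc_continuous_s].
Qed.

Let g2_continuous_t s : `|s| < rho -> continuous (fun t => re (g2 s t)).
Proof.
move=> h t; apply: (@continuous_comp _ _ _ (g2 s) (@re R)); last exact: re_continuous.
apply: cvgM; first exact: cvg_cst.
apply: cvgM; first exact: cvg_cst.
by apply: cvgM; [exact: circ_continuous|exact: kc_continuous_t].
Qed.

Let g2_integrable s : `|s| < rho -> leb.-integrable `[0, 1] (EFin \o (fun t => re (g2 s t))).
Proof.
move=> h; apply: continuous_compact_integrable; first exact: segment_compact.
by apply: continuous_subspaceT; exact: g2_continuous_t.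
Qed.

(** The common [B] is the derivative of [g1] in [t] and of [g2] in [s]; with the chain rule factor
    [l] both equal [2 pi i (circ t k + s l (circ t)^2)]. *)
Let g_closed s0 t0 : `|s0| < rho -> ofR s0 * circ t0 != z0 ->
  exists A B C : Cplx R, dif2 g1 s0 t0 A B /\ dif2 g2 s0 t0 B C.
Proof.
move=> hs hz.
have dp := dif2_mul (dif2_fst s0 t0) (dif2_circ s0 t0).
have kd : derivable k (ofR s0 * circ t0) 1 by apply: k_der; rewrite ?cabs_polar.
have [l dk] := dif2_comp dp kd.
have d1 := dif2_mul (dif2_circ s0 t0) dk.
have d2 := dif2_mul (dif2_cst (ofR (2 * pi) * imag_unit) s0 t0)
  (dif2_mul (dif2_fst s0 t0) d1).
exists (0 * k (ofR s0 * circ t0) + circ t0 * (l * (1 * circ t0 + ofR s0 * 0))).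
eexists; eexists; split; first exact: d1.
apply: dif2_eq d2 _ (erefl _); ring.
Qed.

Let circulation_const_itv a b : 0 < a -> a <= b -> b < rho ->
  (forall s, a <= s <= b -> s != cabs z0) -> circulation a = circulation b.
Proof.
move=> a0 ab brho hz.
have lt_rho s : a <= s <= b -> `|s| < rho by move=> hs; rewrite ltr_norml; lra.
have : rect_circulation (fun s t => re (g1 s t)) (fun s t => re (g2 s t)) a b 0 1 = 0.
  apply: goursat_rectangle => //; first split.
  - move=> t _; apply: continuous_compact_integrable; first exact: segment_compact.
    apply: continuous_in_subspaceT => s; rewrite inE /= in_itv /= => hs.
    exact/g1_continuous_s/lt_rho.
  - by move=> s; rewrite in_itv /= => hs; apply: g2_integrable; exact: lt_rho.
  - move=> s t hs _.
    have [A [B [C [dA dB]]]] := g_closed (t0 := t) (lt_rho _ hs)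
      ltac:(by apply: contraTneq (hz s hs) => <-; rewrite cabs_polar ger0_norm ?eqxx //; lra).
    exists (re A), (re B), (re C) => e e0.
    have [d1 d10 H1] := dif2_re_im dA e0; have [d2 d20 H2] := dif2_re_im dB e0.
    exists (Num.min d1 d2) => [|x y _ _]; first by rewrite lt_min d10.
    rewrite !lt_min => /andP[x1 x2] /andP[y1 y2].
    by split; [have [] := H1 x y x1 y1|have [] := H2 x y x2 y2].
rewrite /rect_circulation => E.
have Z : \int[leb]_(s in `[a, b]) (re (g1 s 0) - re (g1 s 1)) = 0.
  under eq_Rintegral do rewrite /g1 /kc circ1 subrr.
  by rewrite Rintegral_cst ?mul0r //; exact: measurable_itv.
move: E; rewrite Z add0r RintegralB => [/eqP|||];
  [by rewrite subr_eq0 => /eqP|exact: measurable_itv| |];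
  by apply: g2_integrable; apply: lt_rho; rewrite lexx ab.
Qed.

Let circulation_continuous s : `|s| < rho -> {for s, continuous circulation}.
Proof.
move=> hs; pose r := (`|s| + rho) / 2.
have r0 : 0 <= r by rewrite /r; have := normr_ge0 s; lra.
have rrho : r < rho by rewrite /r; lra.
have sr : `|s| < r by rewrite /r; lra.
have [M M0 kM] := kc_bounded rrho.
have lt_rho x : x \in `]-r, r[ -> `|x| < rho.
  by rewrite in_itv /= ltr_norml => /andP[? ?]; apply/andP; split; lra.
have := @continuity_under_integral R _ _ leb (fun s t => re (g2 s t)) `[0, 1]
  (measurable_itv _) (- r) r.
move=> /(_ (fun x hx => g2_integrable (lt_rho x hx)))
  /(_ _ (fun=> 2 * pi * (r * M))); apply.
- apply/aeW => t _ x; rewrite inE => /lt_rho; exact: g2_continuous_s.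
- apply: continuous_compact_integrable; first exact: segment_compact.
  by apply: continuous_subspaceT => x; exact: cvg_cst.
- move=> x hx; apply/aeW => t; rewrite /= in_itv /= => ht.
  apply: le_trans (re_le_cabs _) _; rewrite !cabsM !cabs_ofR cabs_circ mul1r.
  have -> : cabs (@imag_unit R) = 1.
    apply/eqP; rewrite -(@eqrXn2 _ 2) ?cabs_ge0 // cabs_sqr re_imag_unit im_imag_unit.
    by rewrite expr0n /= add0r.
  rewrite mulr1 ger0_norm; last by rewrite mulr_ge0 ?pi_ge0.
  rewrite ler_wpM2l ?mulr_ge0 ?pi_ge0 // ler_pM ?cabs_ge0 //.
    by move: hx; rewrite /= in_itv /= ler_norml => /andP[? ?]; apply/andP; split; lra.
  by apply: kM => //; move: hx; rewrite /= in_itv /= => /andP[? ?]; apply/andP; split; lra.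
- by rewrite inE /= in_itv /= -ltr_norml.
Qed.

Let circulation_endpoints a b : 0 <= a -> a < b -> b < rho ->
  (forall s, a < s < b -> s != cabs z0) -> circulation a = circulation b.
Proof.
move=> a0 ab brho hz.
have /cvgrPdist_lt ca : {for a, continuous circulation}.
  by apply: circulation_continuous; rewrite ger0_norm //; lra.
have /cvgrPdist_lt cb : {for b, continuous circulation}.
  by apply: circulation_continuous; rewrite ger0_norm //; lra.
apply/eqP; rewrite -subr_eq0 -normr_le0; apply/ler_addgt0Pr => e e0; rewrite add0r.
have e2 : 0 < e / 2 by rewrite divr_gt0.
have /nbhs_ballP[d1 /= d10 H1] := ca _ e2.
have /nbhs_ballP[d2 /= d20 H2] := cb _ e2.
pose d := Num.min (Num.min d1 d2) (b - a) / 2.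
have [dd1 dd2 dba d0] : [/\ d < d1, d < d2, d <= (b - a) / 2 & 0 < d].
  have m1 : Num.min (Num.min d1 d2) (b - a) <= d1 by rewrite !ge_min lexx.
  have m2 : Num.min (Num.min d1 d2) (b - a) <= d2 by rewrite !ge_min lexx orbT.
  have m3 : Num.min (Num.min d1 d2) (b - a) <= b - a by rewrite !ge_min lexx orbT.
  have m4 : 0 < Num.min (Num.min d1 d2) (b - a) by rewrite !lt_min d10 d20 subr_gt0 ab.
  by rewrite /d; split; lra.
have := H1 (a + d); rewrite /ball /= opprD addNKr normrN gtr0_norm // => /(_ dd1) k1.
have := H2 (b - d); rewrite /ball /= opprB addrC subrK gtr0_norm // => /(_ dd2) k2.
have E : circulation (a + d) = circulation (b - d).
  clear H1 H2 k1 k2 ca cb; apply: circulation_const_itv; do ?[lra].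
  by move=> s hs; apply: hz; lra.
have -> : circulation a - circulation b =
  (circulation a - circulation (a + d)) - (circulation b - circulation (b - d)).
  by rewrite E opprB addrA subrK.
apply: le_trans (ler_normB _ _) _; rewrite [leRHS]splitr.
exact: lerD (ltW k1) (ltW k2).
Qed.

Let circulation1 : circulation 1 = 0.
Proof.
have c0 : circulation 0 = 0.
  rewrite /circulation; under eq_Rintegral do rewrite /g2 ofR0 mul0r mulr0 re0.
  by rewrite Rintegral_cst ?mul0r //; exact: measurable_itv.
have z0ge := cabs_ge0 z0.
have [h|h] := boolP ((0 < cabs z0) && (cabs z0 < 1)).
  move: h => /andP[h1 h2]; rewrite -(@circulation_endpoints (cabs z0) 1) //.
    rewrite -(@circulation_endpoints 0 (cabs z0)) //; first exact: lt_trans h2 rho1.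
    by move=> s /andP[_ ?]; rewrite lt_eqF.
  by move=> s /andP[? _]; rewrite gt_eqF.
rewrite -(@circulation_endpoints 0 1) //.
by move=> s hs; apply: contraNneq h => <-.
Qed.

Lemma cauchy_circle_im : \int[leb]_(t in `[0, 1]) im (circ t * k (circ t)) = 0.
Proof.
have := circulation1; rewrite /circulation.
have ic : leb.-integrable `[0, 1] (EFin \o (fun t => im (circ t * k (circ t)))).
  apply: continuous_compact_integrable; first exact: segment_compact.
  apply: continuous_subspaceT => t.
  apply: (@continuous_comp _ _ _ (fun t => circ t * k (circ t)) (@im R)).
    apply: cvgM; first exact: (@circ_continuous R t).
    apply: (@continuous_comp _ _ _ circ k); first exact: (@circ_continuous R t).
    by apply: k_cont; rewrite cabs_circ.
  exact: im_continuous.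
under eq_Rintegral => t _.
  have -> : re (g2 1 t) = (- (2 * pi)) * im (circ t * k (circ t)).
    rewrite /g2 /kc !ofR1 !mul1r; set w := circ t * k (circ t).
    by rewrite !cplxE re_imag_unit im_imag_unit; ring.
  over.
have /= -> := @RintegralZl _ _ _ leb `[0, 1] _ (- (2 * pi)) (measurable_itv _) ic.
move=> /eqP; rewrite mulf_eq0 => /orP[|/eqP//].
by rewrite oppr_eq0 mulf_eq0 pnatr_eq0 /= gt_eqF // pi_gt0.
Qed.

End cauchy_theorem.

Section complex_derivable.
Context {R : realType}.
Implicit Types (f g : Cplx R -> Cplx R) (z c : Cplx R).

Lemma cderivable_cst c z : derivable (fun _ : Cplx R => c) z 1.
Proof. exact: derivable_cst. Qed.
Lemma cderivable_id z : derivable (fun x : Cplx R => x) z 1.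
Proof. exact: derivable_id. Qed.
Lemma cderivableD f g z : derivable f z 1 -> derivable g z 1 ->
  derivable (fun x => f x + g x) z 1.
Proof. exact: derivableD. Qed.
Lemma cderivableB f g z : derivable f z 1 -> derivable g z 1 ->
  derivable (fun x => f x - g x) z 1.
Proof. exact: derivableB. Qed.
Lemma cderivableM f g z : derivable f z 1 -> derivable g z 1 ->
  derivable (fun x => f x * g x) z 1.
Proof. exact: derivableM. Qed.
Lemma cderivable_div f g z : g z != 0 -> derivable f z 1 -> derivable g z 1 ->
  derivable (fun x => f x / g x) z 1.
Proof. by move=> gz df dg; exact: (cderivableM df (derivableV gz dg)). Qed.
Lemma cderivable_comp f g z : derivable f z 1 -> derivable g (f z) 1 ->
  derivable (fun x => g (f x)) z 1.
Proof.
move=> /derivable1_diffP df /derivable1_diffP dg.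
by apply/derivable1_diffP; exact: differentiable_comp df dg.
Qed.

End complex_derivable.

(** * Complex means over the circle *)

Section circle_mean.
Context {R : realType}.
Notation leb := (@lebesgue_measure R).
Notation circ := (@circle_param R).
Implicit Types (g h : R -> Cplx R) (c z w : Cplx R).

(** Componentwise integration over the parameter interval, where Goursat's lemma lives;
    [integral_circle_param] later transfers the results to [circle_measure]. *)
Definition cmean g : Cplx R :=
  Complex (\int[leb]_(t in `[0, 1]) re (g t)) (\int[leb]_(t in `[0, 1]) im (g t)).

Lemma re_cmean g : re (cmean g) = \int[leb]_(t in `[0, 1]) re (g t).
Proof. by []. Qed.
Lemma im_cmean g : im (cmean g) = \int[leb]_(t in `[0, 1]) im (g t).
Proof. by []. Qed.

Lemma integrable01 (u : R -> R) : continuous u ->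
  leb.-integrable `[0, 1] (EFin \o u).
Proof.
move=> cu; apply: continuous_compact_integrable; first exact: segment_compact.
exact: continuous_subspaceT.
Qed.

Lemma integrable_re g : continuous g -> leb.-integrable `[0, 1] (EFin \o (fun t => re (g t))).
Proof.
move=> cg; apply: integrable01 => t.
by apply: (@continuous_comp _ _ _ g (@re R)); [exact: cg|exact: re_continuous].
Qed.
Lemma integrable_im g : continuous g -> leb.-integrable `[0, 1] (EFin \o (fun t => im (g t))).
Proof.
move=> cg; apply: integrable01 => t.
by apply: (@continuous_comp _ _ _ g (@im R)); [exact: cg|exact: im_continuous].
Qed.

Lemma Rintegral01_cst (r : R) : \int[leb]_(t in `[0, 1]) r = r.
Proof.
rewrite Rintegral_cst; last exact: measurable_itv.
by rewrite /= lebesgue_measure_itv /= lte_fin ltr01 /= subr0 mulr1.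
Qed.

Let I01D (u v : R -> R) : leb.-integrable `[0, 1] (EFin \o u) ->
  leb.-integrable `[0, 1] (EFin \o v) ->
  \int[leb]_(t in `[0, 1]) (u t + v t) =
  \int[leb]_(t in `[0, 1]) u t + \int[leb]_(t in `[0, 1]) v t.
Proof. exact: (@RintegralD _ _ _ leb _ u v (measurable_itv _)). Qed.

Let I01B (u v : R -> R) : leb.-integrable `[0, 1] (EFin \o u) ->
  leb.-integrable `[0, 1] (EFin \o v) ->
  \int[leb]_(t in `[0, 1]) (u t - v t) =
  \int[leb]_(t in `[0, 1]) u t - \int[leb]_(t in `[0, 1]) v t.
Proof. exact: (@RintegralB _ _ _ leb _ u v (measurable_itv _)). Qed.

Let I01Z (u : R -> R) r : leb.-integrable `[0, 1] (EFin \o u) ->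
  \int[leb]_(t in `[0, 1]) (r * u t) = r * \int[leb]_(t in `[0, 1]) u t.
Proof. exact: (@RintegralZl _ _ _ leb _ u r (measurable_itv _)). Qed.

Lemma eq_cmean g h : (forall t, g t = h t) -> cmean g = cmean h.
Proof. by move=> /funext ->. Qed.

Lemma cmeanD g h : continuous g -> continuous h ->
  cmean (fun t => g t + h t) = cmean g + cmean h.
Proof.
move=> cg ch; apply: cplx_eqP; rewrite !cplxE ?re_cmean ?im_cmean.
- under eq_Rintegral do rewrite reD.
  exact: (I01D (integrable_re cg) (integrable_re ch)).
- under eq_Rintegral do rewrite imD.
  exact: (I01D (integrable_im cg) (integrable_im ch)).
Qed.

Lemma cmeanZ c g : continuous g -> cmean (fun t => c * g t) = c * cmean g.
Proof.
move=> cg; have ir := integrable_re cg; have ii := integrable_im cg.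
have Zr (u : R -> R) r : leb.-integrable `[0, 1] (EFin \o u) ->
    leb.-integrable `[0, 1] (EFin \o (fun t => r * u t)).
  move=> iu; have := @integrableZl _ _ R leb `[0, 1] (measurable_itv _) r _ iu.
  exact.
apply: cplx_eqP; rewrite !cplxE ?re_cmean ?im_cmean.
- under eq_Rintegral do rewrite reM.
  rewrite (I01B (Zr _ _ ir) (Zr _ _ ii)).
  by rewrite (I01Z _ ir) (I01Z _ ii).
- under eq_Rintegral do rewrite imM.
  rewrite (I01D (Zr _ _ ii) (Zr _ _ ir)).
  by rewrite (I01Z _ ir) (I01Z _ ii).
Qed.

Lemma cmean_conj g : continuous g -> cmean (fun t => conj (g t)) = conj (cmean g).
Proof.
move=> cg; apply: cplx_eqP; rewrite !cplxE ?re_cmean ?im_cmean.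
  by under eq_Rintegral do rewrite re_conj.
under eq_Rintegral => t _ do rewrite im_conj -mulN1r.
by rewrite (I01Z _ (integrable_im cg)) mulN1r.
Qed.

Lemma cmean_cst c : cmean (fun=> c) = c.
Proof.
by apply: cplx_eqP; rewrite ?re_cmean ?im_cmean Rintegral01_cst.
Qed.

Lemma re_cmean_ge0 g : (forall t, 0 <= re (g t)) -> 0 <= re (cmean g).
Proof. by move=> h; rewrite re_cmean; exact: Rintegral_ge0. Qed.

End circle_mean.

(** * Cauchy, Szego, Herglotz and Poisson kernels *)

Section cauchy_formula.
Context {R : realType}.
Notation circ := (@circle_param R).
Implicit Types (h k G : Cplx R -> Cplx R) (z w : Cplx R) (rho : R).

Definition holomorphic_disc rho h := forall z, cabs z < rho -> derivable h z 1.

Lemma circ_comp_continuous k : (forall t, {for circ t, continuous k}) ->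
  continuous (fun t => k (circ t)).
Proof.
move=> ck t; apply: (@continuous_comp _ _ _ circ k); last exact: ck.
exact: circ_continuous.
Qed.

Lemma cauchy_circle k rho z0 : 1 < rho ->
  (forall z, cabs z < rho -> {for z, continuous k}) ->
  (forall z, cabs z < rho -> z != z0 -> derivable k z 1) ->
  cmean (fun t => circ t * k (circ t)) = 0.
Proof.
move=> rho1 ck dk; apply: cplx_eqP; last first.
  by rewrite im_cmean (cauchy_circle_im rho1 ck dk).
rewrite re_cmean.
(* The real part for [k] is the imaginary part for [i k]. *)
have ck' z : cabs z < rho -> {for z, continuous (fun z => imag_unit * k z)}.
  by move=> zr; apply: continuousM; [exact: cst_continuous|exact: ck].
have dk' z : cabs z < rho -> z != z0 -> derivable (fun z => imag_unit * k z) z 1.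
  by move=> zr zz; apply: cderivableM; [exact: cderivable_cst|exact: dk].
have := cauchy_circle_im rho1 ck' dk'.
under eq_Rintegral => t _.
  have -> : im (circ t * (imag_unit * k (circ t))) = re (circ t * k (circ t)).
    by rewrite !cplxE re_imag_unit im_imag_unit; ring.
  over.
exact.
Qed.

Lemma one_sub_conj_neq0 z w : cabs z < 1 -> cabs w <= 1 -> 1 - conj z * w != 0.
Proof.
move=> z1 w1; rewrite subr_eq0; apply: contraTneq z1 => /(congr1 (@cabs R)).
rewrite cabs1 cabsM cabs_conj => e; rewrite -leNgt e.
by rewrite ler_piMr // cabs_ge0.
Qed.

(** The radius [2 / (1 + cabs z)] exceeds 1 and stays below [1 / cabs z], without a separate case
    for [z = 0]. *)
Lemma derivable_one_sub_conj z w : cabs z < 1 -> cabs w < 2 / (1 + cabs z) ->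
  1 - conj z * w != 0.
Proof.
move=> z1; have z0 := cabs_ge0 z; rewrite ltr_pdivlMr; last lra.
move=> h; rewrite subr_eq0; apply: contraTneq h => /(congr1 (@cabs R)).
rewrite cabs1 cabsM cabs_conj => e; rewrite -leNgt mulrDr mulr1 [cabs w * _]mulrC -e.
have : cabs z * cabs w <= cabs w by rewrite ler_piMl ?cabs_ge0 // ltW.
lra.
Qed.

Lemma one_sub_conj_derivable z w : derivable (fun x => 1 - conj z * x) w 1.
Proof.
apply: cderivableB; first exact: cderivable_cst.
by apply: cderivableM; [exact: cderivable_cst|exact: cderivable_id].
Qed.

Lemma two_div_gt1 z : cabs z < 1 -> 1 < 2 / (1 + cabs z).
Proof. by have := cabs_ge0 z => ? ?; rewrite ltr_pdivlMr; lra. Qed.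

Lemma cmean_szego z : cabs z < 1 ->
  cmean (fun t => (1 - conj z * circ t)^-1) = 1.
Proof.
move=> z1.
(* The Szego kernel is [1 + w * k w] with [k] holomorphic beyond the closed disc, so Cauchy's
   theorem kills the second term. *)
pose k w := conj z / (1 - conj z * w).
have dk w : cabs w < 2 / (1 + cabs z) -> derivable k w 1.
  move=> hw; apply: cderivable_div; last exact: one_sub_conj_derivable.
    exact: derivable_one_sub_conj.
  exact: cderivable_cst.
have kc : cmean (fun t => circ t * k (circ t)) = 0.
  apply: (@cauchy_circle k (2 / (1 + cabs z)) 0); first exact: two_div_gt1.
    by move=> w /dk; exact: derivable_continuous.
  by move=> w /dk.
have ck : continuous (fun t => circ t * k (circ t)).
  move=> t; apply: cvgM; first exact: circ_continuous.
  apply: circ_comp_continuous => s; apply: derivable_continuous; apply: dk.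
  by rewrite cabs_circ two_div_gt1.
rewrite (@eq_cmean _ _ (fun t => 1 + circ t * k (circ t))); last first.
  move=> t; rewrite /k; field; apply: one_sub_conj_neq0 => //.
  by rewrite cabs_circ.
have c1 : continuous (fun _ : R => 1 : Cplx R) by move=> t; exact: cvg_cst.
by rewrite (cmeanD c1 ck) cmean_cst kc addr0.
Qed.

Lemma conj_circ t : conj (circ t) = (circ t)^-1.
Proof.
apply: (mulfI (circ_neq0 t)); rewrite mul_conj cabs_circ expr1n mulfV //.
exact: circ_neq0.
Qed.

Lemma circ_sub_neq0 z t : cabs z < 1 -> circ t - z != 0.
Proof.
by move=> z1; rewrite subr_eq0; apply: contraTneq z1 => <-; rewrite cabs_circ ltxx.
Qed.

(** The Cauchy kernel has its pole inside the disc, out of reach of [cauchy_circle]; but on the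
    circle, where [conj xi = xi^-1], it is the conjugate of the Szego kernel. *)
Lemma cmean_cauchy_kernel z : cabs z < 1 ->
  cmean (fun t => circ t / (circ t - z)) = 1.
Proof.
move=> z1; rewrite -[RHS]conj1 -(cmean_szego z1) -cmean_conj; last first.
  apply: circ_comp_continuous (fun w => (1 - conj z * w)^-1) _ => t.
  apply: derivable_continuous; apply: derivableV; last exact: one_sub_conj_derivable.
  by apply: one_sub_conj_neq0 => //; rewrite cabs_circ.
apply: eq_cmean => t; rewrite conjV conjD conj1 conjN conjM conjK conj_circ.
have := circ_neq0 t; have := circ_sub_neq0 t z1 => h0 h1.
by field; rewrite h1 h0.
Qed.

(** Cauchy's theorem for the difference quotient of [h] at [z]; this is what the exceptional point
    [z0] of [cauchy_circle] is for. *)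
Lemma cauchy_formula h rho z : 1 < rho -> holomorphic_disc rho h -> cabs z < 1 ->
  cmean (fun t => h (circ t) * (circ t / (circ t - z))) = h z.
Proof.
move=> rho1 dh z1.
have [l hl] := derivable_approx (dh z (lt_trans z1 rho1)).
(* The difference quotient of h at z is continuous, and differentiable off z. *)
pose k w := if w == z then l else (h w - h z) / (w - z).
have dk w : cabs w < rho -> w != z -> derivable k w 1.
  move=> wr wz; apply: (@near_eq_derivable _ _ _ (fun w => (h w - h z) / (w - z))).
    have wz0 : 0 < cabs (w - z) by rewrite cabs_gt0 subr_eq0.
    apply/Cplx_nbhsP; exists (cabs (w - z)) => // u hu; rewrite /k.
    by case: eqVneq hu => // ->; rewrite cabsB ltxx.
  apply: cderivable_div; first by rewrite subr_eq0.
    by apply: cderivableB; [exact: dh|exact: cderivable_cst].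
  by apply: cderivableB; [exact: cderivable_id|exact: cderivable_cst].
have ck w : cabs w < rho -> {for w, continuous k}.
  move=> wr; have [->|wz] := eqVneq w z; last exact/derivable_continuous/dk.
  apply/continuousP_eps => e e0.
  have [d d0 H] := hl (e / 2) ltac:(by rewrite divr_gt0).
  exists d => // u hu; rewrite /k eqxx; case: eqVneq => [_|uz].
    by rewrite subrr cabs0.
  have uz0 : 0 < cabs (u - z) by rewrite cabs_gt0 subr_eq0.
  have -> : (h u - h z) / (u - z) - l = (h u - h z - l * (u - z)) / (u - z).
    by field; rewrite subr_eq0.
  rewrite cabsM cabsV ltr_pdivrMr //; apply: le_lt_trans (H u hu) _.
  by rewrite ltr_pM2r //; lra.
have kc := cauchy_circle rho1 ck dk.
have cont_kernel : continuous (fun t => circ t / (circ t - z)).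
  apply: circ_comp_continuous (fun w => w / (w - z)) _ => t.
  apply: derivable_continuous; apply: cderivable_div; first exact: circ_sub_neq0.
    exact: cderivable_id.
  by apply: cderivableB; [exact: cderivable_id|exact: cderivable_cst].
have cont_k : continuous (fun t => circ t * k (circ t)).
  move=> t; apply: cvgM; first exact: circ_continuous.
  by apply: circ_comp_continuous => s; apply: ck; rewrite cabs_circ.
rewrite (@eq_cmean _ _ (fun t => circ t * k (circ t) + h z * (circ t / (circ t - z)))).
  have cZ : continuous (fun t => h z * (circ t / (circ t - z))).
    by move=> t; apply: cvgM; [exact: cvg_cst|exact: cont_kernel].
  by rewrite (cmeanD cont_k cZ) (cmeanZ _ cont_kernel) kc cmean_cauchy_kernel // add0r mulr1.
move=> t; have tz := circ_sub_neq0 t z1.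
rewrite /k; case: eqVneq => [e|_]; first by rewrite e subrr eqxx in tz.
by field.
Qed.

Lemma derivable_circ_continuous rho h : 1 < rho -> holomorphic_disc rho h ->
  continuous (fun t => h (circ t)).
Proof.
move=> rho1 dh; apply: circ_comp_continuous => t.
by apply/derivable_continuous/dh; rewrite cabs_circ.
Qed.

(* For G of positive real part this kernel is positive definite, being the mean of
   2 re G times a rank one kernel (herglotz_kernelE). *)
Definition herglotz_kernel G z w := (G z + conj (G w)) / (1 - z * conj w).

Lemma szego_circE z t : cabs z < 1 -> circ t / (circ t - z) = (1 - conj (circ t) * z)^-1.
Proof.
move=> z1; rewrite conj_circ; have := circ_neq0 t; have := circ_sub_neq0 t z1 => h0 h1.
by field; rewrite h1 h0.
Qed.

Lemma szego_continuous z : cabs z < 1 -> continuous (fun t => (1 - conj (circ t) * z)^-1).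
Proof.
move=> z1; rewrite (_ : (fun _ => _) = (fun t => circ t / (circ t - z))); last first.
  by apply/funext => t; rewrite szego_circE.
apply: circ_comp_continuous (fun w => w / (w - z)) _ => t.
apply: derivable_continuous; apply: cderivable_div; first exact: circ_sub_neq0.
  exact: cderivable_id.
by apply: cderivableB; [exact: cderivable_id|exact: cderivable_cst].
Qed.

Lemma conj_comp_continuous (g : R -> Cplx R) : continuous g -> continuous (fun t => conj (g t)).
Proof.
by move=> cg t; apply: (@continuous_comp _ _ _ g (@conj R)); [exact: cg|exact: conj_continuous].
Qed.

(** The conjugated factor equals [(1 - xi * conj w)^-1], holomorphic in [xi], while the other one is
    the Cauchy kernel at [z]; so this is Cauchy's formula for [G x / (1 - conj w * x)]. *)
Lemma cmean_herglotz_half G rho z w : 1 < rho -> holomorphic_disc rho G ->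
  cabs z < 1 -> cabs w < 1 ->
  cmean (fun t => G (circ t) * ((1 - conj (circ t) * z)^-1 * conj (1 - conj (circ t) * w)^-1))
    = G z / (1 - z * conj w).
Proof.
move=> rho1 dG z1 w1; rewrite [z * _]mulrC.
pose h x := G x / (1 - conj w * x).
have -> : G z / (1 - conj w * z) = h z by [].
rewrite -(@cauchy_formula h (Num.min rho (2 / (1 + cabs w)))) //.
- apply: eq_cmean => t; rewrite szego_circE // /h conjV conjD conj1 conjN conjM conjK.
  by rewrite [circ t * conj w]mulrC; ring.
- by rewrite lt_min rho1 two_div_gt1.
- move=> x; rewrite lt_min => /andP[x1 x2]; apply: cderivable_div.
  + exact: derivable_one_sub_conj.
  + exact: dG.
  + exact: one_sub_conj_derivable.
Qed.

(** Since [2 re G = G + conj G], the mean splits into [cmean_herglotz_half] and its conjugate with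
    [z] and [w] exchanged. *)
Lemma herglotz_kernelE G rho z w : 1 < rho -> holomorphic_disc rho G ->
  cabs z < 1 -> cabs w < 1 ->
  cmean (fun t => ofR (2 * re (G (circ t))) *
           ((1 - conj (circ t) * z)^-1 * conj (1 - conj (circ t) * w)^-1))
    = herglotz_kernel G z w.
Proof.
move=> rho1 dG z1 w1; have h1 := cmean_herglotz_half rho1 dG z1 w1.
have h2 := cmean_herglotz_half rho1 dG w1 z1.
have cG := derivable_circ_continuous rho1 dG.
have cz := szego_continuous z1; have cw := szego_continuous w1.
have c1 : continuous (fun t => G (circ t) *
    ((1 - conj (circ t) * z)^-1 * conj (1 - conj (circ t) * w)^-1)).
  move=> t; apply: cvgM; first exact: cG.
  by apply: cvgM; [exact: cz|exact: (conj_comp_continuous cw)].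
have c2 : continuous (fun t => G (circ t) *
    ((1 - conj (circ t) * w)^-1 * conj (1 - conj (circ t) * z)^-1)).
  move=> t; apply: cvgM; first exact: cG.
  by apply: cvgM; [exact: cw|exact: (conj_comp_continuous cz)].
rewrite (@eq_cmean _ _ (fun t => G (circ t) *
    ((1 - conj (circ t) * z)^-1 * conj (1 - conj (circ t) * w)^-1) +
  conj (G (circ t) * ((1 - conj (circ t) * w)^-1 * conj (1 - conj (circ t) * z)^-1)))).
  rewrite (cmeanD c1 (conj_comp_continuous c2)).
  rewrite (cmean_conj c2) h1 h2 /herglotz_kernel conjM conjV conjD conj1 conjN conjM conjK.
  by rewrite [conj w * z]mulrC mulrDl.
by move=> t; rewrite -addz_conj !conjM conjK; ring.
Qed.

(** The diagonal [w = z] of [herglotz_kernelE], as [|1 - conj xi * z| = |xi - z|] on the circle. *)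
Lemma poisson_formula G rho z : 1 < rho -> holomorphic_disc rho G -> cabs z < 1 ->
  \int[lebesgue_measure]_(t in `[0, 1])
     (re (G (circ t)) * ((1 - cabs z ^+ 2) / cabs (circ t - z) ^+ 2)) = re (G z).
Proof.
move=> rho1 dG z1.
have K := herglotz_kernelE rho1 dG z1 z1.
have z2 : 0 < 1 - cabs z ^+ 2 by rewrite subr_gt0 exprn_ilt1 ?cabs_ge0.
have KE : herglotz_kernel G z z = ofR (2 * re (G z) / (1 - cabs z ^+ 2)).
  by rewrite /herglotz_kernel addz_conj mul_conj -ofR1 -ofRN -ofRD -ofRV -ofRM.
have := congr1 (@re R) K; rewrite KE re_ofR re_cmean.
under eq_Rintegral => t _.
  have -> : re (ofR (2 * re (G (circ t))) * ((1 - conj (circ t) * z)^-1 *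
     conj (1 - conj (circ t) * z)^-1)) =
     2 / (1 - cabs z ^+ 2) *
     (re (G (circ t)) * ((1 - cabs z ^+ 2) / cabs (circ t - z) ^+ 2)).
    rewrite mul_conj -ofRM re_ofR -szego_circE // cabsM cabsV cabs_circ mul1r.
    by field; rewrite cabs_eq0 circ_sub_neq0 //= gt_eqF.
  over.
have ic : lebesgue_measure.-integrable `[0, 1] (EFin \o (fun t =>
    re (G (circ t)) * ((1 - cabs z ^+ 2) / cabs (circ t - z) ^+ 2))).
  apply: integrable01 => t; apply: cvgM.
    apply: (@continuous_comp _ _ _ (fun t => G (circ t)) (@re R)); last exact: re_continuous.
    exact: (derivable_circ_continuous rho1 dG).
  apply: cvgM; first exact: cvg_cst.
  apply: cvgV; first by rewrite expf_neq0 // cabs_eq0 circ_sub_neq0.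
  apply: cvgM; apply: (@continuous_comp _ _ _ (fun t => circ t - z) (@cabs R));
    (try exact: cabs_continuous); apply: cvgB; (try exact: cvg_cst);
    exact: circ_continuous.
have /= -> := @RintegralZl _ _ _ lebesgue_measure `[0, 1] _ (2 / (1 - cabs z ^+ 2)) (measurable_itv _) ic.
move=> E; have : 2 / (1 - cabs z ^+ 2) != 0 by rewrite mulf_neq0 ?invr_eq0 ?gt_eqF.
by move=> /mulfI; apply; rewrite E; ring.
Qed.

(** The form is the mean of [2 re G] times [|S z + c * S w|^2], where [S] is the Szego kernel. *)
Lemma herglotz_kernel_quadratic G rho z w c : 1 < rho -> holomorphic_disc rho G ->
  (forall t, 0 <= re (G (circ t))) -> cabs z < 1 -> cabs w < 1 ->
  0 <= re (herglotz_kernel G z z + conj c * herglotz_kernel G z w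
        + c * herglotz_kernel G w z + c * conj c * herglotz_kernel G w w).
Proof.
move=> rho1 dG G0 z1 w1.
pose S x t := (1 - conj (circ t) * x)^-1.
pose I x y t := ofR (2 * re (G (circ t))) * (S x t * conj (S y t)).
have cI x y : cabs x < 1 -> cabs y < 1 -> continuous (I x y).
  move=> x1 y1 t; apply: cvgM.
    apply: (@continuous_comp _ _ _ (fun t => 2 * re (G (circ t))) (@ofR R)); last exact: ofR_continuous.
    apply: cvgM; first exact: cvg_cst.
    apply: (@continuous_comp _ _ _ (fun t => G (circ t)) (@re R)); last exact: re_continuous.
    exact: (derivable_circ_continuous rho1 dG).
  by apply: cvgM; [exact: szego_continuous|exact/conj_comp_continuous/szego_continuous].
have cZ a x y : cabs x < 1 -> cabs y < 1 -> continuous (fun t => a * I x y t).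
  by move=> x1 y1 t; apply: cvgM; [exact: cvg_cst|exact: cI].
rewrite -!(herglotz_kernelE rho1 dG) // -/(I z z) -/(I z w) -/(I w z) -/(I w w).
rewrite -(cmeanZ (conj c) (cI z w z1 w1)) -(cmeanZ c (cI w z w1 z1)).
rewrite -(cmeanZ (c * conj c) (cI w w w1 w1)).
have c1 : continuous (fun t => I z z t + conj c * I z w t).
  by move=> t; apply: cvgD; [exact: cI|exact: cZ].
have c2 : continuous (fun t => I z z t + conj c * I z w t + c * I w z t).
  by move=> t; apply: cvgD; [exact: c1|exact: cZ].
rewrite -(cmeanD (cI z z z1 z1) (cZ (conj c) z w z1 w1)).
rewrite -(cmeanD c1 (cZ c w z w1 z1)) -(cmeanD c2 (cZ (c * conj c) w w w1 w1)).
apply: re_cmean_ge0 => t.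
have -> : I z z t + conj c * I z w t + c * I w z t + c * conj c * I w w t =
     ofR (2 * re (G (circ t))) * ((S z t + c * S w t) * conj (S z t + c * S w t)).
  by rewrite /I conjD conjM; ring.
by rewrite mul_conj -ofRM re_ofR mulr_ge0 ?sqr_ge0 // mulr_ge0.
Qed.

End cauchy_formula.

(** * Pick's inequality *)

Section pick.
Context {R : realType}.
Notation circ := (@circle_param R).
Implicit Types (G : Cplx R -> Cplx R) (z w : Cplx R) (rho r : R).

(** The determinant condition [|K z w|^2 <= K z z * K w w] for [K = herglotz_kernel G], with
    denominators cleared so that it passes to limits. *)
Definition pick_inequality G z w :=
  cabs (G z + conj (G w)) ^+ 2 * ((1 - cabs z ^+ 2) * (1 - cabs w ^+ 2)) <=
  4 * re (G z) * re (G w) * cabs (1 - z * conj w) ^+ 2.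

Let quadratic_discriminant (a b n : R) : 0 <= n -> 0 <= b ->
  (forall t, 0 <= a - 2 * t * n + t ^+ 2 * n * b) -> n <= a * b.
Proof.
move=> n0; rewrite le_eqVlt => /orP[/eqP <-|b0] H.
  rewrite mulr0 leNgt; apply/negP => n1.
  (* With [b = 0] the expression is affine in [t], and this [t] gives it the value -1. *)
  have := H ((a + 1) / (2 * n)); rewrite mulr0 addr0.
  have -> : 2 * ((a + 1) / (2 * n)) * n = a + 1 by field; rewrite gt_eqF.
  lra.
have := H b^-1; have -> : a - 2 * b^-1 * n + b^-1 ^+ 2 * n * b = a - n / b.
  by field; rewrite gt_eqF.
by rewrite subr_ge0 ler_pdivrMr.
Qed.

Lemma pick_closed_disc G rho z w : 1 < rho -> holomorphic_disc rho G ->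
  (forall t, 0 <= re (G (circ t))) -> 0 <= re (G w) ->
  cabs z < 1 -> cabs w < 1 -> pick_inequality G z w.
Proof.
move=> rho1 dG G0 Gw0 z1 w1; rewrite /pick_inequality.
have z2 : 0 < 1 - cabs z ^+ 2 by rewrite subr_gt0 exprn_ilt1 ?cabs_ge0.
have w2 : 0 < 1 - cabs w ^+ 2 by rewrite subr_gt0 exprn_ilt1 ?cabs_ge0.
have KE x : herglotz_kernel G x x = ofR (2 * re (G x) / (1 - cabs x ^+ 2)).
  by rewrite /herglotz_kernel addz_conj mul_conj -ofR1 -ofRN -ofRD -ofRV -ofRM.
set kap := herglotz_kernel G z w.
have zw0 : 1 - z * conj w != 0 by rewrite mulrC; apply: one_sub_conj_neq0 => //; exact: ltW.
have wz : herglotz_kernel G w z = conj kap.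
  rewrite /kap /herglotz_kernel conjM conjD conjV conjD conj1 conjN conjM !conjK.
  by rewrite [w * _]mulrC [G w + _]addrC.
have := @quadratic_discriminant (2 * re (G z) / (1 - cabs z ^+ 2))
  (2 * re (G w) / (1 - cabs w ^+ 2)) (cabs kap ^+ 2).
rewrite sqr_ge0 divr_ge0 ?mulr_ge0 // ?(ltW w2) //.
move=> /(_ isT isT) H.
have {}H : cabs kap ^+ 2 <= 2 * re (G z) / (1 - cabs z ^+ 2) * (2 * re (G w) / (1 - cabs w ^+ 2)).
  apply: H => t.
  (* With [c] a real multiple of [kap] both cross terms become [- t * |kap|^2], leaving a real
     quadratic polynomial in [t]. *)
  have := herglotz_kernel_quadratic (- (ofR t * kap)) rho1 dG G0 z1 w1.
  rewrite wz !KE -/kap conjN conjM conj_ofR.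
  have -> : - (ofR t * conj kap) * kap = - ofR (t * cabs kap ^+ 2).
    by rewrite ofRM -mul_conj; ring.
  have -> : - (ofR t * kap) * conj kap = - ofR (t * cabs kap ^+ 2).
    by rewrite ofRM -mul_conj; ring.
  have -> : - (ofR t * kap) * - (ofR t * conj kap) = ofR (t ^+ 2 * cabs kap ^+ 2).
    by rewrite ofRM -mul_conj expr2 ofRM; ring.
  rewrite -ofRM !cplxE.
  congr (_ <= _); ring.
have kE : cabs kap ^+ 2 = cabs (G z + conj (G w)) ^+ 2 / cabs (1 - z * conj w) ^+ 2.
  by rewrite /kap /herglotz_kernel cabsM cabsV exprMn exprVn.
move: H; rewrite kE ler_pdivrMr; last by rewrite exprn_gt0 // cabs_gt0.
have -> : 2 * re (G z) / (1 - cabs z ^+ 2) * (2 * re (G w) / (1 - cabs w ^+ 2)) *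
    cabs (1 - z * conj w) ^+ 2 =
    4 * re (G z) * re (G w) * cabs (1 - z * conj w) ^+ 2 /
    ((1 - cabs z ^+ 2) * (1 - cabs w ^+ 2)).
  by field; rewrite !gt_eqF.
by rewrite ler_pdivlMr // mulr_gt0.
Qed.

Lemma dilation_holomorphic G r : 0 < r < 1 -> holomorphic_disc 1 G ->
  holomorphic_disc r^-1 (fun z => G (ofR r * z)).
Proof.
move=> /andP[r0 r1] dG z zr.
apply: (@cderivable_comp _ (fun x => ofR r * x) G).
  by apply: cderivableM; [exact: cderivable_cst|exact: cderivable_id].
apply: dG; rewrite cabsM cabs_ofR gtr0_norm // mulrC -ltr_pdivlMr //.
by rewrite div1r.
Qed.

Lemma cvg_dilation G z : {for z, continuous G} ->
  G (ofR r * z) @[r --> (1 : R)^'-] --> G z.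
Proof.
move=> cG; apply: (cvg_continuous_comp (u := fun r => ofR r * z) cG).
have -> : nbhs z = nbhs (ofR 1 * z) by rewrite ofR1 mul1r.
apply: cvgM; last exact: cvg_cst.
by apply: cvg_at_left_filter; exact: ofR_continuous.
Qed.

(** The dilates [G (r z)] are holomorphic beyond the closed disc, and the inequality survives
    [r -> 1]. *)
Lemma pick_disc G z w : holomorphic_disc 1 G ->
  (forall x, cabs x < 1 -> 0 <= re (G x)) ->
  cabs z < 1 -> cabs w < 1 -> pick_inequality G z w.
Proof.
move=> dG G0 z1 w1.
have cz : {for z, continuous G} by apply/derivable_continuous/dG.
have cw : {for w, continuous G} by apply/derivable_continuous/dG.
have lz := cvg_dilation cz; have lw := cvg_dilation cw.
have re_cvg (u : R -> Cplx R) l : u r @[r --> (1 : R)^'-] --> l ->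
    re (u r) @[r --> (1 : R)^'-] --> re l.
  exact: (cvg_continuous_comp (@re_continuous R l)).
have cabs2_cvg (u : R -> Cplx R) l : u r @[r --> (1 : R)^'-] --> l ->
    cabs (u r) ^+ 2 @[r --> (1 : R)^'-] --> cabs l ^+ 2.
  move=> h; have h' : cabs (u r) @[r --> (1 : R)^'-] --> cabs l.
    exact: (cvg_continuous_comp (@cabs_continuous R l) h).
  by rewrite !expr2; apply: cvgM.
apply: (@ler_cvg_to _ ((1 : R)^'-) _ _
  (fun r => cabs (G (ofR r * z) + conj (G (ofR r * w))) ^+ 2 *
     ((1 - cabs z ^+ 2) * (1 - cabs w ^+ 2)))
  (fun r => 4 * re (G (ofR r * z)) * re (G (ofR r * w)) * cabs (1 - z * conj w) ^+ 2)).
- apply: cvgM; last exact: cvg_cst.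
  have lcw : conj (G (ofR r * w)) @[r --> (1 : R)^'-] --> conj (G w).
    exact: (cvg_continuous_comp (@conj_continuous R (G w)) lw).
  exact: (cabs2_cvg _ _ (cvgD lz lcw)).
- apply: cvgM; last exact: cvg_cst.
  apply: cvgM; last exact: (re_cvg _ _ lw).
  by apply: cvgM; [exact: cvg_cst|exact: (re_cvg _ _ lz)].
near=> r.
have r01 : 0 < r < 1 by apply/andP; split; near: r; [exact: nbhs_left_gt|exact: nbhs_left_lt].
have Gr0 x : cabs x <= 1 -> 0 <= re (G (ofR r * x)).
  case/andP: r01 => r0 r1 x1; apply: G0; rewrite cabsM cabs_ofR gtr0_norm //.
  by apply: le_lt_trans r1; rewrite ler_piMr // ltW.
have r1V : 1 < r^-1 by case/andP: r01 => r0 r1; rewrite -[1]invr1 ltf_pV2 ?posrE.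
have Gc t : 0 <= re (G (ofR r * circ t)) by apply: Gr0; rewrite cabs_circ.
have Gw : 0 <= re (G (ofR r * w)) by apply: Gr0; exact: ltW.
exact: (@pick_closed_disc (fun z => G (ofR r * z)) r^-1 z w r1V
  (dilation_holomorphic r01 dG) Gc Gw z1 w1).
Unshelve. all: by end_near. Qed.

End pick.

(** * The Julia-Caratheodory theorem *)

Section julia_caratheodory.
Context {R : realType}.
Implicit Types (z w p eta : Cplx R) (f : Cplx R -> Cplx R).

(** For [|p| = 1], the conformal map of the disc onto the right half-plane with its pole at [p]. Its
    real part is the Poisson kernel at [p], which links Pick's inequality to harmonic measure. *)
Definition cayley p z := (p + z) / (p - z).

Lemma cayley_neq0 p z : cabs p = 1 -> cabs z < 1 -> p - z != 0.
Proof. by move=> p1 z1; rewrite subr_eq0; apply: contraTneq z1 => <-; rewrite p1 ltxx. Qed.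

Lemma re_cayley p z : cabs p = 1 -> cabs z < 1 ->
  re (cayley p z) = (1 - cabs z ^+ 2) / cabs (p - z) ^+ 2.
Proof.
move=> p1 z1; have pz := cayley_neq0 p1 z1.
have pz2 : cabs (p - z) ^+ 2 != 0 by rewrite expf_neq0 // cabs_eq0.
have -> : cayley p z = ofR (cabs (p - z) ^+ 2)^-1 * ((p + z) * conj (p - z)).
  rewrite ofRV -mul_conj /cayley; have := pz; rewrite -conj_eq0.
  by move: (conj (p - z)) => q q0; field; rewrite q0 pz.
have -> : 1 - cabs z ^+ 2 = cabs p ^+ 2 - cabs z ^+ 2 by rewrite p1 expr1n.
by rewrite !cabs_sqr !cplxE in pz2 *; field.
Qed.

Lemma one_sub_sqr_gt0 (x : R) : 0 <= x -> x < 1 -> 0 < 1 - x ^+ 2.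
Proof. by move=> x0 x1; rewrite subr_gt0 exprn_ilt1. Qed.

Lemma re_cayley_gt0 p z : cabs p = 1 -> cabs z < 1 -> 0 < re (cayley p z).
Proof.
move=> p1 z1; rewrite re_cayley // divr_gt0 ?one_sub_sqr_gt0 ?cabs_ge0 //.
by rewrite exprn_gt0 // cabs_gt0 cayley_neq0.
Qed.

Lemma cayley_derivable p z : cabs p = 1 -> cabs z < 1 -> derivable (cayley p) z 1.
Proof.
move=> p1 z1; apply: (@cderivable_div _ (fun z => p + z) (fun z => p - z)).
- exact: cayley_neq0.
- by apply: cderivableD; [exact: cderivable_cst|exact: cderivable_id].
- by apply: cderivableB; [exact: cderivable_cst|exact: cderivable_id].
Qed.

Lemma frequently_ge0 (u : R^nat) l : u n @[n --> \oo] --> l ->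
  (forall N, exists2 n, (N <= n)%N & 0 <= u n) -> 0 <= l.
Proof.
move=> /cvgrPdist_lt ul fr; rewrite leNgt; apply/negP => l0.
have [N _ HN] := ul (- l) ltac:(by rewrite oppr_gt0).
have [n Nn un] := fr N; have := HN n Nn; rewrite /= ltr_norml => /andP[]; lra.
Qed.

Lemma cvg_cabs2 {T} {F : set_system T} {FF : Filter F} (u : T -> Cplx R) l :
  u x @[x --> F] --> l -> cabs (u x) ^+ 2 @[x --> F] --> cabs l ^+ 2.
Proof.
move=> h; have h' := cvg_continuous_comp (@cabs_continuous R l) h.
by rewrite expr2; exact: (cvgM h' h').
Qed.

Lemma cvg_conj {T} {F : set_system T} {FF : Filter F} (u : T -> Cplx R) l :
  u x @[x --> F] --> l -> conj (u x) @[x --> F] --> conj l.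
Proof. exact: (cvg_continuous_comp (@conj_continuous R l)). Qed.

Variables (f : Cplx R -> Cplx R) (p eta : Cplx R).
Hypothesis f_self : analytic_self_map f.
Hypothesis p1 : cabs p = 1.
Hypothesis eta1 : cabs eta = 1.

Let f1 z : cabs z < 1 -> cabs (f z) < 1.
Proof. by move=> /unit_discE /f_self[_ /unit_discE]. Qed.

Let fd z : cabs z < 1 -> derivable f z 1.
Proof. by move=> /unit_discE /f_self[]. Qed.

Let F z := cayley eta (f z).

Let F_derivable z : cabs z < 1 -> derivable F z 1.
Proof.
move=> z1; apply: (@cderivable_comp _ f (cayley eta)); first exact: fd.
by apply: cayley_derivable => //; exact: f1.
Qed.

Let reF_gt0 z : cabs z < 1 -> 0 < re (F z).
Proof. by move=> z1; apply: re_cayley_gt0 => //; exact: f1. Qed.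

(** Pick's inequality for [F] at [z] and [w n], multiplied by [|eta - f (w n)|^2]: this removes the
    pole that [F (w n)] approaches, and [u n] then converges. Nonnegativity of [u n] for infinitely
    many [n] passes to the limit. *)
Lemma julia_inequality (w : nat -> Cplx R) (M : R) :
  (forall n, cabs (w n) < 1) -> w n @[n --> \oo] --> p ->
  f (w n) @[n --> \oo] --> eta ->
  (forall N, exists2 n, (N <= n)%N &
     1 - cabs (f (w n)) ^+ 2 <= M * (1 - cabs (w n) ^+ 2)) ->
  forall z, cabs z < 1 -> re (cayley p z) <= M * re (F z).
Proof.
move=> w1 wp fw fr z z1.
pose u n := 4 * M * re (F z) * cabs (1 - z * conj (w n)) ^+ 2 -
  cabs (F z * conj (eta - f (w n)) + conj (eta + f (w n))) ^+ 2 * (1 - cabs z ^+ 2).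
have z2 := one_sub_sqr_gt0 (cabs_ge0 z) z1.
have u0 N : exists2 n, (N <= n)%N & 0 <= u n.
  have [n Nn hn] := fr N; exists n => //; rewrite /u subr_ge0.
  have w2 := one_sub_sqr_gt0 (cabs_ge0 (w n)) (w1 n).
  have ew := cayley_neq0 eta1 (f1 (w1 n)).
  have := @pick_disc R F z (w n) F_derivable (fun x hx => ltW (reF_gt0 hx)) z1 (w1 n).
  rewrite /pick_inequality [re (F (w n))]re_cayley //; last exact: f1.
  have -> : F z * conj (eta - f (w n)) + conj (eta + f (w n)) =
      (F z + conj (F (w n))) * conj (eta - f (w n)).
    rewrite mulrDl -conjM; congr (_ + conj _); rewrite /F /cayley.
    by field.
  rewrite cabsM cabs_conj exprMn.
  have e2 : 0 < cabs (eta - f (w n)) ^+ 2 by rewrite exprn_gt0 // cabs_gt0.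
  set X := cabs (F z + _) ^+ 2; set Y := cabs (eta - _) ^+ 2 in e2 *.
  set W := 1 - cabs (w n) ^+ 2 in w2 hn *; set Z := 1 - cabs z ^+ 2 in z2 *.
  set S := cabs (1 - _) ^+ 2; set B := 1 - cabs (f _) ^+ 2 in hn *.
  have rF := reF_gt0 z1; set rf := re (F z) in rF *.
  have S0 : 0 <= S by exact: sqr_ge0.
  have -> : 4 * rf * (B / Y) * S = 4 * rf * B * S / Y by field; rewrite gt_eqF.
  rewrite ler_pdivlMr // => h.
  rewrite -(ler_pM2r w2).
  have -> : X * Y * Z * W = X * (Z * W) * Y by ring.
  apply: (le_trans h).
  have -> : 4 * M * rf * S * W = 4 * rf * S * (M * W) by ring.
  have -> : 4 * rf * B * S = 4 * rf * S * B by ring.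
  apply: ler_wpM2l; last exact: hn.
  by rewrite mulr_ge0 // mulr_ge0 // ltW.
have ul : u n @[n --> \oo] --> 4 * M * re (F z) * cabs (1 - z * conj p) ^+ 2 -
    cabs (F z * conj (eta - eta) + conj (eta + eta)) ^+ 2 * (1 - cabs z ^+ 2).
  have c1 : 1 - z * conj (w n) @[n --> \oo] --> 1 - z * conj p.
    exact: (cvgB (cvg_cst _) (cvgM (cvg_cst _) (cvg_conj wp))).
  have c2 : F z * conj (eta - f (w n)) + conj (eta + f (w n)) @[n --> \oo] -->
      F z * conj (eta - eta) + conj (eta + eta).
    apply: cvgD; last exact: (cvg_conj (cvgD (cvg_cst _) fw)).
    apply: cvgM; first exact: cvg_cst.
    exact: (cvg_conj (cvgB (cvg_cst _) fw)).
  exact: (cvgB (cvgM (cvg_cst _) (cvg_cabs2 c1)) (cvgM (cvg_cabs2 c2) (cvg_cst _))).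
have := frequently_ge0 ul u0; rewrite subrr conj0 mulr0 add0r cabs_conj.
have -> : cabs (eta + eta) = 2.
  have -> : eta + eta = ofR 2 * eta by apply: cplx_eqP; rewrite !cplxE; ring.
  by rewrite cabsM cabs_ofR eta1 mulr1 ger0_norm.
have -> : cabs (1 - z * conj p) = cabs (p - z).
  rewrite -[LHS]mul1r -[in LHS]p1 -cabsM mulrBr mulr1 mulrCA mul_conj p1 expr1n.
  by rewrite ofR1 mulr1.
rewrite re_cayley // ler_pdivrMr; last by rewrite exprn_gt0 // cabs_gt0 cayley_neq0.
set Y := cabs (p - z) ^+ 2; set X := 1 - _; set rf := re (F z).
have -> : 4 * M * rf * Y = 4 * (M * rf * Y) by ring.
by lra.
Qed.

Section residual_part.
Variable c : R.
Hypothesis c_le : forall z, cabs z < 1 -> c * re (cayley p z) <= re (F z).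
Hypothesis c_inf : forall e : R, 0 < e ->
  exists2 w, cabs w < 1 & re (F w) <= (c + e) * re (cayley p w).

(* c is the largest constant for which F - c * cayley p keeps a nonnegative real
   part; Pick's inequality then makes this residual o(1 / |p - z|) in Stolz angles. *)
Let G z := F z - ofR c * cayley p z.

Let G_derivable z : cabs z < 1 -> derivable G z 1.
Proof.
move=> z1; apply: (@cderivableB _ F (fun z => ofR c * cayley p z)).
  exact: F_derivable.
apply: (@cderivableM _ (fun=> ofR c) (cayley p)); first exact: cderivable_cst.
exact: cayley_derivable.
Qed.

Let reG z : re (G z) = re (F z) - c * re (cayley p z).
Proof. by rewrite /G !cplxE mul0r subr0. Qed.

(** By extremality of [c] there is a [w] where [re (G w)] is tiny compared with [re (cayley p w)].
    If [|G z| <= 2 |G w|], closeness of [z] to [p] suffices. Otherwise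
    [|G z + conj (G w)| >= |G z| / 2], and Pick's inequality at [z] and [w] bounds
    [|G z| (1 - |z|^2)], hence [|z - p| |G z|] in the Stolz angle. *)
Lemma residual_decay (b e : R) : 0 < b -> 0 < e -> exists2 d : R, 0 < d &
  forall z, cabs z < 1 -> cabs (z - p) < d -> cabs (z - p) < b * (1 - cabs z) ->
    cabs ((p - z) * G z) <= e.
Proof.
move=> b0 e0.
(* 64 collects the 4 of Pick's inequality, a 4 from [(X / 2) ^+ 2] and a 4 from [(2 * P) ^+ 2]; [b]
   is the aperture. *)
have e'0 : 0 < e / (64 * b) by rewrite divr_gt0 // mulr_gt0.
have [w w1 hw] := c_inf e'0.
have pw : 0 < cabs (p - w) by rewrite cabs_gt0 cayley_neq0.
set A := cabs (G w); have A0 : 0 <= A by exact: cabs_ge0.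
exists (Num.min (cabs (p - w)) (e / (2 * A + 1))).
  by rewrite lt_min pw divr_gt0 //; lra.
move=> z z1; rewrite lt_min => /andP[zd1 zd2] zb.
rewrite cabsM cabsB; set X := cabs (G z); set D := cabs (z - p) in zd1 zd2 zb *.
have X0 : 0 <= X by exact: cabs_ge0.
have D0 : 0 <= D by exact: cabs_ge0.
have [XA|AX] := ltP X (2 * A).
  have : D * X <= e / (2 * A + 1) * (2 * A + 1).
    by apply: ler_pM => //; [exact: ltW|lra].
  by rewrite divfK // gt_eqF //; lra.
have z2 := one_sub_sqr_gt0 (cabs_ge0 z) z1.
have w2 := one_sub_sqr_gt0 (cabs_ge0 w) w1.
have G0 x : cabs x < 1 -> 0 <= re (G x) by move=> x1; rewrite reG subr_ge0 c_le.
have := @pick_disc R G z w G_derivable G0 z1 w1; rewrite /pick_inequality.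
have hGw : re (G w) <= e / (64 * b) * ((1 - cabs w ^+ 2) / cabs (p - w) ^+ 2).
  by rewrite -re_cayley // reG; move: hw; rewrite mulrDl; lra.
have hS : cabs (1 - z * conj w) <= 2 * cabs (p - w).
  have -> : 1 - z * conj w = p * conj (p - w) - (z - p) * conj w.
    by rewrite conjD conjN mulrBr mul_conj p1 expr1n ofR1; ring.
  apply: le_trans (cabsD _ _) _; rewrite cabsN !cabsM !cabs_conj p1 mul1r -/D.
  have : D * cabs w <= D * 1 by rewrite ler_wpM2l // ltW.
  lra.
have hX : X / 2 <= cabs (G z + conj (G w)).
  have := cabs_sub_ge (G z) (- conj (G w)); rewrite opprK cabsN cabs_conj -/A -/X; lra.
have rGz : re (G z) <= X by apply: le_trans (ler_norm _) (re_le_cabs _).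
have rGz0 := G0 _ z1; have rGw0 := G0 _ w1.
set Z := 1 - cabs z ^+ 2 in z2 *; set W := 1 - cabs w ^+ 2 in w2 hGw *.
set P := cabs (p - w) in pw hGw hS *; set S := cabs (1 - _) in hS *.
set K := cabs (_ + _) in hX *; set e' := e / (64 * b) in e'0 hGw *.
move=> H.
have H1 : (X / 2) ^+ 2 * (Z * W) <= 4 * X * (e' * (W / P ^+ 2)) * (2 * P) ^+ 2.
  apply: (@le_trans _ _ (K ^+ 2 * (Z * W))).
    apply: ler_wpM2r; first by rewrite mulr_ge0 // ltW.
    by rewrite ler_pXn2r // nnegrE ?cabs_ge0 // divr_ge0.
  apply: (le_trans H); apply: ler_pM.
  - by rewrite !mulr_ge0.
  - by rewrite sqr_ge0.
  - apply: ler_pM => //; first by rewrite mulr_ge0.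
    by rewrite ler_wpM2l.
  - by rewrite ler_pXn2r // nnegrE ?cabs_ge0 // mulr_ge0 // ltW.
have {H1} : X * (X * Z) <= X * (64 * e').
  rewrite -(ler_pM2r w2).
  have -> : X * (X * Z) * W = 4 * ((X / 2) ^+ 2 * (Z * W)) by field.
  have -> : X * (64 * e') * W = 4 * (4 * X * (e' * (W / P ^+ 2)) * (2 * P) ^+ 2).
    by field; rewrite gt_eqF.
  by rewrite ler_wpM2l.
move=> XX; have := X0; rewrite le_eqVlt => /orP[/eqP <-|Xp]; first by rewrite mulr0 ltW.
move: XX; rewrite (ler_pM2l Xp) => XZ.
have zz : 1 - cabs z <= Z.
  rewrite /Z; have := cabs_ge0 z; have : cabs z * cabs z <= 1 * cabs z.
    by rewrite ler_wpM2r ?cabs_ge0 // ltW.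
  by rewrite expr2; lra.
have : D * X <= b * (1 - cabs z) * X by rewrite ler_wpM2r // ltW.
have : b * (1 - cabs z) * X <= b * (X * Z).
  rewrite -mulrA; apply: ler_wpM2l; first exact: ltW.
  by rewrite mulrC; apply: ler_wpM2l.
have : b * (X * Z) <= b * (64 * e') by apply: ler_wpM2l; first exact: ltW.
have -> : b * (64 * e') = e by rewrite /e'; field; rewrite gt_eqF.
lra.
Qed.

Lemma residual_cvg (b : R) : 0 < b ->
  (p - z) * G z @[z --> within (stolz_angle b p) (nbhs p)] --> (0 : Cplx R).
Proof.
move=> b0; apply/Cplx_cvgP => e e0.
have e2 : 0 < e / 2 by rewrite divr_gt0.
have [d d0 H] := residual_decay b0 e2.
apply/Cplx_nbhsP; exists d => // z zd [/unit_discE z1 /= zb].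
rewrite subr0; apply: le_lt_trans (H z z1 zd _) _; last by lra.
move: zb; rewrite norm_cabs -/(ofR b) -ofR1 norm_cabs -ofRN -ofRD -ofRM.
by rewrite /ofR ltcR.
Qed.

(** From [F + 1 = 2 eta / (eta - f)] the quotient is [2 eta / H] with [H = (p - z) (F + 1)]. Writing
    [F = G + c * cayley p] shows that [H] tends to [2 c p], as the residual term vanishes in the
    limit. *)
Lemma angular_quotient_cvg (b : R) : 0 < b -> 0 < c ->
  (eta - f z) / (p - z) @[z --> within (stolz_angle b p) (nbhs p)] -->
  eta / (p * ofR c).
Proof.
move=> b0 cp.
set FF := within _ _.
have FFil : Filter FF by exact: within_filter.
have FFi : FF `=>` nbhs p by exact: cvg_within.
have zp : z @[z --> FF] --> p by [].
pose H z := (p - z) * G z + (ofR c * (p + z) + (p - z)).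
have Hl : H z @[z --> FF] --> 0 + (ofR c * (p + p) + (p - p)).
  apply: cvgD; first exact: residual_cvg.
  apply: cvgD; first exact: (cvgM (cvg_cst _) (cvgD (cvg_cst _) zp)).
  exact: (cvgB (cvg_cst _) zp).
have p0 : p != 0 by rewrite -cabs_gt0 p1.
have cn0 : ofR c != 0 by rewrite -cabs_gt0 cabs_ofR gtr0_norm.
have two0 : ofR 2 != 0 :> Cplx R by rewrite -cabs_gt0 cabs_ofR ger0_norm.
have lE : 0 + (ofR c * (p + p) + (p - p)) = ofR 2 * (ofR c * p).
  by apply: cplx_eqP; rewrite !cplxE; ring.
have l0 : 0 + (ofR c * (p + p) + (p - p)) != 0 by rewrite lE !mulf_neq0.
have E1 : (ofR 2 * eta) * (0 + (ofR c * (p + p) + (p - p)))^-1 = eta / (p * ofR c).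
  by rewrite lE; field; rewrite ?two0 ?cn0 ?p0.
have L1 : ofR 2 * eta / H x @[x --> FF] --> eta / (p * ofR c).
  by rewrite -E1; apply: cvgM; [exact: cvg_cst|exact: cvgV].
suff E2 : \forall z \near FF, ofR 2 * eta / H z = (eta - f z) / (p - z).
  exact: (cvg_near_eq E2 L1).
apply/Cplx_nbhsP; exists 1 => // z _ [/unit_discE z1 _].
have pz := cayley_neq0 p1 z1; have ez := cayley_neq0 eta1 (f1 z1).
have eta0 : eta != 0 by rewrite -cabs_gt0 eta1.
have HE : H z = ofR 2 * eta * (p - z) / (eta - f z).
  have -> : ofR 2 = 1 + 1 :> Cplx R by rewrite -ofR1 -ofRD.
  by rewrite /H /G /F /cayley; field; rewrite pz ez.
by rewrite /= HE; field; rewrite ?pz ?ez ?eta0 ?two0.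
Qed.

End residual_part.

End julia_caratheodory.

(** * A sequence of points along a radius *)

Section radial_sequence.
Context {R : realType}.

(** Sequences suit Fatou's lemma and dominated convergence; [n.+2] keeps every radius strictly
    between 0 and 1. *)
Definition rad (n : nat) : R := 1 - n.+2%:R^-1.

Lemma rad_lt1 n : rad n < 1.
Proof. by rewrite /rad ltrBlDr ltrDl invr_gt0. Qed.

Lemma rad_gt0 n : 0 < rad n.
Proof. by rewrite /rad subr_gt0 invf_lt1 // ltr1n. Qed.

Lemma cvg_rad : rad n @[n --> \oo] --> (1 : R).
Proof.
apply/cvgrPdist_lt => e e0; near=> n.
rewrite /rad opprB addrC subrK ger0_norm ?invr_ge0 //.
apply: (@lt_trans _ _ n.+1%:R^-1); first by rewrite ltf_pV2 ?posrE // ltr_nat.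
by near: n; exact: (near_infty_natSinv_lt (PosNum e0)).
Unshelve. all: by end_near. Qed.

Lemma cvg_rad_left : rad n @[n --> \oo] --> (1 : R)^'-.
Proof.
move=> A hA; suff : \forall n \near \oo, A (rad n) by [].
have : \forall n \near \oo, rad n < 1 -> A (rad n) := cvg_rad hA.
by apply: filterS => n; apply; exact: rad_lt1.
Qed.

Lemma cvg_radial (f : Cplx R -> Cplx R) (xi l : Cplx R) :
  f (ofR r * xi) @[r --> (1 : R)^'-] --> l -> f (ofR (rad n) * xi) @[n --> \oo] --> l.
Proof. by move=> fl A /fl /cvg_rad_left. Qed.

Lemma cabs_rad n (xi : Cplx R) : cabs xi = 1 -> cabs (ofR (rad n) * xi) = rad n.
Proof. by move=> xi1; rewrite cabsM xi1 mulr1 cabs_ofR ger0_norm // ltW // rad_gt0. Qed.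

Lemma cabs_rad_lt1 n (xi : Cplx R) : cabs xi = 1 -> cabs (ofR (rad n) * xi) < 1.
Proof. by move=> /cabs_rad ->; exact: rad_lt1. Qed.

Lemma cvg_rad_mul (xi : Cplx R) : ofR (rad n) * xi @[n --> \oo] --> xi.
Proof.
rewrite -[X in _ --> X]mul1r -ofR1; apply: cvgM; last exact: cvg_cst.
exact: (cvg_continuous_comp (@ofR_continuous R 1) cvg_rad).
Qed.

Lemma sub_rad_mul n (xi : Cplx R) : xi - ofR (rad n) * xi = ofR (1 - rad n) * xi.
Proof. by rewrite (ofRD 1 (- rad n)) ofRN ofR1; ring. Qed.

Lemma cabs_sub_rad n (xi : Cplx R) : cabs xi = 1 -> cabs (xi - ofR (rad n) * xi) = 1 - rad n.
Proof.
move=> xi1; rewrite sub_rad_mul cabsM xi1 mulr1 cabs_ofR ger0_norm //.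
by rewrite subr_ge0; exact/ltW/rad_lt1.
Qed.

Lemma rad_stolz (b : R) n (p : Cplx R) : 1 < b -> cabs p = 1 ->
  stolz_angle b p (ofR (rad n) * p).
Proof.
move=> b1 p1; split; first by apply/unit_discE; exact: cabs_rad_lt1.
rewrite /= norm_cabs -/(ofR b) -ofR1 norm_cabs -ofRN -ofRD -ofRM /ofR ltcR.
rewrite cabsB cabs_sub_rad // cabs_rad //; have := rad_lt1 n => h.
by rewrite -[ltLHS]mul1r ltr_pM2r // subr_gt0.
Qed.

Lemma cvg_rad_stolz (b : R) (p : Cplx R) : 1 < b -> cabs p = 1 ->
  ofR (rad n) * p @[n --> \oo] --> within (stolz_angle b p) (nbhs p).
Proof.
move=> b1 p1 A hA; suff : \forall n \near \oo, A (ofR (rad n) * p) by [].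
have : \forall n \near \oo, stolz_angle b p (ofR (rad n) * p) ->
  A (ofR (rad n) * p) := cvg_rad_mul hA.
by apply: filterS => n; apply; exact: rad_stolz.
Qed.

End radial_sequence.

(** * Angular derivative and radial quotient *)

Section angular_derivative.
Context {R : realType}.
Variables (f : Cplx R -> Cplx R) (p eta : Cplx R).
Hypothesis f_self : analytic_self_map f.
Hypothesis p1 : cabs p = 1.
Hypothesis eta1 : cabs eta = 1.
Notation z_ n := (ofR (rad n) * p).
Hypothesis f_eta : f (z_ n) @[n --> \oo] --> eta.

Let f1 z : cabs z < 1 -> cabs (f z) < 1.
Proof. by move=> /unit_discE /f_self[_ /unit_discE]. Qed.

Definition radial_quotient n : R :=
  (1 - cabs (f (z_ n)) ^+ 2) / (1 - cabs (z_ n) ^+ 2).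

Let z2 n : 0 < 1 - cabs (z_ n) ^+ 2.
Proof. by apply: one_sub_sqr_gt0; rewrite ?cabs_ge0 // cabs_rad_lt1. Qed.

(** The hypothesis says that the lower limit of the quotient is finite. The conclusion upgrades this
    to a limit of the quotient and to an angular limit in every Stolz angle. *)
Lemma julia_caratheodory (M : R) :
  (forall N, exists2 n, (N <= n)%N & radial_quotient n <= M) ->
  exists2 c : R, 0 < c &
    (forall b : R, 0 < b -> (eta - f z) / (p - z)
       @[z --> within (stolz_angle b p) (nbhs p)] --> eta / (p * ofR c)) /\
    radial_quotient n @[n --> \oo] --> c^-1.
Proof.
move=> fr.
have fr' N : exists2 n, (N <= n)%N &
    1 - cabs (f (z_ n)) ^+ 2 <= M * (1 - cabs (z_ n) ^+ 2).
  by have [n Nn h] := fr N; exists n => //; rewrite -ler_pdivrMr.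
have J := julia_inequality f_self p1 eta1 (fun n => cabs_rad_lt1 n p1)
  (@cvg_rad_mul R p) f_eta fr'.
pose F z := cayley eta (f z).
have reF z : cabs z < 1 -> 0 < re (F z) by move=> z1; apply: re_cayley_gt0 => //; exact: f1.
have reZ z : cabs z < 1 -> 0 < re (cayley p z) by move=> z1; exact: re_cayley_gt0.
have lt01 : cabs (0 : Cplx R) < 1 by rewrite cabs0.
have M0 : 0 < M.
  have := lt_le_trans (reZ 0 lt01) (J 0 lt01).
  by rewrite pmulr_lgt0 //; exact: reF.
(* The infimum [c] of [S] is the best constant in [c * re (cayley p z) <= re (F z)]. Julia's
   inequality keeps it above [M^-1 > 0]; it turns out to be the reciprocal of the angular
   derivative's modulus. *)
pose S := [set re (F z) / re (cayley p z) | z in [set z | cabs z < 1]].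
have Slb : lbound S M^-1.
  move=> _ [z z1 <-]; rewrite ler_pdivlMr ?reZ // ler_pdivrMl //.
  exact: J.
have S0 : S !=set0 by exists (re (F 0) / re (cayley p 0)), 0.
have hS : has_inf S by split => //; exists M^-1.
pose c := inf S.
have cM : M^-1 <= c by apply: lb_le_inf.
have c0 : 0 < c by apply: lt_le_trans cM; rewrite invr_gt0.
have c_le z : cabs z < 1 -> c * re (cayley p z) <= re (F z).
  move=> z1; rewrite -ler_pdivlMr ?reZ //.
  by apply: ge_inf; [case: hS|exists z].
have c_inf (e : R) : 0 < e -> exists2 w, cabs w < 1 & re (F w) <= (c + e) * re (cayley p w).
  move=> e0; have [_ [w w1 <-] /ltW h] := inf_adherent e0 hS.
  by exists w => //; rewrite -ler_pdivrMr ?reZ.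
have Q b b0 := @angular_quotient_cvg R f p eta f_self p1 eta1 c c_le c_inf b b0 c0.
exists c => //; split => //.
have b2 : 1 < (2 : R) by rewrite ltr1n.
have q_cvg : (eta - f (z_ n)) / (p - z_ n) @[n --> \oo] --> eta / (p * ofR c).
  by move=> A /(Q 2 ltac:(by [])) /(cvg_rad_stolz b2 p1).
pose G z := F z - ofR c * cayley p z.
have G_cvg : (p - z_ n) * G (z_ n) @[n --> \oo] --> (0 : Cplx R).
  move=> A /(@residual_cvg R f p eta f_self p1 eta1 c c_le c_inf 2 ltac:(by [])).
  exact: (cvg_rad_stolz b2 p1).
have ratio_cvg : re (F (z_ n)) / re (cayley p (z_ n)) @[n --> \oo] --> c.
  apply/cvgrPdist_lt => e e0.
  have /(_ _ e e0) := (Cplx_cvgP (fun n => (p - z_ n) * G (z_ n)) 0).1 G_cvg.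
  apply: filterS => n; rewrite subr0; apply: le_lt_trans.
  have zn1 := @cabs_rad_lt1 R n p p1; have rZ := reZ _ zn1.
  have -> : c - re (F (z_ n)) / re (cayley p (z_ n)) =
     - (re (G (z_ n)) / re (cayley p (z_ n))).
    rewrite /G reD reN (reM (ofR c)) re_ofR im_ofR mul0r subr0.
    by move: (re _) (re _) rZ => x y y0; field; rewrite gt_eqF.
  rewrite normrN normrM normfV [X in _ / X]gtr0_norm //.
  rewrite ler_pdivrMr // cabsM cabs_sub_rad // mulrAC.
  have r1 := @rad_lt1 R n; have r0 := @rad_gt0 R n.
  (* On the radius this product is [1 + rad n], so dividing by [re (cayley p (z_ n))] costs at most
     a factor [|p - z_n|], which the residual estimate absorbs. *)
  have h : 1 <= (1 - rad n) * re (cayley p (z_ n)).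
    rewrite re_cayley // cabs_sub_rad // cabs_rad //.
    have -> : (1 - rad n) * ((1 - rad n ^+ 2) / (1 - rad n) ^+ 2) = 1 + rad n :> R.
      by field; rewrite subr_eq0 gt_eqF.
    lra.
  by apply: le_trans (re_le_cabs _) _; rewrite ler_peMl ?cabs_ge0.
(* By [re_cayley], [radial_quotient] is the squared modulus of the difference quotient times the
   ratio of the two real parts; the limits are [c^-2] and [c]. *)
have -> : c^-1 = cabs (eta / (p * ofR c)) ^+ 2 * c.
  rewrite cabsM cabsV cabsM eta1 p1 !mul1r cabs_ofR gtr0_norm //.
  by field; rewrite gt_eqF.
have := cvg_cabs2 q_cvg => q2.
have lim2 : cabs ((eta - f (z_ n)) / (p - z_ n)) ^+ 2 *
   (re (F (z_ n)) / re (cayley p (z_ n))) @[n --> \oo] --> cabs (eta / (p * ofR c)) ^+ 2 * c.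
  by apply: cvgM; [exact: q2|exact: ratio_cvg].
suff E : \forall n \near \oo, cabs ((eta - f (z_ n)) / (p - z_ n)) ^+ 2 *
   (re (F (z_ n)) / re (cayley p (z_ n))) = radial_quotient n.
  exact: (cvg_near_eq E lim2).
near=> n; have zn1 := @cabs_rad_lt1 R n p p1; have fn1 := f1 zn1.
rewrite /radial_quotient !re_cayley // cabsM cabsV.
have := cayley_neq0 p1 zn1; have := cayley_neq0 eta1 fn1.
rewrite -!cabs_gt0 => h1 h2; have := z2 n => h3.
by field; rewrite !gt_eqF.
Unshelve. all: by end_near. Qed.

(** Every Stolz angle contains the radial points. A finite limit of the quotient there forces
    [eta' - f] to tend to 0, so the [eta'] of the definition is the radial limit [eta]. *)
Lemma angular_quotient_unique (l : Cplx R) : is_angular_derivative f p l ->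
  (eta - f (z_ n)) / (p - z_ n) @[n --> \oo] --> l.
Proof.
move=> [eta' [b [_ b1 H]]].
have Hn : (eta' - f (z_ n)) / (p - z_ n) @[n --> \oo] --> l.
  by move=> A /H /(cvg_rad_stolz b1 p1).
suff <- : eta' = eta by [].
have zp : p - z_ n @[n --> \oo] --> p - p.
  by apply: cvgB; [exact: cvg_cst|exact: cvg_rad_mul].
have h0 : eta' - f (z_ n) @[n --> \oo] --> l * (p - p).
  have h : (eta' - f (z_ n)) / (p - z_ n) * (p - z_ n) @[n --> \oo] --> l * (p - p).
    by apply: cvgM; [exact: Hn|exact: zp].
  suff E : \forall n \near \oo, (eta' - f (z_ n)) / (p - z_ n) * (p - z_ n) = eta' - f (z_ n).
    exact: (cvg_near_eq E h).
  near=> n; rewrite divfK //; apply: cayley_neq0 => //; exact: cabs_rad_lt1.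
have h1 : eta' - f (z_ n) @[n --> \oo] --> eta' - eta.
  by apply: cvgB; [exact: cvg_cst|exact: f_eta].
apply/eqP; rewrite -subr_eq0 -(mulr0 l) -(subrr p); apply/eqP.
exact: (cvg_unique (@norm_hausdorff _ _) h1 h0).
Unshelve. all: by end_near. Qed.

(** A finite angular derivative bounds [radial_quotient], so [julia_caratheodory] applies, and
    uniqueness identifies the value picked by [get]. The last clause says that [f (z_ n)] tends to
    [eta] nontangentially. *)
Lemma finite_angular_derivative : (abs_angular_derivative f p < +oo)%E ->
  exists2 a : R, 0 < a & [/\ abs_angular_derivative f p = a%:E,
    radial_quotient n @[n --> \oo] --> a &
    exists2 K : R, 0 < K & \forall n \near \oo,
      cabs (eta - f (z_ n)) <= K * (1 - cabs (f (z_ n)))].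
Proof.
rewrite /abs_angular_derivative; case: asboolP => // ex _.
have := getPex ex; set l := get _ => /angular_quotient_unique ql.
have ql1 := cvg_continuous_comp (@cabs_continuous R l) ql.
have bnd n : radial_quotient n <= 2 * cabs ((eta - f (z_ n)) / (p - z_ n)).
  have zn1 := @cabs_rad_lt1 R n p p1; have fn1 := f1 zn1.
  rewrite /radial_quotient (cabsM (eta - _)) cabsV cabs_sub_rad // cabs_rad //.
  have r1 := @rad_lt1 R n; have r0 := @rad_gt0 R n; have f0 := cabs_ge0 (f (z_ n)).
  have h := cabs_sub_ge eta (f (z_ n)); rewrite eta1 in h.
  set a := cabs (f _) in f0 fn1 h *; set d := cabs (eta - _) in h *.
  have d0 : 0 <= d by exact: cabs_ge0.
  have -> : 1 - rad n ^+ 2 = (1 - rad n) * (1 + rad n) :> R by ring.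
  have -> : 1 - a ^+ 2 = (1 - a) * (1 + a) by ring.
  rewrite ler_pdivrMr; last by rewrite mulr_gt0 //; lra.
  have -> : 2 * (d / (1 - rad n)) * ((1 - rad n) * (1 + rad n)) = 2 * d * (1 + rad n).
    by field; rewrite subr_eq0 gt_eqF.
  have : (1 - a) * (1 + a) <= d * 2 by apply: ler_pM => //; lra.
  have := mulr_ge0 d0 (ltW r0); lra.
have fr N : exists2 n, (N <= n)%N & radial_quotient n <= 2 * (cabs l + 1).
  have /cvgrPdist_lt /(_ 1 ltr01) [N' _ HN'] := ql1.
  exists (maxn N N'); first exact: leq_maxl.
  have := HN' (maxn N N') (leq_maxr _ _); rewrite /= distrC => h.
  apply: le_trans (bnd _) _; move: h; rewrite ltr_norml => /andP[]; lra.
have [c c0 [Q Dc]] := julia_caratheodory fr.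
exists c^-1; first by rewrite invr_gt0.
have Qn : (eta - f (z_ n)) / (p - z_ n) @[n --> \oo] --> eta / (p * ofR c).
  have b2 : 1 < (2 : R) by rewrite ltr1n.
  by move=> A /(Q 2 ltac:(by [])) /(cvg_rad_stolz b2 p1).
have lE : l = eta / (p * ofR c) by exact: (cvg_unique (@norm_hausdorff _ _) ql Qn).
have lc : cabs l = c^-1.
  by rewrite lE cabsM cabsV cabsM eta1 p1 !mul1r cabs_ofR gtr0_norm.
split => //; first by rewrite -[X in X%:E]/(cabs l) lc.
have c2 : 0 < c^-1 / 2 by rewrite divr_gt0 ?invr_gt0.
have cV : 0 < c^-1 by rewrite invr_gt0.
(* Eventually [|eta - f| <= 2 c^-1 (1 - r)] and [1 - |f|^2 >= c^-1 / 2 * (1 - r)]: the ratio of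
   these constants is 4, and [1 - |f|^2 <= 2 (1 - |f|)] doubles it. *)
exists 8 => //; near=> n.
have zn1 := @cabs_rad_lt1 R n p p1; have fn1 := f1 zn1.
have r1 := @rad_lt1 R n; have r0 := @rad_gt0 R n; have f0 := cabs_ge0 (f (z_ n)).
have h1 : cabs (eta - f (z_ n)) <= 2 * c^-1 * (1 - rad n).
  rewrite -ler_pdivrMr ?subr_gt0 //.
  have -> : cabs (eta - f (z_ n)) / (1 - rad n) = cabs ((eta - f (z_ n)) / (p - z_ n)).
    by rewrite (cabsM (eta - _)) cabsV cabs_sub_rad.
  have : `|cabs l - cabs ((eta - f (z_ n)) / (p - z_ n))| < c^-1.
    by near: n; move/cvgrPdist_lt : ql1; apply.
  rewrite lc ltr_norml => /andP[]; lra.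
have h2 : c^-1 / 2 * (1 - rad n ^+ 2) <= 1 - cabs (f (z_ n)) ^+ 2.
  have r2 : 0 < 1 - rad n ^+ 2 :> R by apply: one_sub_sqr_gt0 => //; exact: ltW.
  have : `|c^-1 - radial_quotient n| < c^-1 / 2.
    by near: n; move/cvgrPdist_lt : Dc; apply.
  rewrite /radial_quotient cabs_rad // -ler_pdivlMr // ltr_norml => /andP[]; lra.
apply: (le_trans h1); set a := cabs _ in fn1 f0 h2 *.
have : (1 - a) * (1 + a) <= (1 - a) * 2 by apply: ler_pM => //; lra.
have : c^-1 / 2 * (1 - rad n) * 1 <= c^-1 / 2 * (1 - rad n) * (1 + rad n).
  by rewrite ler_wpM2l // ?mulr_ge0 //; lra.
have -> : c^-1 / 2 * (1 - rad n) * (1 + rad n) = c^-1 / 2 * (1 - rad n ^+ 2) by ring.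
move: h2; have -> : 1 - a ^+ 2 = (1 - a) * (1 + a) by ring.
set X := c^-1 / 2 * (1 - rad n ^+ 2); set Y := (1 - a) * (1 + a).
have -> : 2 * c^-1 * (1 - rad n) = 4 * (c^-1 / 2 * (1 - rad n)) by field; rewrite gt_eqF.
set W := c^-1 / 2 * (1 - rad n); lra.
Unshelve. all: by end_near. Qed.

Lemma infinite_angular_derivative (M : R) : abs_angular_derivative f p = +oo%E ->
  exists N, forall n, (N <= n)%N -> M <= radial_quotient n.
Proof.
rewrite /abs_angular_derivative; case: asboolP => // nex _.
apply: contrapT => H; apply: nex.
have fr N : exists2 n, (N <= n)%N & radial_quotient n <= M.
  apply: contrapT => H'; apply: H; exists N => n Nn.
  by rewrite leNgt; apply/negP => /ltW h; apply: H'; exists n.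
have [c c0 [Q _]] := julia_caratheodory fr.
exists (eta / (p * ofR c)), eta, 2; split; first exact/unit_circleE.
- by rewrite ltr1n.
- exact: Q.
Qed.

End angular_derivative.

(** * The circle measure *)

Section circle_measure_theory.
Context {R : realType}.
Notation leb := (@lebesgue_measure R).
Notation Leb := (@completed_lebesgue_measure R).
Notation circ := (@circle_param R).
Notation lam := (@circle_measure R).
Notation T := (circleType R).
Local Notation I01 := (`[0, 1[%classic : set R).

Lemma borel_lebesgue (A : set R) : @measurable _ (measurableTypeR R) A ->
  @measurable _ (lebesgueTypeR R) A.
Proof. by move=> mA; apply: sub_caratheodory. Qed.

Lemma completed_lebesgueE (A : set R) : Leb A = leb A.
Proof. by []. Qed.

Lemma circle_measurable_borel (E : set T) :
  @measurable _ (measurableTypeR R) (circ @^-1` E) -> measurable E.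
Proof.
move=> mE; rewrite circle_measurableE; apply: borel_lebesgue.
by apply: measurableI => //; exact: (@measurable_itv R `[0, 1[).
Qed.

Lemma circle_measurable_fun (g : Cplx R -> R) :
  measurable_fun (setT : set R) (g \o circ) -> measurable_fun (setT : set T) g.
Proof.
move=> mg _ B mB; rewrite setTI; apply: circle_measurable_borel.
by have := mg measurableT B mB; rewrite setTI.
Qed.

Lemma continuous_circle_measurable (g : Cplx R -> R) :
  continuous (g \o circ) -> measurable_fun (setT : set T) g.
Proof.
by move=> cg; apply: circle_measurable_fun; exact: continuous_measurable_fun.
Qed.

Lemma measurable_unit_circle : measurable (unit_circle : set T).
Proof.
apply: circle_measurable_borel; rewrite [X in measurable X](_ : _ = setT) //.
by apply/seteqP; split => // t _; apply/unit_circleE; exact: cabs_circ.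
Qed.

Lemma circle_measure_unit (E : set T) : lam E = lam (E `&` unit_circle).
Proof.
rewrite /circle_measure; congr (Leb _); apply/seteqP; split => t [t01 Et];
  split => //; last by case: Et.
by split => //; apply/unit_circleE; exact: cabs_circ.
Qed.

Lemma circle_measureT : lam setT = 1%E.
Proof.
rewrite /circle_measure preimage_setT setIT completed_lebesgueE.
have := @lebesgue_measure_itv R `[0, 1[; rewrite /= lte_fin ltr01 => ->.
by rewrite oppr0 adde0.
Qed.

Lemma circle_measure_offcircle : lam (~` unit_circle) = 0%E.
Proof. by rewrite circle_measure_unit setICl measure0. Qed.

Lemma circle_measure_fin_num : fin_num_fun lam.
Proof.
move=> E mE; rewrite ge0_fin_numE ?measure_ge0 //.
apply: (@le_lt_trans _ _ (lam setT)); first by apply: le_measure; rewrite ?inE.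
by rewrite circle_measureT ltry.
Qed.

HB.instance Definition _ := Measure_isFinite.Build _ _ _ lam circle_measure_fin_num.

Lemma integral_unit_circle (D : set T) (g : T -> \bar R) : measurable D ->
  measurable_fun D g -> (forall x, D x -> (0 <= g x)%E) ->
  (\int[lam]_(x in D) g x = \int[lam]_(x in D `&` unit_circle) g x)%E.
Proof.
move=> mD mg g0.
rewrite (@ge0_negligible_integral _ _ _ _ _ (~` (unit_circle : set T))) ?setDE ?setCK //.
- by apply: measurableC; exact: measurable_unit_circle.
- exact: circle_measure_offcircle.
Qed.

(* The junk value 0 lies off the circle, so that the preimage under phi of a subset
   of the circle stays inside [0, 1[. *)
Let phi (t : lebesgueTypeR R) : T := if t \in `[0, 1[ then circ t else (0 : Cplx R).

Let phi_pre (E : set T) : E `<=` unit_circle ->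
  phi @^-1` E = I01 `&` circ @^-1` E.
Proof.
move=> EU; apply/seteqP; split => t; rewrite /= /phi.
  case: ifPn => t01 // /EU /unit_circleE; rewrite cabs0 => /esym/eqP.
  by rewrite oner_eq0.
by move=> [t01 Et]; rewrite [t \in _]t01.
Qed.

Let measurable_phi : measurable_fun setT phi.
Proof.
move=> _ E mE; rewrite setTI.
have -> : phi @^-1` E = (I01 `&` circ @^-1` E) `|` (~` I01 `&` (fun=> E 0)).
  apply/seteqP; split => t; rewrite /= /phi.
    by case: ifPn => t01 Et; [left|right; split => //; apply/negP].
  by move=> [[t01 Et]|[/negP nt01 E0]]; [rewrite [t \in _]t01|rewrite ifN].
apply: measurableU; first by rewrite -circle_measurableE.
have [E0|nE0] := pselect (E 0).
  rewrite [X in _ `&` X](_ : _ = setT) ?setIT; last by apply/seteqP; split.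
  by apply: measurableC; apply: borel_lebesgue; exact: (@measurable_itv R `[0, 1[).
by rewrite [X in _ `&` X](_ : _ = set0) ?setI0; last by apply/seteqP; split.
Qed.

Let measurable_id : @measurable_fun _ _ (lebesgueTypeR R) (measurableTypeR R) setT idfun.
Proof. by move=> _ E mE; rewrite setTI; apply: borel_lebesgue. Qed.

(** On subsets of the circle [circle_measure] is the pushforward of [Leb] by [phi], so a change of
    variables applies once the integral is restricted to the circle. *)
Lemma integral_circle_param (g : Cplx R -> R) : (forall x, 0 <= g x) ->
  continuous (g \o circ) ->
  (\int[lam]_x (g x)%:E)%E = (\int[leb]_(t in `[0, 1]) g (circ t))%:E.
Proof.
move=> g0 cg.
have mg : measurable_fun (setT : set T) (EFin \o g).
  by apply/measurable_EFinP; exact: continuous_circle_measurable.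
have mU := measurable_unit_circle.
rewrite (integral_unit_circle measurableT mg); last by move=> x _; rewrite lee_fin.
rewrite setTI.
rewrite (@eq_measure_integral _ _ _ _ (pushforward Leb phi)); last first.
  move=> A mA AU.
  by rewrite /= /pushforward phi_pre.
rewrite (ge0_integral_pushforward measurable_phi) //; last 2 first.
- exact: measurable_funS mg.
- by move=> x _; rewrite /= lee_fin.
rewrite (phi_pre (@subset_refl _ _)).
have -> : I01 `&` circ @^-1` unit_circle = I01.
  by apply/seteqP; split => [t []//|t t01]; split => //; apply/unit_circleE/cabs_circ.
(* A second pushforward, by the identity from the completed to the Borel sigma-algebra, replaces
   [Leb] by [leb]. *)
transitivity (\int[Leb]_(t in idfun @^-1` I01) ((EFin \o (g \o circ)) \o idfun) t)%E.
  by apply: eq_integral => t; rewrite inE => t01; rewrite /= /phi [t \in _]t01.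
have mgc : measurable_fun (setT : set R) (EFin \o (g \o circ)).
  by apply/measurable_EFinP; exact: continuous_measurable_fun.
rewrite -(@ge0_integral_pushforward _ _ _ _ _ _ measurable_id Leb I01); last 3 first.
- exact: (@measurable_itv R `[0, 1[).
- exact: measurable_funS mgc.
- by move=> x _; rewrite /= lee_fin.
rewrite (@eq_measure_integral _ _ _ _ leb) //.
have mgI : measurable_fun (`[0, 1[%classic : set R) (EFin \o (g \o circ)).
  exact: measurable_funS mgc.
rewrite (integral_itv_bndo_bndc mgI) /Rintegral fineK //.
have /integrableP[_ fi] := integrable01 cg.
rewrite ge0_fin_numE; last by apply: integral_ge0 => t _; rewrite lee_fin.
apply: le_lt_trans fi; apply: ge0_le_integral.
- exact: measurable_itv.
- by move=> t _; rewrite lee_fin.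
- exact: measurable_funS mgc.
- by apply: measurableT_comp => //; exact: measurable_funS mgc.
- by move=> t _; rewrite lee_fin ler_norm.
Qed.

End circle_measure_theory.

(** * Harmonic measure *)

Section poisson_kernel.
Context {R : realType}.
Notation circ := (@circle_param R).
Notation lam := (@circle_measure R).
Notation T := (circleType R).
Implicit Types (z w x tau : Cplx R) (f : Cplx R -> Cplx R) (r : R).

(* The absolute value only serves to make the kernel nonnegative outside the disc. *)
Definition poisson_kernel z x : R := `|1 - cabs z ^+ 2| / cabs (x - z) ^+ 2.

Lemma poisson_kernel_ge0 z x : 0 <= poisson_kernel z x.
Proof. by rewrite divr_ge0 ?sqr_ge0. Qed.

Lemma poisson_kernelE z x : cabs z < 1 ->
  poisson_kernel z x = (1 - cabs z ^+ 2) / cabs (x - z) ^+ 2.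
Proof. by move=> z1; rewrite /poisson_kernel gtr0_norm // one_sub_sqr_gt0 ?cabs_ge0. Qed.

Lemma poisson_kernel_gt0 z x : cabs z < 1 -> cabs x = 1 -> 0 < poisson_kernel z x.
Proof.
move=> z1 x1; rewrite poisson_kernelE // divr_gt0 ?one_sub_sqr_gt0 ?cabs_ge0 //.
by rewrite exprn_gt0 // cabs_gt0 cayley_neq0.
Qed.

Lemma poisson_kernel_cayley z x : cabs z < 1 -> cabs x = 1 ->
  poisson_kernel z x = re (cayley x z).
Proof. by move=> z1 x1; rewrite poisson_kernelE // re_cayley. Qed.

Lemma poisson_kernel_continuous z : cabs z < 1 ->
  continuous (poisson_kernel z \o circ).
Proof.
move=> z1 t; apply: cvgM; first exact: cvg_cst.
apply: cvgV; first by rewrite expf_neq0 // cabs_eq0 circ_sub_neq0.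
apply: cvg_cabs2; apply: cvgB; [exact: circ_continuous|exact: cvg_cst].
Qed.

Lemma poisson_kernel_measurable z : cabs z < 1 ->
  measurable_fun (setT : set T) (poisson_kernel z).
Proof. by move=> z1; apply: continuous_circle_measurable; exact: poisson_kernel_continuous. Qed.

Lemma poisson_integral (G : Cplx R -> Cplx R) rho (g : Cplx R -> R) z :
  1 < rho -> holomorphic_disc rho G -> cabs z < 1 ->
  (forall x, 0 <= g x) -> (forall t, g (circ t) = re (G (circ t))) ->
  (\int[lam]_x (g x * poisson_kernel z x)%:E = (re (G z))%:E)%E.
Proof.
move=> rho1 dG z1 g0 gG.
rewrite (@integral_circle_param R (fun x => g x * poisson_kernel z x)); last 2 first.
- by move=> x; rewrite mulr_ge0 ?poisson_kernel_ge0.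
- move=> t; apply: cvgM; last exact: poisson_kernel_continuous.
  rewrite (_ : (fun t => g (circ t)) = (fun t => re (G (circ t)))); last exact/funext.
  rewrite gG; exact: (cvg_continuous_comp (@re_continuous R _)
    (@derivable_circ_continuous R rho G rho1 dG t)).
rewrite -(poisson_formula rho1 dG z1); congr EFin; apply: eq_Rintegral => t _.
by rewrite gG poisson_kernelE.
Qed.

Lemma poisson_kernel_integral z : cabs z < 1 ->
  (\int[lam]_x (poisson_kernel z x)%:E = 1)%E.
Proof.
move=> z1.
have d1 : holomorphic_disc 2 (fun=> 1 : Cplx R) by move=> w _; exact: cderivable_cst.
have h2 : 1 < (2 : R) by rewrite ltr1n.
have := @poisson_integral (fun=> 1) 2 (fun=> 1) z h2 d1 z1 (fun=> ler01) (fun=> erefl).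
by rewrite re1 => <-; apply: eq_integral => x _; rewrite mul1r.
Qed.

(** In its first argument the kernel is the real part of [cayley tau]; composed with [f (r x)] it is
    the real part of a function holomorphic beyond the closed disc, which the Poisson formula
    reproduces. *)
Lemma poisson_kernel_comp f r tau z : analytic_self_map f -> 0 < r < 1 ->
  cabs tau = 1 -> cabs z < 1 ->
  (\int[lam]_x (poisson_kernel (f (ofR r * x)) tau * poisson_kernel z x)%:E =
   (poisson_kernel (f (ofR r * z)) tau)%:E)%E.
Proof.
move=> fs /andP[r0 r1] tau1 z1.
have small x : cabs x < r^-1 -> cabs (ofR r * x) < 1.
  by move=> xr; rewrite cabsM cabs_ofR gtr0_norm // mulrC -ltr_pdivlMr // div1r.
have f1 x : cabs x < 1 -> cabs (f x) < 1 by move=> /unit_discE /fs[_ /unit_discE].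
have rV : 1 < r^-1 by rewrite -[1]invr1 ltf_pV2 ?posrE.
rewrite (@poisson_integral (fun x => cayley tau (f (ofR r * x))) r^-1) //.
- rewrite -poisson_kernel_cayley //; apply: f1; apply: small.
  exact: lt_trans rV.
- move=> x xr; apply: (@cderivable_comp _ (fun x => f (ofR r * x)) (cayley tau)).
    apply: (@cderivable_comp _ (fun x => ofR r * x) f).
      by apply: cderivableM; [exact: cderivable_cst|exact: cderivable_id].
    by have [] := fs (ofR r * x) ((unit_discE _).2 (small x xr)).
  by apply: cayley_derivable => //; apply: f1; exact: small.
- by move=> x; exact: poisson_kernel_ge0.
- by move=> t; rewrite poisson_kernel_cayley //; apply/f1/small; rewrite cabs_circ.
Qed.

Definition harmonic_measure w (C : set T) : \bar R :=
  (\int[lam]_(tau in C) (poisson_kernel w tau)%:E)%E.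

Lemma harmonic_measure_ge0 w C : (0 <= harmonic_measure w C)%E.
Proof. by apply: integral_ge0 => x _; rewrite lee_fin poisson_kernel_ge0. Qed.

Lemma measurable_inv_ge0 d (X : measurableType d) (D : set X) (g : X -> R) :
  (forall a, 0 <= g a) -> measurable_fun D g -> measurable_fun D (fun a => (g a)^-1).
Proof.
move=> g0 mg; rewrite (_ : (fun _ => _) = (fun a => g a `^ (-1))); last first.
  by apply/funext => a; rewrite powR_inv1.
exact: (measurableT_comp (measurable_powR (-1)) mg).
Qed.

Lemma re_comp_continuous (h : R -> Cplx R) : continuous h -> continuous (fun t => re (h t)).
Proof. by move=> ch t; exact: (cvg_continuous_comp (@re_continuous R (h t)) (ch t)). Qed.
Lemma im_comp_continuous (h : R -> Cplx R) : continuous h -> continuous (fun t => im (h t)).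
Proof. by move=> ch t; exact: (cvg_continuous_comp (@im_continuous R (h t)) (ch t)). Qed.

Lemma re_circ_measurable : measurable_fun (setT : set T) (@re R).
Proof.
by apply: continuous_circle_measurable; apply: re_comp_continuous; exact: circ_continuous.
Qed.
Lemma im_circ_measurable : measurable_fun (setT : set T) (@im R).
Proof.
by apply: continuous_circle_measurable; apply: im_comp_continuous; exact: circ_continuous.
Qed.

Lemma dilation_circ_continuous f r : analytic_self_map f -> 0 < r < 1 ->
  continuous (fun t => f (ofR r * circ t)).
Proof.
move=> fs /andP[r0 r1] t.
have c1 : {for ofR r * circ t, continuous f}.
  apply: derivable_continuous; have [] // := fs (ofR r * circ t).
  by apply/unit_discE; rewrite cabsM cabs_circ mulr1 cabs_ofR gtr0_norm.
apply: (cvg_continuous_comp c1).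
by apply: cvgM; [exact: cvg_cst|exact: circ_continuous].
Qed.

(** Real and imaginary parts write the squared distance in the denominator as a polynomial in
    functions of one variable each, so measurability on the circle suffices. *)
Lemma joint_kernel_measurable f r z : analytic_self_map f -> 0 < r < 1 -> cabs z < 1 ->
  measurable_fun (setT : set (T * T))
    (fun xt => poisson_kernel (f (ofR r * xt.1)) xt.2 * poisson_kernel z xt.1).
Proof.
move=> fs r01 z1; have cf := dilation_circ_continuous fs r01.
have m1 (g : T -> R) : measurable_fun setT g ->
    measurable_fun setT (fun xt : T * T => g xt.1).
  by move=> mg; exact: (measurableT_comp mg measurable_fst).
have m2 (g : T -> R) : measurable_fun setT g ->
    measurable_fun setT (fun xt : T * T => g xt.2).
  by move=> mg; exact: (measurableT_comp mg measurable_snd).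
have msq (g : T * T -> R) : measurable_fun setT g -> measurable_fun setT (fun xt => g xt ^+ 2).
  by move=> mg; exact: measurable_funX.
apply: measurable_funM; last exact: (m1 _ (poisson_kernel_measurable z1)).
apply: measurable_funM.
  apply: (m1 (fun x : T => `|1 - cabs (f (ofR r * x)) ^+ 2|)).
  apply: continuous_circle_measurable => t.
  apply: cvg_norm; apply: cvgB; first exact: cvg_cst.
  by apply: cvg_cabs2; exact: cf.
apply: (@measurable_inv_ge0 _ _ _ (fun xt : T * T => cabs ((xt.2 : Cplx R) - f (ofR r * xt.1)) ^+ 2)).
  by move=> xt; exact: sqr_ge0.
rewrite (_ : (fun _ => _) = (fun xt : T * T =>
   (re xt.2 - re (f (ofR r * xt.1))) ^+ 2 + (im xt.2 - im (f (ofR r * xt.1))) ^+ 2)); last first.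
  by apply/funext => xt; rewrite cabs_sqr reD imD reN imN.
apply: measurable_funD; apply: msq; apply: measurable_funB.
- exact: (m2 _ re_circ_measurable).
- apply: (m1 (fun x : T => re (f (ofR r * x)))); apply: continuous_circle_measurable.
  exact: (re_comp_continuous cf).
- exact: (m2 _ im_circ_measurable).
- apply: (m1 (fun x : T => im (f (ofR r * x)))); apply: continuous_circle_measurable.
  exact: (im_comp_continuous cf).
Qed.

Definition joint_kernel f r z (C : set T) (xt : T * T) : R := \1_C xt.2 *
  (poisson_kernel (f (ofR r * xt.1)) xt.2 * poisson_kernel z xt.1).

Let joint_kernel_ge0 f r z C xt : (0 <= (joint_kernel f r z C xt)%:E)%E.
Proof. rewrite lee_fin mulr_ge0 // mulr_ge0 //; exact: poisson_kernel_ge0. Qed.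

Let measurable_joint_kernel f r z (C : set T) : analytic_self_map f -> 0 < r < 1 ->
  cabs z < 1 -> measurable C ->
  measurable_fun setT (EFin \o joint_kernel f r z C).
Proof.
move=> fs r01 z1 mC.
apply/measurable_EFinP; apply: measurable_funM; last exact: joint_kernel_measurable.
have mi : measurable_fun (setT : set T) (\1_C : T -> R) by exact: measurable_indic.
exact: (measurableT_comp mi measurable_snd).
Qed.

Let integral_indicM (C : set T) (g : T -> R) :
  (\int[lam]_tau (\1_C tau * g tau)%R%:E = \int[lam]_(tau in C) (g tau)%:E)%E.
Proof.
rewrite [RHS]integral_mkcond; apply: eq_integral => tau _.
by rewrite patchE indicE; case: ifP => _; rewrite ?mul1r ?mul0r.
Qed.

Let integral_joint_kernel f r z (C : set T) : measurable C ->
  fubini_F lam (EFin \o joint_kernel f r z C) =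
  (fun x => harmonic_measure (f (ofR r * x)%R) C * (poisson_kernel z x)%:E)%E.
Proof.
move=> mC; apply/funext => x; rewrite /fubini_F.
rewrite (integral_indicM C (fun y => poisson_kernel (f (ofR r * x)) y * poisson_kernel z x)).
rewrite /harmonic_measure muleC -ge0_integralZl_EFin ?poisson_kernel_ge0 //.
- by apply: eq_integral => y _; rewrite mulrC EFinM.
- by move=> y _; rewrite lee_fin poisson_kernel_ge0.
- apply/measurable_EFinP; apply: (@measurable_funS _ _ _ _ setT) => //.
  apply: measurable_funM; first exact: measurable_cst.
  apply: measurable_inv_ge0; first by move=> y; exact: sqr_ge0.
  apply: continuous_circle_measurable => t; apply: cvg_cabs2.
  by apply: cvgB; [exact: circ_continuous|exact: cvg_cst].
Qed.

Lemma harmonic_measure_measurable f r z (C : set T) : analytic_self_map f -> 0 < r < 1 ->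
  cabs z < 1 -> measurable C -> measurable_fun (setT : set T)
    (fun x => harmonic_measure (f (ofR r * x)%R) C * (poisson_kernel z x)%:E)%E.
Proof.
move=> fs r01 z1 mC; rewrite -integral_joint_kernel //.
apply: measurable_fun_fubini_tonelli_F; first exact: measurable_joint_kernel.
by move=> xt; exact: joint_kernel_ge0.
Qed.

(** Tonelli's theorem exchanges the integrals over [x] and [tau]; for each [tau] in [C] the inner
    one is [poisson_kernel_comp]. *)
Lemma harmonic_measure_comp f r z (C : set T) : analytic_self_map f -> 0 < r < 1 ->
  cabs z < 1 -> measurable C -> C `<=` unit_circle ->
  (\int[lam]_x (harmonic_measure (f (ofR r * x)%R) C * (poisson_kernel z x)%:E) =
   harmonic_measure (f (ofR r * z)%R) C)%E.
Proof.
move=> fs r01 z1 mC CU.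
have := @fubini_tonelli _ _ T T R lam lam _ (measurable_joint_kernel fs r01 z1 mC)
  (joint_kernel_ge0 f r z C).
rewrite -(integral_joint_kernel f r z mC) => ->.
transitivity (\int[lam]_y (\1_C y * poisson_kernel (f (ofR r * z)) y)%R%:E)%E; last exact: integral_indicM.
apply: eq_integral => y _.
rewrite /joint_kernel /= indicE; case: (boolP (y \in C)) => yC /=; last first.
  under eq_integral do rewrite mul0r.
  by rewrite integral0 mul0r.
under eq_integral do rewrite mul1r.
rewrite mul1r poisson_kernel_comp //.
by apply/unit_circleE/CU; rewrite inE in yC.
Qed.

End poisson_kernel.

(** * Regularity and limits of harmonic measure *)

Section harmonic_measure_theory.
Context {R : realType}.
Notation leb := (@lebesgue_measure R).
Notation Leb := (@completed_lebesgue_measure R).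
Notation circ := (@circle_param R).
Notation lam := (@circle_measure R).
Notation T := (circleType R).
Local Notation I01 := (`[0, 1[%classic : set R).
Local Notation U := (unit_circle : set T).
Implicit Types (z w x tau : Cplx R) (f : Cplx R -> Cplx R) (C E : set T).

Lemma circle_negligible_measurable (N E : set T) : measurable N -> lam N = 0%E ->
  E `<=` N -> measurable E /\ lam E = 0%E.
Proof.
move=> mN N0 EN.
suff mE : measurable E.
  split => //; apply/eqP; rewrite eq_le measure_ge0 andbT -N0.
  by apply: le_measure; rewrite ?inE.
rewrite circle_measurableE; apply: (@completed_lebesgue_measure_is_complete R).
exists (I01 `&` circ @^-1` N); split => //; first by rewrite -circle_measurableE.
by move=> t [t01 Et]; split => //; exact: EN.
Qed.

(** Up to a null set, the parameter set of [E] is a Borel set [A], approximated from inside by a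
    compact [K]. The image of [K] under the continuous [circ] is compact, hence closed in the
    plane. *)
Lemma circle_inner_regularity E (e : R) : measurable E -> 0 < e ->
  exists C : set T, [/\ measurable C, closed (C : set (Cplx R)), C `<=` E `&` U &
    (lam (E `\` C) < e%:E)%E].
Proof.
move=> mE e0.
have : (@wlength R idfun)^*%mu.-cara.-measurable (I01 `&` circ @^-1` E).
  by move: mE; rewrite circle_measurableE.
rewrite -completed_caratheodory_measurable g_sigma_completed_algebra_genE.
move=> [/= A mA [N [/= N' [mN' N'0 NN']] ANE]].
have AS : A `<=` I01 `&` circ @^-1` E by rewrite -ANE; exact: subsetUl.
have lI : leb I01 = 1%E.
  have := @lebesgue_measure_itv R `[0, 1[; rewrite /= lte_fin ltr01 => ->.
  by rewrite oppr0 adde0.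
have Afin : (leb A < +oo)%E.
  apply: (@le_lt_trans _ _ (leb I01)); last by rewrite lI ltry.
  apply: le_measure; [by rewrite inE| |by move=> t /AS []].
  by rewrite inE; exact: (@measurable_itv R `[0, 1[).
have [K [cK KA Ke]] := lebesgue_regularity_inner mA Afin e0.
have cC : closed (circ @` K : set (Cplx R)).
  apply: compact_closed; first exact: norm_hausdorff.
  apply: continuous_compact => //; apply: continuous_subspaceT => t.
  exact: circ_continuous.
have mC : measurable (circ @` K : set T).
  apply: circle_measurable_borel; apply: closed_measurable.
  by apply: closed_comp cC => t _; exact: circ_continuous.
exists (circ @` K : set T); split => //.
  move=> _ [t Kt <-]; have [t01 Et] := AS _ (KA _ Kt); split => //.
  exact/unit_circleE/cabs_circ.
rewrite /circle_measure.
have mK : @measurable _ (measurableTypeR R) K by exact: compact_measurable.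
have mAK : @measurable _ (measurableTypeR R) ((A `\` K) `|` N').
  by apply: measurableU => //; exact: measurableD.
apply: (@le_lt_trans _ _ (Leb ((A `\` K) `|` N'))).
  apply: le_measure; rewrite ?inE.
  - by rewrite -circle_measurableE; exact: measurableD.
  - exact: borel_lebesgue.
  move=> t [t01 [Et nCt]]; have : (A `|` N) t by rewrite ANE.
  move=> [At|/NN' N't]; [by left; split => // Kt; apply: nCt; exists t|by right].
rewrite completed_lebesgueE; apply: le_lt_trans Ke.
apply: (@le_trans _ _ (leb (A `\` K) + leb N')%E); last by rewrite N'0 adde0.
by apply: measureU2 => //; exact: measurableD.
Qed.

Lemma harmonic_measureT w : cabs w < 1 -> harmonic_measure w U = 1%E.
Proof.
move=> w1; rewrite -(poisson_kernel_integral w1) [RHS]integral_unit_circle ?setTI //.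
- by apply/measurable_EFinP; exact: poisson_kernel_measurable.
- by move=> x _; rewrite lee_fin poisson_kernel_ge0.
Qed.

Let mpk w D : cabs w < 1 -> measurable_fun (D : set T) (EFin \o poisson_kernel w).
Proof.
move=> w1; apply: (@measurable_funS _ _ _ _ setT) => //.
by apply/measurable_EFinP; exact: poisson_kernel_measurable.
Qed.

Let pk_ge0 w x : (0 <= (poisson_kernel w x)%:E)%E.
Proof. by rewrite lee_fin poisson_kernel_ge0. Qed.

Lemma harmonic_measureU w C E : cabs w < 1 -> measurable C -> measurable E ->
  [disjoint C & E] -> harmonic_measure w (C `|` E) =
  (harmonic_measure w C + harmonic_measure w E)%E.
Proof.
by move=> w1 mC mE CE; rewrite /harmonic_measure ge0_integral_setU //; exact: mpk.
Qed.

Lemma le_harmonic_measure w C E : cabs w < 1 -> measurable C -> measurable E ->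
  C `<=` E -> (harmonic_measure w C <= harmonic_measure w E)%E.
Proof.
by move=> w1 mC mE CE; apply: ge0_subset_integral => //; exact: mpk.
Qed.

Lemma harmonic_measure_setC w C : cabs w < 1 -> measurable C -> C `<=` U ->
  (harmonic_measure w C + harmonic_measure w (U `\` C) = 1)%E.
Proof.
move=> w1 mC CU; have mU := @measurable_unit_circle R.
rewrite -harmonic_measureU // ?harmonic_measureT //.
- by rewrite setDUK // harmonic_measureT.
- exact: measurableD.
- by apply/disj_setPS => x [Cx [_ nCx]].
Qed.

Lemma harmonic_measure_fin_num w C : cabs w < 1 -> measurable C -> C `<=` U ->
  harmonic_measure w C \is a fin_num.
Proof.
move=> w1 mC CU; rewrite ge0_fin_numE ?harmonic_measure_ge0 //.
apply: (@le_lt_trans _ _ 1%E); last by rewrite ltry.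
rewrite -(harmonic_measureT w1); apply: le_harmonic_measure => //.
exact: measurable_unit_circle.
Qed.

Lemma harmonic_measure_le w C (M : R) : cabs w < 1 -> measurable C -> 0 <= M ->
  (forall tau, C tau -> poisson_kernel w tau <= M) ->
  (harmonic_measure w C <= M%:E * lam C)%E.
Proof.
move=> w1 mC M0 H; rewrite -integral_cst //; apply: ge0_le_integral => //.
exact: mpk.
Qed.

Lemma harmonic_measure_cvg (w : nat -> Cplx R) w0 C :
  (forall n, cabs (w n) < 1) -> cabs w0 < 1 -> w n @[n --> \oo] --> w0 ->
  measurable C -> C `<=` U ->
  harmonic_measure (w n) C @[n --> \oo] --> harmonic_measure w0 C.
Proof.
move=> w1 w01 ww0 mC CU.
(* Midway between [cabs w0] and 1: eventually [cabs (w n) < rho], and the kernels are at most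
   [(1 - rho) ^- 2]. The shift by [N] makes this domination hold for every index. *)
pose rho := (1 + cabs w0) / 2.
have rho1 : rho < 1 by rewrite /rho; lra.
have [N _ HN] : \forall n \near \oo, cabs (w n) < rho.
  have e0 : 0 < rho - cabs w0 by rewrite /rho; lra.
  have /cvgrPdist_lt /(_ _ e0) := cvg_continuous_comp (@cabs_continuous R w0) ww0.
  by apply: filterS => n; rewrite ltr_norml => /andP[]; lra.
rewrite -(cvg_shiftn N); apply: (@dominated_cvg _ _ _ lam C mC
  (fun n tau => (poisson_kernel (w (n + N)%N) tau)%:E) _
  (cst ((1 - rho) ^- 2)%:E)).
- by move=> n; exact: mpk.
- move=> tau /CU /unit_circleE tau1; apply: cvg_EFin; first by near=> n.
  have wN : w (n + N)%N @[n --> \oo] --> w0 by rewrite (cvg_shiftn N).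
  apply: cvgM.
    by apply: cvg_norm; apply: cvgB; [exact: cvg_cst|exact: cvg_cabs2].
  apply: cvgV; first by rewrite expf_neq0 // cabs_eq0 cayley_neq0.
  by apply: cvg_cabs2; apply: cvgB; [exact: cvg_cst|].
- by move=> tau _.
- exact: finite_measure_integrable_cst.
- move=> n tau /CU /unit_circleE tau1; rewrite abse_EFin lee_fin ger0_norm ?poisson_kernel_ge0 //.
  have wr : cabs (w (n + N)%N) < rho by apply: HN; rewrite /= leq_addl.
  rewrite poisson_kernelE // -[leRHS]mul1r; apply: ler_pM.
  + by rewrite ltW // one_sub_sqr_gt0 ?cabs_ge0.
  + by rewrite invr_ge0 sqr_ge0.
  + by rewrite lerBlDr lerDl sqr_ge0.
  + have h : 1 - rho <= cabs (tau - w (n + N)%N).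
      by apply: le_trans (cabs_sub_ge _ _); rewrite tau1 lerD2l lerN2 ltW.
    have r0 : 0 < 1 - rho by rewrite subr_gt0.
    have t0 := lt_le_trans r0 h.
    by rewrite lef_pV2 ?posrE ?exprn_gt0 // ler_pXn2r // nnegrE ltW.
Unshelve. all: by end_near. Qed.

(** Once [|w n - w0| < d / 2], points of [C] are at distance at least [d / 2] from [w n], so the
    kernel on [C] is at most [4 / d^2 * (1 - |w n|^2)], which tends to 0. *)
Lemma harmonic_measure_boundary_cvg (w : nat -> Cplx R) w0 C (d : R) :
  (forall n, cabs (w n) < 1) -> cabs w0 = 1 -> w n @[n --> \oo] --> w0 ->
  measurable C -> C `<=` U -> 0 < d -> (forall tau, C tau -> d <= cabs (tau - w0)) ->
  harmonic_measure (w n) (U `\` C) @[n --> \oo] --> 1%E.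
Proof.
move=> w1 w01 ww0 mC CU d0 dC.
have fO n : harmonic_measure (w n) (U `\` C) \is a fin_num.
  apply: harmonic_measure_fin_num; [exact: w1| |by move=> ? []].
  by apply: measurableD => //; exact: measurable_unit_circle.
have fC n : harmonic_measure (w n) C \is a fin_num by exact: harmonic_measure_fin_num.
have OE n : fine (harmonic_measure (w n) (U `\` C)) = 1 - fine (harmonic_measure (w n) C).
  have := congr1 fine (harmonic_measure_setC (w1 n) mC CU).
  by rewrite fineD //= => h; lra.
have lim0 : 4 / d ^+ 2 * (1 - cabs (w n) ^+ 2) @[n --> \oo] --> (0 : R).
  rewrite (_ : (0 : R) = 4 / d ^+ 2 * (1 - cabs w0 ^+ 2)); last first.
    by rewrite w01 expr1n subrr mulr0.
  apply: cvgM; first exact: cvg_cst.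
  by apply: cvgB; [exact: cvg_cst|exact: cvg_cabs2].
have d2 : 0 < d / 2 by rewrite divr_gt0.
have bound : \forall n \near \oo,
    `|fine (harmonic_measure (w n) C)| <= 4 / d ^+ 2 * (1 - cabs (w n) ^+ 2).
  have near_w : \forall n \near \oo, cabs (w n - w0) < d / 2.
    exact: (Cplx_cvgP (F := \oo) w w0).1 ww0 _ d2.
  apply: filterS near_w => n wn; have wn1 := one_sub_sqr_gt0 (cabs_ge0 _) (w1 n).
  have M0 : 0 <= 4 / d ^+ 2 * (1 - cabs (w n) ^+ 2).
    by rewrite mulr_ge0 ?(ltW wn1) // divr_ge0 ?sqr_ge0.
  rewrite ger0_norm ?fine_ge0 ?harmonic_measure_ge0 //.
  rewrite -lee_fin fineK //.
  apply: le_trans (harmonic_measure_le (w1 n) mC M0 _) _.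
    move=> tau Ct; rewrite poisson_kernelE // mulrC ler_wpM2r ?(ltW wn1) //.
    have h : d / 2 <= cabs (tau - w n).
      by have := cabs_tri (w n) tau w0; have := dC _ Ct; lra.
    have -> : 4 / d ^+ 2 = ((d / 2) ^+ 2)^-1 by field; rewrite gt_eqF.
    rewrite lef_pV2 ?posrE ?exprn_gt0 //; last exact: lt_le_trans h.
    by rewrite ler_pXn2r // nnegrE ?cabs_ge0 // ltW.
  rewrite -[leRHS]mule1; apply: lee_wpmul2l; first by rewrite lee_fin.
  by rewrite -(@circle_measureT R); apply: le_measure; rewrite ?inE.
have limC : fine (harmonic_measure (w n) C) @[n --> \oo] --> (0 : R).
  apply/cvgrPdist_lt => e e0.
  have /cvgrPdist_lt /(_ e e0) lim0' := lim0.
  near=> n; rewrite sub0r normrN.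
  have b1 : `|fine (harmonic_measure (w n) C)| <= 4 / d ^+ 2 * (1 - cabs (w n) ^+ 2).
    by near: n.
  have b2 : `|0 - 4 / d ^+ 2 * (1 - cabs (w n) ^+ 2)| < e by near: n.
  apply: (le_lt_trans b1); move: b2; rewrite sub0r normrN; exact: le_lt_trans (ler_norm _).
have limO : fine (harmonic_measure (w n) (U `\` C)) @[n --> \oo] --> (1 : R).
  rewrite (_ : (fun n => _) = (fun n => 1 - fine (harmonic_measure (w n) C))); last exact/funext.
  by rewrite -[X in _ --> X]subr0; apply: cvgB => //; exact: cvg_cst.
by apply: cvg_EFin; [exact: nearW|exact: limO].
Unshelve. all: by end_near. Qed.

End harmonic_measure_theory.

(** * Invariance of harmonic measure under inner functions *)

Section inner_invariance.
Context {R : realType}.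
Notation lam := (@circle_measure R).
Notation T := (circleType R).
Local Notation U := (unit_circle : set T).
Implicit Types (z w x tau : Cplx R) (f : Cplx R -> Cplx R) (C E : set T).

Lemma measurable_fun_limn_einf d (X : measurableType d) (D : set X)
    (u : nat -> X -> \bar R) : (forall n, measurable_fun D (u n)) ->
  measurable_fun D (fun a => limn_einf (u ^~ a)).
Proof.
move=> mu; rewrite (_ : (fun _ => _) = (fun a => - limn_esup (fun n => - u n a))%E) //.
apply: measurableT_comp => //.
by apply: measurable_fun_limn_esup => n; exact: measurableT_comp.
Qed.

Lemma poisson_kernel_le w tau : cabs w < 1 -> cabs tau = 1 ->
  poisson_kernel w tau <= (1 - cabs w) ^- 2.
Proof.
move=> w1 tau1; rewrite poisson_kernelE // -[leRHS]mul1r; apply: ler_pM.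
- by rewrite ltW // one_sub_sqr_gt0 ?cabs_ge0.
- by rewrite invr_ge0 sqr_ge0.
- by rewrite lerBlDr lerDl sqr_ge0.
have h : 1 - cabs w <= cabs (tau - w) by rewrite -tau1; exact: cabs_sub_ge.
have r0 : 0 < 1 - cabs w by rewrite subr_gt0.
have t0 := lt_le_trans r0 h.
by rewrite lef_pV2 ?posrE ?exprn_gt0 // ler_pXn2r // nnegrE ltW.
Qed.

Let pk_ge0 w x : (0 <= (poisson_kernel w x)%:E)%E.
Proof. by rewrite lee_fin poisson_kernel_ge0. Qed.

Let mpk w D : cabs w < 1 -> measurable_fun (D : set T) (EFin \o poisson_kernel w).
Proof.
move=> w1; apply: (@measurable_funS _ _ _ _ setT) => //.
by apply/measurable_EFinP; exact: poisson_kernel_measurable.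
Qed.

Lemma analytic_self_map_rad f n xi : analytic_self_map f -> cabs xi <= 1 ->
  cabs (f (ofR (rad n) * xi)) < 1.
Proof.
move=> fs xi1; have r0 := @rad_gt0 R n; have r1 := @rad_lt1 R n.
suff : cabs (ofR (rad n) * xi) < 1 by move=> /unit_discE /fs[_ /unit_discE].
rewrite cabsM cabs_ofR gtr0_norm //; apply: le_lt_trans r1.
by rewrite ler_piMr // ltW.
Qed.

(** Let [L] be the lower limit of the integrands of [harmonic_measure_comp] for the complement of
    [C]. At a good point whose radial limit misses [C] it equals the Poisson kernel, so the good
    points where [L] is below the kernel form a measurable set inside the preimage. On the set [B]
    where [L] dominates the kernel, Fatou's lemma bounds harmonic measure by that of the complement
    of [C] seen from [f z]. *)
Lemma harmonic_measure_closed_le f z C : inner f -> cabs z < 1 ->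
  measurable C -> closed (C : set (Cplx R)) -> C `<=` U ->
  exists A : set T, [/\ measurable A, A `<=` boundary_preimage f C &
    (harmonic_measure (f z) C <= harmonic_measure z A)%E].
Proof.
move=> [fs [N [mN N0 Nsub]]] z1 mC cC CU.
have mU := @measurable_unit_circle R.
have mO : measurable (U `\` C) by exact: measurableD.
have OU : U `\` C `<=` U by exact: subDsetl.
have fz1 : cabs (f z) < 1 by move/unit_discE : z1 => /fs[_ /unit_discE].
have r01 n : (0 : R) < (rad n : R) < 1 by rewrite rad_gt0 rad_lt1.
pose v n (x : T) := (harmonic_measure (f (ofR (rad n) * x)%R) (U `\` C) * (poisson_kernel z x)%:E)%E.
have v0 n (x : T) : setT x -> (0 <= v n x)%E.
  by move=> _; rewrite mule_ge0 // harmonic_measure_ge0.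
have mv n : measurable_fun (setT : set T) (v n).
  exact: (harmonic_measure_measurable fs (r01 n) z1 mO).
pose L (x : T) := limn_einf (v ^~ x).
have mL : measurable_fun (setT : set T) L by exact: measurable_fun_limn_einf.
have L0 x : (0 <= L x)%E.
  rewrite /L limn_einf_lim; apply: lime_ge; first exact: is_cvg_einfs.
  by apply: nearW => n; apply: le_ereal_inf_tmp => _ [m _ <-]; exact: v0.
have fatou_L : (\int[lam]_x L x <= harmonic_measure (f z) (U `\` C))%E.
  have F1 := @fatou _ _ R lam setT measurableT _ mv v0.
  apply: (le_trans F1).
  have E1 : (fun n => \int[lam]_x v n x)%E =
      (fun n => harmonic_measure (f (ofR (rad n) * z)%R) (U `\` C)).
    by apply/funext => n; rewrite /v harmonic_measure_comp.
  rewrite E1.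
  have cz : {for z, continuous f} by apply: derivable_continuous; have [] := fs z ((unit_discE _).2 z1).
  have H := @harmonic_measure_cvg R (fun n => f (ofR (rad n) * z)) (f z) _
    (fun n => analytic_self_map_rad n fs (ltW z1)) fz1
    (cvg_continuous_comp cz (@cvg_rad_mul R z)) mO OU.
  by rewrite (cvg_limn_einf_sup H).1.
pose B := [set x | ((poisson_kernel z x)%:E <= L x)%E] : set T.
have mB : measurable B.
  have := @measurable_lee _ T R setT measurableT _ _ (@mpk z setT z1) mL.
  by rewrite setTI.
exists ((U `\` N) `\` B); split.
- by apply: measurableD => //; exact: measurableD.
- move=> x [[Ux nNx] nBx].
  have good := contrapT (fun h => nNx (Nsub x h)).
  have [lx x1] := good Ux.
  split => //; apply: contrapT => nCx; apply: nBx.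
  have [d d0 dC] : exists2 d : R, 0 < d & forall tau, C tau -> d <= cabs (tau - radial_limit f x).
    have oC : nbhs (radial_limit f x) (~` (C : set (Cplx R))).
      by apply: open_nbhs_nbhs; split => //; exact: closed_openC.
    have /Cplx_nbhsP[d d0 dH] := oC; exists d => // tau Ct.
    by rewrite leNgt; apply/negP => /dH; apply.
  have x1' : cabs x = 1 by apply/unit_circleE.
  have l1 : cabs (radial_limit f x) = 1 by apply/unit_circleE.
  have fl : f (ofR r * x) @[r --> (1 : R)^'-] --> radial_limit f x := lx.
  have wn := cvg_radial fl.
  have wn1 n : cabs (f (ofR (rad n) * x)) < 1.
    by apply: analytic_self_map_rad => //; rewrite x1'.
  have H := harmonic_measure_boundary_cvg wn1 l1 wn mC CU d0 dC.
  have vL : v n x @[n --> \oo] --> (1 * (poisson_kernel z x)%:E)%E.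
    apply: cvgeM; [by rewrite mule_def_fin|exact: H|exact: cvg_cst].
  by rewrite /B /= /L (cvg_limn_einf_sup vL).1 mul1e.
have mUN : measurable (U `\` N) by exact: measurableD.
have hUN : (harmonic_measure z (U `\` N) = 1)%E.
  by rewrite -(harmonic_measureT z1) /harmonic_measure [RHS](ge0_negligible_integral mN) //; exact: mpk.
have hB : (harmonic_measure z ((U `\` N) `&` B) <= harmonic_measure (f z) (U `\` C))%E.
  apply: le_trans fatou_L; apply: (@le_trans _ _ (\int[lam]_(x in (U `\` N) `&` B) L x)%E).
    apply: ge0_le_integral => //.
    - exact: measurableI.
    - exact: mpk.
    - exact: measurable_funS mL.
    - by move=> x [].
  apply: ge0_subset_integral => //; exact: measurableI.
have := harmonic_measure_setC fz1 mC CU.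
have -> : (1 = harmonic_measure z ((U `\` N) `\` B) + harmonic_measure z ((U `\` N) `&` B))%E.
  rewrite -hUN -harmonic_measureU //.
  - by rewrite setDE setUC -setIUr setUv setIT.
  - exact: measurableD.
  - exact: measurableI.
  - by apply/disj_setPS => x [[_ nB] [_ Bx]].
move=> E.
have fO : harmonic_measure (f z) (U `\` C) \is a fin_num.
  by apply: harmonic_measure_fin_num.
rewrite -(leeD2rE _ _ fO) E; exact: leeD2l.
Qed.

(** Closed subsets of [E] give the inequality up to errors [(1 - |f z|)^-2 / (n + 1)]; the union of
    the corresponding sets [A n] gives it without error. *)
Lemma harmonic_measure_inner_le f z E : inner f -> cabs z < 1 ->
  measurable E -> E `<=` U ->
  exists A : set T, [/\ measurable A, A `<=` boundary_preimage f E &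
    (harmonic_measure (f z) E <= harmonic_measure z A)%E].
Proof.
move=> fi z1 mE EU.
have fz1 : cabs (f z) < 1.
  by case: fi => fs _; move/unit_discE : z1 => /fs[_ /unit_discE].
have step (n : nat) : exists A : set T, [/\ measurable A, A `<=` boundary_preimage f E &
    (harmonic_measure (f z) E <= harmonic_measure z A + ((1 - cabs (f z)) ^- 2 * n.+1%:R^-1)%:E)%E].
  have n0 : 0 < n.+1%:R^-1 :> R by rewrite invr_gt0.
  have [C [mC cC CE Ce]] := circle_inner_regularity mE n0.
  have CE' : C `<=` E by move=> x /CE[].
  have CU : C `<=` U by move=> x /CE[].
  have [A [mA AC hA]] := harmonic_measure_closed_le fi z1 mC cC CU.
  exists A; split => //; first by move=> x /AC[? ? ?]; split => //; exact: CE'.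
  have mEC : measurable (E `\` C) by exact: measurableD.
  rewrite -(setDUK CE') harmonic_measureU //; last first.
    by apply/disj_setPS => x [Cx [_ nCx]].
  apply: leeD => //; rewrite EFinM.
  have M0 : 0 <= (1 - cabs (f z)) ^- 2 by rewrite invr_ge0 sqr_ge0.
  apply: le_trans (harmonic_measure_le fz1 mEC M0 _) _.
    by move=> tau [/EU /unit_circleE tau1 _]; exact: poisson_kernel_le.
  by apply: lee_wpmul2l; [rewrite lee_fin|exact: ltW].
have [A HA] := choice step.
have mUA : measurable (\bigcup_n A n) by apply: bigcupT_measurable => n; have [] := HA n.
exists (\bigcup_n A n); split => //; first by move=> x [n _ Anx]; have [_ + _] := HA n; apply.
apply/lee_addgt0Pr => e e0.
pose M := (1 - cabs (f z)) ^- 2.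
have M0 : 0 < M by rewrite invr_gt0 exprn_gt0 // subr_gt0.
have [n hn] : exists n : nat, n.+1%:R^-1 < e / M.
  have [n _ /(_ n (leqnn n)) hn] := near_infty_natSinv_lt (PosNum (divr_gt0 e0 M0)).
  by exists n.
have [mA _ hA] := HA n; apply: (le_trans hA); apply: leeD.
  by apply: le_harmonic_measure => // x Ax; exists n.
by rewrite lee_fin -/M mulrC -ler_pdivlMr // ltW.
Qed.

(** The sets [A] and [A'] obtained for [E] and its complement are disjoint, and their harmonic
    measures add up to at least 1. So both inequalities are equalities and the rest of the circle is
    null; the preimage of [E] differs from [A] by a subset of that rest, measurable by
    completeness. *)
Lemma inner_preimage_invariance f z E : inner f -> cabs z < 1 ->
  measurable E -> E `<=` U ->
  measurable (boundary_preimage f E : set T) /\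
  harmonic_measure z (boundary_preimage f E) = harmonic_measure (f z) E.
Proof.
move=> fi z1 mE EU; have mU := @measurable_unit_circle R.
have fz1 : cabs (f z) < 1.
  by case: fi => fs _; move/unit_discE : z1 => /fs[_ /unit_discE].
have mE' : measurable (U `\` E) by exact: measurableD.
have E'U : U `\` E `<=` U by exact: subDsetl.
have [A [mA AE hA]] := harmonic_measure_inner_le fi z1 mE EU.
have [A' [mA' AE' hA']] := harmonic_measure_inner_le fi z1 mE' E'U.
have AU : A `<=` U by move=> x /AE[].
have A'U : A' `<=` U by move=> x /AE'[].
have dAA' x : boundary_preimage f E x -> A' x -> False.
  by move=> [_ _ Ex] /AE'[_ _ []].
have mAA : measurable (A `|` A') by exact: measurableU.
have AAU : A `|` A' `<=` U by move=> x [/AU|/A'U].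
have sumA : harmonic_measure z (A `|` A') = (harmonic_measure z A + harmonic_measure z A')%E.
  by apply: harmonic_measureU => //; apply/disj_setPS => x [/AE Ex /(dAA' _ Ex)].
have sum1 := harmonic_measure_setC fz1 mE EU.
have sum2 := harmonic_measure_setC z1 mAA AAU.
have finE : harmonic_measure (f z) E \is a fin_num by exact: harmonic_measure_fin_num.
have finE' : harmonic_measure (f z) (U `\` E) \is a fin_num by exact: harmonic_measure_fin_num.
have finA : harmonic_measure z A \is a fin_num by exact: harmonic_measure_fin_num.
have finA' : harmonic_measure z A' \is a fin_num by exact: harmonic_measure_fin_num.
have mN : measurable (U `\` (A `|` A')) by exact: measurableD.
have NU : U `\` (A `|` A') `<=` U by exact: subDsetl.
have finN : harmonic_measure z (U `\` (A `|` A')) \is a fin_num by exact: harmonic_measure_fin_num.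
have [eqA N0] : harmonic_measure z A = harmonic_measure (f z) E /\
    harmonic_measure z (U `\` (A `|` A')) = 0%E.
  move: hA hA' sum1 sum2; rewrite sumA.
  rewrite -(fineK finE) -(fineK finE') -(fineK finA) -(fineK finA') -(fineK finN).
  have : 0 <= fine (harmonic_measure z (U `\` (A `|` A'))) by rewrite fine_ge0 ?harmonic_measure_ge0.
  rewrite -!EFinD !lee_fin => k0 k1 k2 [k3] [k4].
  by split; congr (_%:E); lra.
(* The Poisson kernel is strictly positive on the circle, so zero harmonic measure means zero
   length. *)
have lamN : lam (U `\` (A `|` A')) = 0%E.
  have : (\int[lam]_(x in U `\` (A `|` A')) `|(poisson_kernel z x)%:E| = 0)%E.
    by rewrite -[RHS]N0; apply: eq_integral => x _; rewrite gee0_abs.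
  move=> /(ae_eq_integral_abs _ mN (@mpk z _ z1)) [M [mM M0 NM]].
  apply/eqP; rewrite eq_le measure_ge0 andbT -M0; apply: le_measure; rewrite ?inE //.
  move=> x Nx; apply: NM => /= /(_ Nx) [k].
  by have := poisson_kernel_gt0 z1 ((unit_circleE x).1 (NU x Nx)); rewrite k ltxx.
have [mS S0] : measurable (boundary_preimage f E `\` A : set T) /\
    lam (boundary_preimage f E `\` A : set T) = 0%E.
  apply: (circle_negligible_measurable mN lamN) => x [fx nAx].
  by split; [case: fx|move=> [//|/(dAA' _ fx)]].
have SE : boundary_preimage f E = A `|` (boundary_preimage f E `\` A) by rewrite setDUK.
have mf : measurable (boundary_preimage f E : set T) by rewrite SE; exact: measurableU.
split => //; rewrite -eqA SE harmonic_measureU //; last first.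
  by apply/disj_setPS => x [Ax [_ nAx]].
have SU : boundary_preimage f E `\` A `<=` U by move=> x [[]].
have M0 : 0 <= (1 - cabs z) ^- 2 by rewrite invr_ge0 sqr_ge0.
have hS := harmonic_measure_le z1 mS M0 (fun tau Ht => poisson_kernel_le z1 ((unit_circleE tau).1 (SU tau Ht))).
rewrite (_ : harmonic_measure z (_ `\` _) = 0%E) ?adde0 //.
by apply/eqP; rewrite eq_le harmonic_measure_ge0 andbT (le_trans hS) // S0 mule0.
Qed.

End inner_invariance.

(** * Passage to the boundary *)

Lemma cvg_shift (V : topologicalType) N (u : nat -> V) (l : V) :
  u n @[n --> \oo] --> l -> u (n + N)%N @[n --> \oo] --> l.
Proof. by move=> ul; exact: (cvg_comp (addn^~ N) u (cvg_addnr N) ul). Qed.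

Section mu_limits.
Context {R : realType}.
Notation lam := (@circle_measure R).
Notation T := (circleType R).
Local Notation U := (unit_circle : set T).
Implicit Types (z w x p : Cplx R) (E : set T).

Lemma circle_cabs_sub_measurable w :
  measurable_fun (setT : set T) (fun x : T => cabs ((x : Cplx R) - w)).
Proof.
apply: continuous_circle_measurable => t.
apply: (cvg_continuous_comp (@cabs_continuous R (circle_param t - w))).
by apply: cvgB; [exact: circ_continuous|exact: cvg_cst].
Qed.

Lemma circle_measurable1 p : measurable ([set p] : set T).
Proof.
have -> : [set p] = setT `&` (fun x : T => cabs ((x : Cplx R) - p)) @^-1` [set 0].
  rewrite setTI; apply/seteqP; split => x /=; first by move=> ->; rewrite subrr cabs0.
  by move/eqP; rewrite cabs_eq0 subr_eq0 => /eqP.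
by apply: circle_cabs_sub_measurable => //; exact: measurable_set1.
Qed.

Lemma mu_density_measurable w E :
  measurable_fun E (fun x : T => ((Normc.normc ((x : Cplx R) - w) ^+ 2)^-1)%:E).
Proof.
apply: (@measurable_funS _ _ _ _ setT) => //; apply/measurable_EFinP.
apply: (@measurable_inv_ge0 _ _ _ _ (fun x : T => cabs ((x : Cplx R) - w) ^+ 2)).
  by move=> x; exact: sqr_ge0.
by apply: measurable_funX; exact: circle_cabs_sub_measurable.
Qed.

Let density_ge0 w x : (0 <= ((Normc.normc (x - w) ^+ 2)^-1)%:E)%E.
Proof. by rewrite lee_fin invr_ge0 sqr_ge0. Qed.

Lemma mu_ge0 w E : (0 <= mu w E)%E.
Proof. by apply: integral_ge0 => x _; exact: density_ge0. Qed.

Lemma harmonic_measure_mu w E : cabs w < 1 -> measurable E ->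
  harmonic_measure w E = ((1 - cabs w ^+ 2)%:E * mu w E)%E.
Proof.
move=> w1 mE; rewrite /mu -ge0_integralZl_EFin //.
- by apply: eq_integral => x _; rewrite poisson_kernelE // EFinM.
- exact: mu_density_measurable.
- by rewrite ltW // one_sub_sqr_gt0 ?cabs_ge0.
Qed.

(** Seen from [r p], the point has harmonic measure [(1 + r) / (1 - r) * lam [set p]], which is at
    most 1 for [r] arbitrarily near 1. *)
Lemma circle_measure1 p : cabs p = 1 -> lam [set p] = 0%E.
Proof.
move=> p1; apply/eqP; rewrite eq_le measure_ge0 andbT.
have mp := circle_measurable1 p.
apply/lee_addgt0Pr => e e0; rewrite add0e.
have [n _ /(_ n (leqnn n)) hn] := near_infty_natSinv_lt (PosNum e0).
have z1 := @cabs_rad_lt1 R n p p1; have r0 := @rad_gt0 R n; have r1 := @rad_lt1 R n.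
have : (harmonic_measure (ofR (rad n) * p) [set p] <= 1)%E.
  rewrite -(harmonic_measureT z1); apply: le_harmonic_measure => //.
    exact: measurable_unit_circle.
  by move=> _ ->; apply/unit_circleE.
have -> : harmonic_measure (ofR (rad n) * p) [set p] =
    (((1 + rad n) / (1 - rad n))%:E * lam [set p])%E.
  rewrite -integral_cst //; apply: eq_integral => x; rewrite inE => ->.
  rewrite /= poisson_kernelE // cabs_sub_rad // cabs_rad //; congr EFin.
  by field; rewrite subr_eq0 gt_eqF.
have fp : lam [set p] \is a fin_num by exact: circle_measure_fin_num.
rewrite -(fineK fp) -EFinM !lee_fin => h.
have l0 : 0 <= fine (lam [set p]) by rewrite fine_ge0 ?measure_ge0.
have h1 : (1 + rad n) * fine (lam [set p]) <= 1 - rad n.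
  by rewrite -[leRHS]mul1r -ler_pdivrMr ?subr_gt0 // mulrAC.
have h2 : fine (lam [set p]) <= (1 + rad n) * fine (lam [set p]).
  by rewrite ler_peMl // lerDl ltW.
apply: (le_trans h2); apply: (le_trans h1); apply: le_trans (ltW hn).
by rewrite /rad opprB addrC subrK lef_pV2 ?posrE // ler_nat.
Qed.

(** Discards the vertex, where the density of [mu p] has the default value 0 and comparing densities
    breaks down. *)
Lemma mu_setD1 w p E : cabs p = 1 -> measurable E -> mu w E = mu w (E `\` [set p]).
Proof.
move=> p1 mE; apply: ge0_negligible_integral => //.
- exact: circle_measurable1.
- exact: mu_density_measurable.
- exact: circle_measure1.
Qed.

Lemma mu_null w E : measurable E -> lam E = 0%E -> mu w E = 0%E.
Proof.
move=> mE E0; rewrite /mu (ge0_negligible_integral mE mE) ?setDv ?integral_set0 //.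
exact: mu_density_measurable.
Qed.

(** The closed disc has diameter 2, so the density is at least 1/4 where [x] differs from [w]. The
    last hypothesis accommodates both [w] in the open disc and [w = p]. *)
Lemma mu_ge_quarter w p E : cabs w <= 1 -> cabs p = 1 -> measurable E -> E `<=` U ->
  (forall x, E x -> x <> p -> x != w) -> ((4^-1)%:E * lam E <= mu w E)%E.
Proof.
move=> w1 p1 mE EU Ew; have mp := circle_measurable1 p.
have mEp : measurable (E `\` [set p]) by exact: measurableD.
have -> : lam E = lam (E `\` [set p]).
  have h : lam (E `&` [set p]) = 0%E.
    apply/eqP; rewrite eq_le measure_ge0 andbT -(circle_measure1 p1).
    by apply: le_measure; rewrite ?inE //; exact: measurableI.
  by rewrite -[RHS]adde0 -h; exact: measureDI.
rewrite (mu_setD1 w p1 mE) -integral_cst //; apply: ge0_le_integral => //.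
- by move=> x _; rewrite lee_fin.
- exact: mu_density_measurable.
- move=> x [Ex xp]; rewrite lee_fin.
  have x1 : cabs x = 1 by apply/unit_circleE/EU.
  have d0 : 0 < cabs (x - w) by rewrite cabs_gt0 subr_eq0 Ew.
  have d2 : cabs (x - w) <= 2 by apply: le_trans (cabsD _ _) _; rewrite cabsN x1; lra.
  rewrite lef_pV2 ?posrE ?exprn_gt0 //.
  have -> : (4 : R) = 2 ^+ 2 by ring.
  by rewrite ler_pXn2r // nnegrE ltW.
Qed.

(** Since [1 - |w| <= |x - w|], the distance from [w] to [p] is at most [K |x - w|]; this gives the
    domination by the density at the vertex. *)
Lemma cabs_sub_stolz (K : R) w p x : cabs x = 1 -> cabs (p - w) <= K * (1 - cabs w) ->
  0 <= K -> cabs (x - p) <= (1 + K) * cabs (x - w).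
Proof.
move=> x1 pw K0; have h1 := cabs_tri w x p; have h2 := cabs_sub_ge x w.
rewrite cabsB in pw; rewrite x1 in h2.
by have := ler_wpM2l K0 h2; rewrite mulrDl mul1r; lra.
Qed.

Lemma mu_density_le (K : R) w p x : cabs x = 1 -> cabs w < 1 -> x != p ->
  cabs (p - w) <= K * (1 - cabs w) -> 0 <= K ->
  (Normc.normc (x - w) ^+ 2)^-1 <= (1 + K) ^+ 2 * (Normc.normc (x - p) ^+ 2)^-1.
Proof.
move=> x1 w1 xp pw K0; rewrite -!/(cabs _).
have h := cabs_sub_stolz x1 pw K0.
have d0 : 0 < cabs (x - p) by rewrite cabs_gt0 subr_eq0.
have w0 : 0 < cabs (x - w) by rewrite cabs_gt0 cayley_neq0.
rewrite ler_pdivlMr ?exprn_gt0 // mulrC ler_pdivrMr ?exprn_gt0 // -exprMn.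
by rewrite ler_pXn2r // nnegrE ?mulr_ge0 ?cabs_ge0 //; lra.
Qed.

Lemma mu_le (K : R) w p E : cabs w < 1 -> cabs p = 1 -> measurable E -> E `<=` U ->
  0 <= K -> cabs (p - w) <= K * (1 - cabs w) ->
  (mu w E <= ((1 + K) ^+ 2)%:E * mu p E)%E.
Proof.
move=> w1 p1 mE EU K0 pw; have mp := circle_measurable1 p.
have mEp : measurable (E `\` [set p]) by exact: measurableD.
rewrite (mu_setD1 w p1 mE) (mu_setD1 p p1 mE) /mu -ge0_integralZl_EFin ?sqr_ge0 //; last first.
  exact: mu_density_measurable.
apply: ge0_le_integral => //.
- exact: mu_density_measurable.
- by apply: measurable_funeM; exact: mu_density_measurable.
- move=> x [Ex xp]; rewrite -EFinM lee_fin; apply: mu_density_le => //.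
    exact/unit_circleE/EU.
  exact/eqP.
Qed.

Let density_cvg (w : nat -> Cplx R) p x : w n @[n --> \oo] --> p -> x != p ->
  ((Normc.normc (x - w n) ^+ 2)^-1)%:E @[n --> \oo] --> ((Normc.normc (x - p) ^+ 2)^-1)%:E.
Proof.
move=> wp xp; apply: cvg_EFin; first exact: nearW.
apply: cvgV; first by rewrite expf_neq0 // -/(cabs _) cabs_eq0 subr_eq0.
by apply: cvg_cabs2; apply: cvgB; [exact: cvg_cst|].
Qed.

Lemma mu_fatou (w : nat -> Cplx R) p E (b : \bar R) : cabs p = 1 -> w n @[n --> \oo] --> p ->
  measurable E -> (forall n, mu (w n) E <= b)%E -> (mu p E <= b)%E.
Proof.
move=> p1 wp mE wb; have mp := circle_measurable1 p.
have mEp : measurable (E `\` [set p]) by exact: measurableD.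
rewrite (mu_setD1 p p1 mE).
have := @fatou _ _ R lam _ mEp (fun n x => ((Normc.normc ((x : Cplx R) - w n) ^+ 2)^-1)%:E)
  (fun n => @mu_density_measurable (w n) _) (fun n x _ => density_ge0 (w n) x).
have -> : (\int[lam]_(x in E `\` [set p])
    limn_einf (fun n => ((Normc.normc ((x : Cplx R) - w n) ^+ 2)^-1)%:E))%E = mu p (E `\` [set p]).
  apply: eq_integral => x; rewrite inE => -[_ /eqP xp].
  by rewrite (cvg_limn_einf_sup (density_cvg wp xp)).1.
move/le_trans; apply; rewrite limn_einf_lim; apply: lime_le; first exact: is_cvg_einfs.
apply: nearW => n; apply: le_trans (wb n); rewrite (mu_setD1 (w n) p1 mE).
by apply: ereal_inf_lbound; exists n => /=.
Qed.

Lemma mu_cvg (K : R) (w : nat -> Cplx R) p E : cabs p = 1 -> w n @[n --> \oo] --> p ->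
  measurable E -> E `<=` U -> 0 <= K -> (forall n, cabs (w n) < 1) ->
  (forall n, cabs (p - w n) <= K * (1 - cabs (w n))) -> (mu p E < +oo)%E ->
  mu (w n) E @[n --> \oo] --> mu p E.
Proof.
move=> p1 wp mE EU K0 w1 wK fin; have mp := circle_measurable1 p.
have mEp : measurable (E `\` [set p]) by exact: measurableD.
rewrite (mu_setD1 p p1 mE) in fin *.
rewrite (_ : (fun n => _) = (fun n => mu (w n) (E `\` [set p]))); last first.
  by apply/funext => n; rewrite -mu_setD1.
apply: (@dominated_cvg _ _ _ lam _ mEp
  (fun n x => ((Normc.normc ((x : Cplx R) - w n) ^+ 2)^-1)%:E) _
  (fun x => (((1 + K) ^+ 2)%:E * ((Normc.normc ((x : Cplx R) - p) ^+ 2)^-1)%:E)%E)).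
- by move=> n; exact: mu_density_measurable.
- by move=> x [_ /eqP xp]; exact: density_cvg.
- by move=> x _; rewrite -EFinM.
- apply: integrableZl => //; apply/integrableP; split; first exact: mu_density_measurable.
  apply: le_lt_trans fin; rewrite le_eqVlt; apply/orP; left; apply/eqP.
  by apply: eq_integral => x _; rewrite gee0_abs.
- move=> n x [Ex /eqP xp]; rewrite gee0_abs // -EFinM lee_fin; apply: mu_density_le => //.
  exact/unit_circleE/EU.
Qed.

End mu_limits.

(** * The identity at a boundary Fatou point *)

Section fatou_point.
Context {R : realType}.
Notation lam := (@circle_measure R).
Notation T := (circleType R).
Variables (f : Cplx R -> Cplx R) (p : Cplx R).
Hypothesis f_inner : inner f.
Hypothesis p_fatou : boundary_Fatou_point f p.
Variable E : set T.
Hypothesis mE : measurable E.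
Hypothesis EU : E `<=` unit_circle.

Let eta := radial_limit f p.
Let S : set T := boundary_preimage f E.
Let z n := ofR (rad n) * p.
Let w n := f (z n).

Let f_self : analytic_self_map f. Proof. by case: f_inner. Qed.
Let p1 : cabs p = 1. Proof. by case: p_fatou => /unit_circleE. Qed.
Let eta1 : cabs eta = 1. Proof. by case: p_fatou => _ _ /unit_circleE. Qed.
Let z1 n : cabs (z n) < 1. Proof. exact: cabs_rad_lt1. Qed.
Let w1 n : cabs (w n) < 1.
Proof. by have /unit_discE /f_self[_ /unit_discE] := z1 n. Qed.
Let w_eta : w n @[n --> \oo] --> eta.
Proof. by case: p_fatou => _ pl _; exact: cvg_radial. Qed.
Let z_p : z n @[n --> \oo] --> p. Proof. exact: cvg_rad_mul. Qed.
Let SU : S `<=` unit_circle. Proof. by move=> x []. Qed.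
Let z_stolz n : cabs (p - z n) <= 1 * (1 - cabs (z n)).
Proof. by rewrite mul1r /z cabs_sub_rad // cabs_rad. Qed.

Lemma measurable_boundary_preimage : measurable S.
Proof. by have [] := inner_preimage_invariance f_inner (z1 0) mE EU. Qed.
Let mS := measurable_boundary_preimage.

Let mu_radial n : mu (z n) S = ((radial_quotient f p n)%:E * mu (w n) E)%E.
Proof.
have [_] := inner_preimage_invariance f_inner (z1 n) mE EU.
rewrite (harmonic_measure_mu (z1 n) mS) (harmonic_measure_mu (w1 n) mE) => H.
have z2 : 0 < 1 - cabs (z n) ^+ 2 by apply: one_sub_sqr_gt0; rewrite ?cabs_ge0.
rewrite /radial_quotient -/(z n) -/(w n) mulrC EFinM -muleA -H muleA -EFinM.
by rewrite mulVf ?gt_eqF // mul1e.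
Qed.

Let muz_le n : (mu (z n) S <= 4%:E * mu p S)%E.
Proof.
have := mu_le (z1 n) p1 mS SU ler01 (z_stolz n).
by rewrite (_ : (1 + 1) ^+ 2 = 4 :> R) //; ring.
Qed.

(** If [mu eta E] is infinite, finiteness of [mu p S] would bound all [mu (w' n) E], hence
    [mu eta E] by Fatou's lemma. If it is finite, Fatou's lemma makes [mu p S] finite too, and both
    sides of [mu_radial] converge by domination. *)
Lemma mu_preimage_finite : (abs_angular_derivative f p < +oo)%E ->
  mu p S = (abs_angular_derivative f p * mu eta E)%E.
Proof.
move=> /(finite_angular_derivative f_self p1 eta1 w_eta)[a a0 [-> Da [K K0 [N1 _ HK]]]].
have a2 : 0 < a / 2 by rewrite divr_gt0.
have /cvgrPdist_lt /(_ _ a2) [N2 _ HD] := Da.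
(* Dropping [N] terms turns the eventual bounds into bounds for every index, the form that
   [mu_fatou] and [mu_cvg] take. *)
pose N := maxn N1 N2; pose z' n := z (n + N); pose w' n := w (n + N).
have w'K n : cabs (eta - w' n) <= K * (1 - cabs (w' n)).
  by apply: HK; rewrite /= (leq_trans (leq_maxl N1 N2)) // leq_addl.
have D' n : a / 2 <= radial_quotient f p (n + N) <= 2 * a.
  have := HD (n + N)%N; rewrite /= (leq_trans (leq_maxr N1 N2)) ?leq_addl // => /(_ isT).
  by rewrite ltr_norml => /andP[? ?]; apply/andP; split; lra.
have z'p : z' n @[n --> \oo] --> p by exact: (@cvg_shift _ N z p z_p).
have w'eta : w' n @[n --> \oo] --> eta by exact: (@cvg_shift _ N w eta w_eta).
have D'a : radial_quotient f p (n + N) @[n --> \oo] --> a by exact: (@cvg_shift _ N (radial_quotient f p) a Da).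
have muE0 := mu_ge0 eta E; have muS0 := mu_ge0 p S.
have [Einf|] := eqVneq (mu eta E) +oo%E.
  rewrite Einf gt0_muley ?lte_fin //; apply: contrapT => /eqP; rewrite -ltey => Sfin.
  have fS : mu p S \is a fin_num by rewrite ge0_fin_numE.
  suff : (mu eta E <= (2 / a * (4 * fine (mu p S)))%:E)%E by rewrite Einf leye_eq.
  apply: (mu_fatou eta1 w'eta mE) => n; have /andP[d1 d2] := D' n.
  have dp : 0 < radial_quotient f p (n + N) by lra.
  have := muz_le (n + N); rewrite mu_radial -(fineK fS) -EFinM -/(w' n) => h.
  have fw : mu (w' n) E \is a fin_num.
    rewrite ge0_fin_numE ?mu_ge0 // ltey; apply/eqP => k.
    by move: h; rewrite k gt0_muley ?lte_fin.
  move: h; rewrite -(fineK fw) -EFinM !lee_fin => h.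
  have m0 : 0 <= fine (mu (w' n) E) by rewrite fine_ge0 ?mu_ge0.
  have h' := ler_wpM2r m0 d1.
  rewrite mulrC -ler_pdivrMr ?divr_gt0 // invf_div mulrC.
  exact: le_trans h' h.
rewrite -ltey => Efin; have fE : mu eta E \is a fin_num by rewrite ge0_fin_numE.
have Sfin : (mu p S < +oo)%E.
  apply: (@le_lt_trans _ _ (2 * a * ((1 + K) ^+ 2 * fine (mu eta E)))%:E); last exact: ltry.
  apply: (mu_fatou p1 z'p mS) => n; have /andP[d1 d2] := D' n.
  rewrite /z' mu_radial -/(w' n) [leRHS]EFinM; apply: lee_pmul.
  - by rewrite lee_fin; lra.
  - exact: mu_ge0.
  - by rewrite lee_fin.
  - rewrite EFinM fineK //; apply: mu_le => //; [exact: w1|exact: ltW].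
have l1 := mu_cvg p1 z'p mS SU ler01 (fun n => z1 (n + N)) (fun n => z_stolz (n + N)) Sfin.
have l2 := mu_cvg eta1 w'eta mE EU (ltW K0) (fun n => w1 (n + N)) w'K Efin.
have l3 : mu (z' n) S @[n --> \oo] --> (a%:E * mu eta E)%E.
  rewrite (_ : (fun n => _) = (fun n => (radial_quotient f p (n + N))%:E * mu (w' n) E)%E); last first.
    by apply/funext => n; rewrite /z' mu_radial.
  apply: cvgeM; [exact: mule_def_fin| |exact: l2].
  by apply: cvg_EFin; [exact: nearW|exact: D'a].
exact: (cvg_unique (@ereal_hausdorff R) l1 l3).
Qed.

Lemma mu_preimage_infinite : abs_angular_derivative f p = +oo%E ->
  (0 < mu eta E)%E -> mu p S = +oo%E.
Proof.
move=> finf muE; apply: contrapT => /eqP; rewrite -ltey => Sfin.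
have fS : mu p S \is a fin_num by rewrite ge0_fin_numE ?mu_ge0.
have lE : (0 < lam E)%E.
  rewrite lt0e measure_ge0 andbT; apply/eqP => E0.
  by move: muE; rewrite mu_null // ltxx.
have flE : lam E \is a fin_num by exact: circle_measure_fin_num.
have l0 : 0 < fine (lam E) by rewrite fine_gt0 // lE ltey_eq flE.
(* The lower bound [lam E / 4] and the upper bound [4 * mu p S] would force
   [M * lam E <= 16 * mu p S]; the added 1 contradicts this. *)
pose M := 16 * fine (mu p S) / fine (lam E) + 1.
have [N /(_ N (leqnn N)) HN] := infinite_angular_derivative f_self p1 eta1 w_eta M finf.
have B0 : 0 <= fine (mu p S) by rewrite fine_ge0 ?mu_ge0.
have M0 : 0 <= M by rewrite /M addr_ge0 // divr_ge0 ?mulr_ge0 // ltW.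
have := muz_le N; rewrite mu_radial -(fineK fS) -EFinM => h.
have q : ((4^-1)%:E * lam E <= mu (w N) E)%E.
  apply: (@mu_ge_quarter _ (w N) p) => //; first exact/ltW/w1.
  move=> x Ex _; apply/eqP => xw; have := w1 N; rewrite -xw.
  by rewrite ((unit_circleE x).1 (EU Ex)) ltxx.
have : (M%:E * ((4^-1)%:E * lam E) <= (4 * fine (mu p S))%:E)%E.
  apply: le_trans h; apply: lee_pmul => //; rewrite ?lee_fin //.
  by apply: mule_ge0; rewrite ?lee_fin ?measure_ge0.
rewrite -(fineK flE) -!EFinM lee_fin /M.
have -> : (16 * fine (mu p S) / fine (lam E) + 1) * (4^-1 * fine (lam E)) =
  4 * fine (mu p S) + fine (lam E) / 4 by field; rewrite gt_eqF.
by have l4 : 0 < fine (lam E) / 4; [rewrite divr_gt0 | lra].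
Qed.

(** All these measures vanish on the sets of zero length and on no others, so the invariance at the
    single interior point [z 0] decides. *)
Lemma mu_preimage_null : mu eta E = 0%E -> mu p S = 0%E.
Proof.
move=> E0.
have lE : lam E = 0%E.
  apply/eqP; rewrite eq_le measure_ge0 andbT.
  have : ((4^-1)%:E * lam E <= mu eta E)%E.
    apply: (@mu_ge_quarter _ eta eta) => //; first by rewrite eta1.
    by move=> x _ /eqP.
  by rewrite E0 pmule_rle0 // lte_fin invr_gt0.
have S0 : mu (z 0) S = 0%E by rewrite mu_radial mu_null // mule0.
apply: mu_null => //; apply/eqP; rewrite eq_le measure_ge0 andbT.
have : ((4^-1)%:E * lam S <= mu (z 0) S)%E.
  apply: (@mu_ge_quarter _ (z 0) p) => //; first exact/ltW/z1.
  move=> x Sx _; apply/eqP => xz; have := z1 0; rewrite -xz.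
  by rewrite ((unit_circleE x).1 (SU Sx)) ltxx.
by rewrite S0 pmule_rle0 // lte_fin invr_gt0.
Qed.

End fatou_point.

Theorem theorem1 (R : realType) (f : Cplx R -> Cplx R) (p : Cplx R) :
  inner f -> boundary_Fatou_point f p ->
  ((abs_angular_derivative f p < +oo)%E ->
   forall E : set (Cplx R), lebesgue_measurable E ->
     lebesgue_measurable (boundary_preimage f E) /\
     mu p (boundary_preimage f E) =
       (abs_angular_derivative f p * mu (radial_limit f p) E)%E) /\
  (abs_angular_derivative f p = +oo%E ->
   forall E : set (Cplx R), lebesgue_measurable E ->
     [/\ lebesgue_measurable (boundary_preimage f E),
         (0 < mu (radial_limit f p) E)%E ->
           mu p (boundary_preimage f E) = +oo%E
       & mu (radial_limit f p) E = 0%E ->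
           mu p (boundary_preimage f E) = 0%E]).
Proof.
move=> fi pF.
have lS E : lebesgue_measurable E -> lebesgue_measurable (boundary_preimage f E).
  move=> [EU mE]; split; first by move=> x [].
  exact: (measurable_boundary_preimage fi pF mE EU).
split=> fp E lE; have [EU mE] := lE.
- split; first exact: lS.
  exact: mu_preimage_finite.
- split; first exact: lS.
  + exact: mu_preimage_infinite.
  + exact: mu_preimage_null.
Qed.
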